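(* Let $G$ be a connected SVD-closed subgroup of $U_n$ with Lie algebra $\mathfrak{g}\subseteq\mathfrak{u}_n$. Let $P_0,P_1\in G$ and let $\mu_1,\dots,\mu_n$ be the $n$ eigenvalues of $P_0^*P_1$. Then: (a) $d(P_0,P_1)=\sqrt{\sum_{j=1}^n|\log(\mu_j)|^2}$; (b) the map $X\mapsto\gamma(t):=P_0\exp(tX)$ $(0\le t\le1)$ is a bijection from $\mathfrak{g}\text{-}plog(P_0^*P_1)$ onto the set of minimizing geodesic segments of $(G,\phi)$ with endpoints $P_0$ and $P_1$.
   Context: $U_n$ is the group of $n\times n$ complex unitary matrices, $\mathfrak{u}_n$ the real Lie algebra of $n\times n$ skew-hermitian matrices. For $z\in\mathbb{C}\setminus\{0\}$, $\log(z)$ is the complex logarithm of $z$ with imaginary part in $(-\pi,\pi]$. Eigenvalues are listed with multiplicity. Frobenius metric: $\phi(A,B):=Re(tr(AB^* ))$ is the Frobenius scalar product on $\mathfrak{gl}_n(\mathbb{C})$; for a closed subgroup $G$ of $U_n$, $\phi$ also denotes the (bi-invariant) Riemannian metric on $G$ obtained by restricting this scalar product to the tangent spaces of $G$. $d$ is the distance on $G$ induced by $\phi$. Geodesic segments from $P_0$ to $P_1$ are parametrized on $[0,1]$. SVD-closure: A non-empty family $A_1,\dots,A_p$ of non-zero matrices of $\mathfrak{gl}_n(\mathbb{C})$ is an SVD-system if $A_h^*A_j=A_hA_j^*=0$ for every $h\neq j$ and $A_jA_j^*A_j=A_j$ for every $j$. Every $M\in\mathfrak{gl}_n(\mathbb{C})\setminus\{0\}$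 has a unique SVD-decomposition $M=\sum_{j=1}^p\sigma_jA_j$, where $A_1,\dots,A_p$ is an SVD-system and $\sigma_1>\dots>\sigma_p>0$; the $A_j$ are the SVD-components of $M$. A real Lie subalgebra $\mathfrak{g}$ of $\mathfrak{gl}_n(\mathbb{C})$ is SVD-closed if all SVD-components of every matrix of $\mathfrak{g}\setminus\{0\}$ belong to $\mathfrak{g}$. A subgroup of $GL_n(\mathbb{C})$ is SVD-closed if it is closed in $GL_n(\mathbb{C})$ and its Lie algebra is SVD-closed. Generalized principal logarithms: if $G$ is a connected closed subgroup of $GL_n(\mathbb{C})$ with Lie algebra $\mathfrak{g}$ and $M\in G$, then $\mathfrak{g}\text{-}plog(M)$ is the set of all $L\in\mathfrak{g}$ such that $\exp(L)=M$ and $-\pi\le Im(\lambda)\le\pi$ for every eigenvalue $\lambda$ of $L$. *)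

(* Defs.v *)
From HB Require Import structures.
From mathcomp Require Import all_boot all_order all_algebra.
From mathcomp Require Import all_classical all_reals all_analysis complex.

Set Implicit Arguments.
Unset Strict Implicit.
Unset Printing Implicit Defensive.

Import Order.TTheory GRing.Theory Num.Theory.
Import numFieldNormedType.Exports.

Local Open Scope classical_set_scope.
Local Open Scope ring_scope.
Local Open Scope complex_scope.
Local Open Scope sesquilinear_scope.

Section ComplexScalars.
Variable R : realType.

Definition cexp (z : R[i]) : R[i] :=
  (expR (complex.Re z) * cos (complex.Im z)) +i*
  (expR (complex.Re z) * sin (complex.Im z)).

(* Relevant only for z <> 0, where the set below is a singleton; clog 0 is the
   default value 0. *)
Definition clog (z : R[i]) : R[i] :=
  xget 0 [set w | cexp w = z /\ - pi < complex.Im w <= pi].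

End ComplexScalars.

Section Matrices.
Variables (R : realType) (n : nat).
Local Notation M := 'M[R[i]]_n.
(* Same matrices as M; R[i]^o carries the topology of the complex modulus. *)
Local Notation Mtop := 'M[R[i]^o]_n.

Definition expm (A : M) : M :=
  lim (((fun N => \sum_(k < N) (k`!%:R^-1 : R[i]) *: A ^+ k) : nat -> Mtop) @ \oo).

Definition frob (A B : M) : R := complex.Re (\tr (A *m B^t*)).

Definition GL_subgroup (G : set M) : Prop :=
  [/\ G `<=` [set A | A \in unitmx], G 1%:M,
      (forall A B, G A -> G B -> G (A *m B)) &
      (forall A, G A -> G (invmx A))].

Definition closed_in_GL (G : set M) : Prop :=
  exists2 F : set Mtop, closed F & G = F `&` [set A | A \in unitmx].

Definition lie_algebra (G : set M) : set M :=
  [set X | forall t : R, G (expm (t%:C *: X))].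

Definition svd_system (p : nat) (A : 'I_p -> M) : Prop :=
  [/\ (0 < p)%N, (forall j, A j != 0),
      (forall h j, h != j -> (A h)^t* *m A j = 0 /\ A h *m (A j)^t* = 0) &
      (forall j, A j *m (A j)^t* *m A j = A j)].

Definition svd_decomposition (X : M) (p : nat) (sigma : 'I_p -> R)
    (A : 'I_p -> M) : Prop :=
  [/\ svd_system A, (forall h j : 'I_p, (h < j)%N -> sigma j < sigma h),
      (forall j, 0 < sigma j) & X = \sum_(j < p) (sigma j)%:C *: A j].

Definition svd_component (X B : M) : Prop :=
  exists (p : nat) (sigma : 'I_p -> R) (A : 'I_p -> M),
    svd_decomposition X sigma A /\ exists j, B = A j.

Definition svd_closed_algebra (g : set M) : Prop :=
  forall X B, g X -> X != 0 -> svd_component X B -> g B.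

Definition svd_closed_subgroup (G : set M) : Prop :=
  [/\ GL_subgroup G, closed_in_GL G & svd_closed_algebra (lie_algebra G)].

Definition plog (g : set M) (P : M) : set M :=
  [set L | [/\ g L, expm L = P &
    forall l, eigenvalue L l -> - pi <= complex.Im l <= pi]].

(* Curves are functions on the whole real line, of which only the restriction
   to [0, 1] matters. Since every C^k map on a compact interval extends to a C^k
   map on R, no one-sided derivatives are needed. *)
Definition deriv_curve (c : R -> M) (t : R) : M :=
  \matrix_(i, j) (derive1 (fun s => complex.Re (c s i j)) t +i*
                  derive1 (fun s => complex.Im (c s i j)) t).

Definition C1_real (f : R -> R) : Prop :=
  (forall t, derivable f t 1) /\ continuous (derive1 f).

Definition C1_curve (c : R -> M) : Prop :=
  forall i j, C1_real (fun s => complex.Re (c s i j)) /\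
              C1_real (fun s => complex.Im (c s i j)).

Definition C2_curve (c : R -> M) : Prop :=
  C1_curve c /\ C1_curve (deriv_curve c).

Definition piecewise_C1 (c : R -> M) : Prop :=
  exists (k : nat) (t : nat -> R),
    [/\ t 0%N = 0, t k = 1 &
        forall i, (i < k)%N -> t i < t i.+1 /\
          exists2 b, C1_curve b & {in `[t i, t i.+1], c =1 b}].

Definition curve_in (G : set M) (c : R -> M) : Prop :=
  forall t, t \in `[0, 1] -> G (c t).

(* The derivative of a piecewise C^1 curve may be meaningless at the break
   points and at 0 and 1; this finite set is negligible in the integral. *)
Definition curve_length (c : R -> M) : R :=
  \int[lebesgue_measure]_(t in `[0, 1])
    Num.sqrt (frob (deriv_curve c t) (deriv_curve c t)).

Definition riem_dist (G : set M) (P Q : M) : R :=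
  inf [set curve_length c | c in
    [set c | [/\ piecewise_C1 c, curve_in G c, c 0 = P & c 1 = Q]]].

Definition tangent_space (G : set M) (P : M) : set M :=
  [set deriv_curve c 0 | c in
    [set c | [/\ C1_curve c, c 0 = P & \forall t \near (0 : R), G (c t)]]].

(* The metric on G is induced by the flat metric [frob] of the ambient matrix
   space, so the Levi-Civita covariant derivative of c' along c is the
   orthogonal projection of c'' onto the tangent space of G. *)
Definition geodesic (G : set M) (c : R -> M) : Prop :=
  [/\ C2_curve c, curve_in G c &
      forall t, t \in `[0, 1] -> forall Z, tangent_space G (c t) Z ->
        frob (deriv_curve (deriv_curve c) t) Z = 0].

Definition minimizing_geodesic (G : set M) (P Q : M) : set (R -> M) :=
  [set c | [/\ geodesic G c, c 0 = P, c 1 = Q &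
               curve_length c = riem_dist G P Q]].

Definition segment (c : R -> M) : `[0 : R, 1]%classic -> M :=
  sigL `[0, 1]%classic c.

End Matrices.

(* Main.v *)
(** The length of X in g-plog (P0^* P1) is sqrt (sum |log mu_j|^2), and geodesics of
    the bi-invariant metric are the curves t |-> P0 exp (tX), since c^* c' is constant
    along a geodesic c; two points remain.

    Existence of X: exp g is compact, hence closed. It is also open in G: if M is the
    point of exp g closest to a nearby Q in G, write Q = M e^B with B small in g.
    Moving M by conjugations gives M B = B M, and choosing the logarithm X of M whose
    orbit under the centraliser of M is best aligned with B gives X B = B X, so that
    Q = e^(X + B). By SVD-closedness, odd functions of X stay in g, so the
    eigenangles of X can be reduced modulo 2 pi to [-pi, pi].

    Lower bound: in an orthonormal eigenbasis v_j of P0^* P1, the unit vector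
    P0^* c(t) v_j turns through an angle at least |log mu_j|; Cauchy-Schwarz with
    weights |log mu_j| combines these bounds. To avoid the singularity of acos at 1 and
    -1, the angle acos x is replaced by acos (lam x), and lam tends to 1. *)
Require Import Defs.
From HB Require Import structures.
From mathcomp Require Import all_boot all_order all_algebra.
From mathcomp Require Import all_classical all_reals all_analysis complex.
From mathcomp Require Import measurable_realfun ring lra.

Set Implicit Arguments.
Unset Strict Implicit.
Unset Printing Implicit Defensive.

Import Order.TTheory GRing.Theory Num.Theory.
Import numFieldNormedType.Exports Normc.

Local Open Scope classical_set_scope.
Local Open Scope ring_scope.
Local Open Scope complex_scope.
Local Open Scope sesquilinear_scope.

(** Everything rests on estimates in the Frobenius norm, above all that [A -> e^A - A] has Lipschitz
    constant [e^r - 1] on the ball of radius [r]. Unitary factors do not amplify errors, so powers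
    of an approximate one-parameter step stay close to the exponential; this gives the closed
    subgroup theorem, and minimising over a compact ball of the Lie algebra gives local logarithms.

    Two optimisations are made because criticality of the distance only shows that [B] commutes with
    [M = e^X]. It need not commute with [X] when distinct eigenangles of [X] differ by a multiple of
    2 pi, whereas [e^X e^B = e^(X + B)] is derived from [X B = B X]. Hence [X] is moved along its
    orbit under the centraliser of [M], which leaves [M] unchanged.

    All minimisers come from principal logarithms because [acos (cos x)] is the distance from [x] to
    the multiples of 2 pi: a logarithm in g has norm at least [sqrt (sum |log mu_j|^2)], with
    equality exactly when its eigenangles all lie in [-pi, pi]. *)

(* [ip], [fnorm], [mexp], [udiag] and [speed] are sealed because unification otherwise
   unfolds them down to limits and integrals. *)
HB.lock Definition ip (R : realType) m n (A B : 'M[R[i]]_(m, n)) : R :=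
  complex.Re (\tr (A *m B^t*)).

HB.lock Definition fnorm (R : realType) m n (A : 'M[R[i]]_(m, n)) : R :=
  Num.sqrt (ip A A).

(** * The real inner product [Re tr (A B^*] [)] and its norm *)

Section FrobeniusNorm.
Variable R : realType.
Local Notation C := R[i].
Local Notation Re := complex.Re.
Local Notation Im := complex.Im.

Lemma ReD (x y : C) : Re (x + y) = Re x + Re y. Proof. by case: x; case: y. Qed.
Lemma ImD (x y : C) : Im (x + y) = Im x + Im y. Proof. by case: x; case: y. Qed.
Lemma ReN (x : C) : Re (- x) = - Re x. Proof. by case: x. Qed.
Lemma ImN (x : C) : Im (- x) = - Im x. Proof. by case: x. Qed.
Lemma ReB (x y : C) : Re (x - y) = Re x - Re y. Proof. by rewrite ReD ReN. Qed.
Lemma ImB (x y : C) : Im (x - y) = Im x - Im y. Proof. by rewrite ImD ImN. Qed.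
Lemma ReM (x y : C) : Re (x * y) = Re x * Re y - Im x * Im y.
Proof. by case: x; case: y. Qed.
Lemma ImM (x y : C) : Im (x * y) = Re x * Im y + Im x * Re y.
Proof. by case: x; case: y. Qed.
Lemma ReZ (a : R) (x : C) : Re (a%:C * x) = a * Re x.
Proof. by rewrite ReM /= mul0r subr0. Qed.
Lemma ImZ (a : R) (x : C) : Im (a%:C * x) = a * Im x.
Proof. by rewrite ImM /= mul0r addr0. Qed.
Lemma ReJ (x : C) : Re (x^*)%R = Re x. Proof. by case: x. Qed.
Lemma ImJ (x : C) : Im (x^*)%R = - Im x. Proof. by case: x. Qed.
Lemma Re_sum I (r : seq I) (P : pred I) (F : I -> C) :
  Re (\sum_(i <- r | P i) F i) = \sum_(i <- r | P i) Re (F i).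
Proof. exact: (big_morph _ ReD erefl). Qed.
Lemma Im_sum I (r : seq I) (P : pred I) (F : I -> C) :
  Im (\sum_(i <- r | P i) F i) = \sum_(i <- r | P i) Im (F i).
Proof. exact: (big_morph _ ImD erefl). Qed.
Lemma complex_eq (x y : C) : Re x = Re y -> Im x = Im y -> x = y.
Proof. by case: x; case: y => /= ? ? ? ? -> ->. Qed.
Lemma conjR (a : R) : ((a%:C)^*)%R = a%:C :> C.
Proof. by apply: complex_eq; rewrite ?ReJ ?ImJ //= oppr0. Qed.

Lemma adjE m n (A : 'M[C]_(m, n)) i j : A^t* i j = ((A j i)^*)%R.
Proof. by rewrite !mxE. Qed.

Lemma adjM m n p (A : 'M[C]_(m, n)) (B : 'M[C]_(n, p)) :
  (A *m B)^t* = B^t* *m A^t*.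
Proof. by rewrite trmx_mul map_mxM. Qed.

Lemma adjD m n (A B : 'M[C]_(m, n)) : (A + B)^t* = A^t* + B^t*.
Proof. by apply/matrixP => i j; rewrite !mxE rmorphD. Qed.

Lemma adjN m n (A : 'M[C]_(m, n)) : (- A)^t* = - A^t*.
Proof. by apply/matrixP => i j; rewrite !mxE rmorphN. Qed.

Lemma adjB m n (A B : 'M[C]_(m, n)) : (A - B)^t* = A^t* - B^t*.
Proof. by rewrite adjD adjN. Qed.

Lemma adjZ m n (a : R) (A : 'M[C]_(m, n)) : (a%:C *: A)^t* = a%:C *: A^t*.
Proof. by apply/matrixP => i j; rewrite !mxE rmorphM /= conjR. Qed.

Lemma adj1 n : (1%:M : 'M[C]_n)^t* = 1%:M.
Proof. by rewrite trmx1 map_mx1. Qed.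

Lemma ipE m n (A B : 'M[C]_(m, n)) :
  ip A B = \sum_i \sum_j (Re (A i j) * Re (B i j) + Im (A i j) * Im (B i j)).
Proof.
rewrite !ip.unlock /mxtrace Re_sum; apply: eq_bigr => i _.
rewrite mxE Re_sum; apply: eq_bigr => j _.
by rewrite adjE ReM ReJ ImJ mulrN opprK.
Qed.

Lemma ipC m n (A B : 'M[C]_(m, n)) : ip A B = ip B A.
Proof.
by rewrite !ipE; apply: eq_bigr => i _; apply: eq_bigr => j _; rewrite mulrC [X in _ + X]mulrC.
Qed.

Lemma ipDl m n (A B D : 'M[C]_(m, n)) : ip (A + B) D = ip A D + ip B D.
Proof. by rewrite !ip.unlock mulmxDl linearD ReD. Qed.
Lemma ipNl m n (A B : 'M[C]_(m, n)) : ip (- A) B = - ip A B.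
Proof. by rewrite !ip.unlock mulNmx linearN ReN. Qed.
Lemma ipZl m n a (A B : 'M[C]_(m, n)) : ip (a%:C *: A) B = a * ip A B.
Proof. by rewrite !ip.unlock -scalemxAl linearZ ReZ. Qed.
Lemma ipDr m n (A B D : 'M[C]_(m, n)) : ip D (A + B) = ip D A + ip D B.
Proof. by rewrite ipC ipDl; congr (_ + _); exact: ipC. Qed.
Lemma ipNr m n (A B : 'M[C]_(m, n)) : ip A (- B) = - ip A B.
Proof. by rewrite ipC ipNl ipC. Qed.
Lemma ipZr m n a (A B : 'M[C]_(m, n)) : ip A (a%:C *: B) = a * ip A B.
Proof. by rewrite ipC ipZl ipC. Qed.
Lemma ipBl m n (A B D : 'M[C]_(m, n)) : ip (A - B) D = ip A D - ip B D.
Proof. by rewrite ipDl ipNl. Qed.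
Lemma ipBr m n (A B D : 'M[C]_(m, n)) : ip D (A - B) = ip D A - ip D B.
Proof. by rewrite ipDr ipNr. Qed.

Lemma ipMl m n p (A : 'M[C]_(m, n)) (B : 'M[C]_(n, p)) D :
  ip (A *m B) D = ip B (A^t* *m D).
Proof. by rewrite !ip.unlock adjM trmxCK -mulmxA mxtrace_mulC mulmxA. Qed.

Lemma ipMr m n p (A : 'M[C]_(m, n)) (B : 'M[C]_(n, p)) D :
  ip (A *m B) D = ip A (D *m B^t*).
Proof. by rewrite !ip.unlock adjM trmxCK -mulmxA. Qed.

Lemma ip_adj m n (A B : 'M[C]_(m, n)) : ip (A^t*) (B^t*) = ip A B.
Proof.
rewrite !ipE exchange_big /=; apply: eq_bigr => i _; apply: eq_bigr => j _.
by rewrite !adjE !ReJ !ImJ mulrNN.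
Qed.

Lemma ip_ge0 m n (A : 'M[C]_(m, n)) : 0 <= ip A A.
Proof.
rewrite ipE; apply: sumr_ge0 => i _; apply: sumr_ge0 => j _.
by rewrite -!expr2 addr_ge0 ?sqr_ge0.
Qed.

Lemma fnorm_ge0 m n (A : 'M[C]_(m, n)) : 0 <= fnorm A.
Proof. by rewrite fnorm.unlock sqrtr_ge0. Qed.

Lemma fnorm_sqr m n (A : 'M[C]_(m, n)) : fnorm A ^+ 2 = ip A A.
Proof. by rewrite fnorm.unlock sqr_sqrtr ?ip_ge0. Qed.

Lemma normc_fnorm m n (A : 'M[C]_(m, n)) i j : normc (A i j) <= fnorm A.
Proof.
rewrite -(ler_pXn2r (n := 2)) ?nnegrE ?fnorm_ge0 //; last first.
  by case: (A i j) => a b /=; exact: sqrtr_ge0.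
rewrite fnorm_sqr ipE (bigD1 i) //= (bigD1 j) //=.
have ->: normc (A i j) ^+ 2 = Re (A i j) * Re (A i j) + Im (A i j) * Im (A i j).
  by case: (A i j) => a b /=; rewrite sqr_sqrtr ?addr_ge0 ?sqr_ge0 // !expr2.
rewrite -addrA lerDl addr_ge0 //; apply: sumr_ge0 => k _; last first.
  by apply: sumr_ge0 => l _; rewrite -!expr2 addr_ge0 ?sqr_ge0.
by rewrite -!expr2 addr_ge0 ?sqr_ge0.
Qed.

Lemma normc_ge0 (x : C) : 0 <= normc x.
Proof. by case: x => a b /=; exact: sqrtr_ge0. Qed.

Lemma normc_sqr (x : C) : normc x ^+ 2 = Re x ^+ 2 + Im x ^+ 2.
Proof. by case: x => a b /=; rewrite sqr_sqrtr ?addr_ge0 ?sqr_ge0. Qed.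

Lemma ler_Re_normc (x : C) : `|Re x| <= normc x.
Proof.
rewrite -(ler_pXn2r (n := 2)) ?nnegrE ?normc_ge0 //.
by rewrite normc_sqr real_normK ?num_real // lerDl sqr_ge0.
Qed.

Lemma ler_Im_normc (x : C) : `|Im x| <= normc x.
Proof.
rewrite -(ler_pXn2r (n := 2)) ?nnegrE ?normc_ge0 //.
by rewrite normc_sqr real_normK ?num_real // lerDr sqr_ge0.
Qed.

Lemma normc_leD (x : C) : normc x <= `|Re x| + `|Im x|.
Proof.
rewrite -(ler_pXn2r (n := 2)) ?nnegrE ?normc_ge0 ?addr_ge0 //.
rewrite normc_sqr sqrrD !real_normK ?num_real //.
by rewrite addrAC lerDl mulrn_wge0 // mulr_ge0.
Qed.

Lemma fnorm_sqr_sum m n (A : 'M[C]_(m, n)) :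
  fnorm A ^+ 2 = \sum_i \sum_j normc (A i j) ^+ 2.
Proof.
rewrite fnorm_sqr ipE; apply: eq_bigr => i _; apply: eq_bigr => j _.
by rewrite normc_sqr !expr2.
Qed.

Lemma fnorm_eq0 m n (A : 'M[C]_(m, n)) : fnorm A = 0 -> A = 0.
Proof.
move=> A0; apply/matrixP => i j; rewrite mxE; apply: eq0_normc.
by apply/eqP; rewrite eq_le normc_ge0 andbT -A0 normc_fnorm.
Qed.

Lemma ip_eq0 m n (A : 'M[C]_(m, n)) : ip A A = 0 -> A = 0.
Proof. by move=> A0; apply: fnorm_eq0; rewrite fnorm.unlock A0 sqrtr0. Qed.

Lemma fnorm0 m n : fnorm (0 : 'M[C]_(m, n)) = 0.
Proof. by rewrite fnorm.unlock ip.unlock mul0mx linear0 sqrtr0. Qed.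

Lemma fnormN m n (A : 'M[C]_(m, n)) : fnorm (- A) = fnorm A.
Proof. by rewrite !fnorm.unlock ipNl ipNr opprK. Qed.

Lemma fnorm_distC m n (A B : 'M[C]_(m, n)) : fnorm (A - B) = fnorm (B - A).
Proof. by rewrite -fnormN opprB. Qed.

Lemma fnormZ m n (a : R) (A : 'M[C]_(m, n)) : fnorm (a%:C *: A) = `|a| * fnorm A.
Proof.
by rewrite !fnorm.unlock ipZl ipZr mulrA -expr2 sqrtrM ?sqr_ge0 // sqrtr_sqr.
Qed.

(** For [c > 0] the quadratic is evaluated at its minimum [- b / c]; the cases [c < 0], and [c = 0]
    with [b != 0], are excluded by a value of [t] that makes it negative. *)
Lemma discriminant_le (a b c : R) :
  (forall t, 0 <= a + 2 * t * b + t ^+ 2 * c) -> b ^+ 2 <= a * c.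
Proof.
move=> h; have a0 : 0 <= a by have := h 0; rewrite !(mulr0, mul0r, expr0n, addr0).
have c0 : 0 <= c.
  rewrite leNgt; apply/negP => c0.
  (* The values at [t] and [- t] are added to cancel the linear term. This [t] is at least 1 and
     [t * - c] exceeds [a], so [a + t^2 c] is negative. *)
  have := h ((1 + a + b ^+ 2) / - c + 1); have := h (- ((1 + a + b ^+ 2) / - c + 1)).
  set t := (_ / _ + 1) => h1 h2.
  have t1 : 1 <= t.
    by rewrite /t lerDr divr_ge0 ?oppr_ge0 ?(ltW c0)// ?addr_ge0 ?sqr_ge0.
  have tc : t * - c = (1 + a + b ^+ 2) - c.
    by rewrite /t mulrDl mul1r divfK // oppr_eq0 lt_eqF.
  have : a - t * (t * - c) >= 0 by move: h1 h2; rewrite sqrrN expr2; lra.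
  have b2 := sqr_ge0 b.
  have : t * - c <= t * (t * - c) by apply: ler_peMl => //; rewrite tc; lra.
  by rewrite tc; lra.
have [c_eq0|c_neq0] := eqVneq c 0.
  have [->|b0] := eqVneq b 0; first by rewrite expr0n c_eq0 mulr0.
  have := h (- (a + 1) / b); rewrite c_eq0 mulr0 addr0 -mulrA divfK //; lra.
have cp : 0 < c by rewrite lt_def c_neq0.
have := h (- b / c); set t := - b / c.
have tc : t * c = - b by rewrite /t divfK.
have -> : t ^+ 2 * c = t * - b by rewrite expr2 -mulrA tc.
have bt : b = - (t * c) by rewrite tc opprK.
move=> h1; have h2 : 0 <= (a + t * b) * c by apply: mulr_ge0; [lra|exact: ltW].
by move: h2; rewrite mulrDl mulrAC tc expr2 mulNr; lra.
Qed.

Lemma ip_CauchySchwarz m n (A B : 'M[C]_(m, n)) : `|ip A B| <= fnorm A * fnorm B.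
Proof.
rewrite -(ler_pXn2r (n := 2)) ?nnegrE ?mulr_ge0 ?fnorm_ge0 //.
rewrite real_normK ?num_real // exprMn !fnorm_sqr; apply: discriminant_le => t.
have := ip_ge0 (A + t%:C *: B).
rewrite ipDl !ipDr !ipZl !ipZr (ipC B A).
by move: (ip A A) (ip A B) (ip B B) => a b c; rewrite expr2; lra.
Qed.

Lemma ip_le m n (A B : 'M[C]_(m, n)) : ip A B <= fnorm A * fnorm B.
Proof. exact: le_trans (ler_norm _) (ip_CauchySchwarz _ _). Qed.

Lemma fnormD m n (A B : 'M[C]_(m, n)) : fnorm (A + B) <= fnorm A + fnorm B.
Proof.
rewrite -(ler_pXn2r (n := 2)) ?nnegrE ?addr_ge0 ?fnorm_ge0 //.
rewrite sqrrD !fnorm_sqr ipDl !ipDr (ipC B A).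
by rewrite mulr2n !addrA lerD2r -!addrA lerD2l lerD ?ip_le.
Qed.

Lemma fnormB m n (A B : 'M[C]_(m, n)) : fnorm (A - B) <= fnorm A + fnorm B.
Proof. by rewrite -(fnormN B) fnormD. Qed.

Lemma fnorm_dist m n (A B D : 'M[C]_(m, n)) :
  fnorm (A - D) <= fnorm (A - B) + fnorm (B - D).
Proof. by apply: le_trans (fnormD _ _); rewrite addrA subrK. Qed.

Lemma fnorm_lerB m n (A B : 'M[C]_(m, n)) : fnorm A - fnorm B <= fnorm (A - B).
Proof. by rewrite lerBlDr; apply: le_trans (fnormD _ _); rewrite subrK. Qed.

Lemma fnorm_sum m n I (r : seq I) (P : pred I) (F : I -> 'M[C]_(m, n)) :
  fnorm (\sum_(i <- r | P i) F i) <= \sum_(i <- r | P i) fnorm (F i).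
Proof.
elim/big_rec2: _ => [|i y x _ h]; first by rewrite fnorm0.
by apply: le_trans (fnormD _ _) _; rewrite lerD2l.
Qed.

Lemma sqr_sum_le (I : finType) (x y : I -> R) :
  (\sum_i x i * y i) ^+ 2 <= (\sum_i x i ^+ 2) * (\sum_i y i ^+ 2).
Proof.
apply: discriminant_le => t.
suff -> : \sum_i x i ^+ 2 + 2 * t * (\sum_i x i * y i) + t ^+ 2 * (\sum_i y i ^+ 2)
   = \sum_i (x i + t * y i) ^+ 2 by apply: sumr_ge0 => i _; exact: sqr_ge0.
rewrite !mulr_sumr -!big_split /=; apply: eq_bigr => i _; ring.
Qed.

Lemma normcD (x y : C) : normc (x + y) <= normc x + normc y.
Proof. exact: le_normcD. Qed.

Lemma normc_sum I (r : seq I) (P : pred I) (F : I -> C) :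
  normc (\sum_(i <- r | P i) F i) <= \sum_(i <- r | P i) normc (F i).
Proof.
elim/big_rec2: _ => [|i y x _ h]; first by rewrite normc0.
by apply: le_trans (normcD _ _) _; rewrite lerD2l.
Qed.

Lemma fnormM m n p (A : 'M[C]_(m, n)) (B : 'M[C]_(n, p)) :
  fnorm (A *m B) <= fnorm A * fnorm B.
Proof.
rewrite -(ler_pXn2r (n := 2)) ?nnegrE ?mulr_ge0 ?fnorm_ge0 // exprMn.
rewrite !fnorm_sqr_sum [X in _ <= _ * X]exchange_big /= mulr_suml.
apply: ler_sum => i _; rewrite mulr_sumr; apply: ler_sum => j _.
apply: le_trans (sqr_sum_le _ _); rewrite ler_pXn2r ?nnegrE ?normc_ge0 //; last first.
  by apply: sumr_ge0 => k _; rewrite mulr_ge0 ?normc_ge0.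
rewrite mxE; apply: le_trans (normc_sum _ _ _) _.
by apply: ler_sum => k _; rewrite normcM.
Qed.

Lemma fnorm_adj m n (A : 'M[C]_(m, n)) : fnorm (A^t*) = fnorm A.
Proof. by rewrite !fnorm.unlock ip_adj. Qed.

Lemma unitary_adjl n (U : 'M[C]_n) : U \is unitarymx -> U^t* *m U = 1%:M.
Proof. by move=> /unitarymxP /mulmx1C. Qed.
Lemma unitary_adjr n (U : 'M[C]_n) : U \is unitarymx -> U *m U^t* = 1%:M.
Proof. by move=> /unitarymxP. Qed.

Lemma ip_unitaryl n p (U : 'M[C]_n) (A B : 'M[C]_(n, p)) :
  U \is unitarymx -> ip (U *m A) (U *m B) = ip A B.
Proof. by move=> hU; rewrite ipMl mulmxA unitary_adjl // mul1mx. Qed.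

Lemma ip_unitaryr n p (U : 'M[C]_n) (A B : 'M[C]_(p, n)) :
  U \is unitarymx -> ip (A *m U) (B *m U) = ip A B.
Proof. by move=> hU; rewrite ipMr -mulmxA unitary_adjr // mulmx1. Qed.

Lemma fnorm_unitaryl n p (U : 'M[C]_n) (A : 'M[C]_(n, p)) :
  U \is unitarymx -> fnorm (U *m A) = fnorm A.
Proof. by move=> hU; rewrite !fnorm.unlock ip_unitaryl. Qed.

Lemma fnorm_unitaryr n p (U : 'M[C]_n) (A : 'M[C]_(p, n)) :
  U \is unitarymx -> fnorm (A *m U) = fnorm A.
Proof. by move=> hU; rewrite !fnorm.unlock ip_unitaryr. Qed.

Lemma unitarymx_adj n (U : 'M[C]_n) : U \is unitarymx -> U^t* \is unitarymx.
Proof. by rewrite trmxC_unitary. Qed.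

Lemma fnorm_conjB n (U A B : 'M[C]_n) : U \is unitarymx ->
  fnorm (U^t* *m A *m U - U^t* *m B *m U) = fnorm (A - B).
Proof.
move=> hU; have -> : U^t* *m A *m U - U^t* *m B *m U = U^t* *m (A - B) *m U.
  by rewrite mulmxBr mulmxBl.
by rewrite (fnorm_unitaryr (U^t* *m (A - B)) hU) (fnorm_unitaryl (A - B) (unitarymx_adj hU)).
Qed.

Lemma unitarymx1 n : (1%:M : 'M[C]_n) \is unitarymx.
Proof. by apply/unitarymxP; rewrite adj1 mulmx1. Qed.

Lemma mxexprS n (A : 'M[C]_n) k : A ^+ k.+1 = A *m A ^+ k.
Proof. exact: exprS. Qed.

Lemma unitarymxX n (U : 'M[C]_n) k : U \is unitarymx -> U ^+ k \is unitarymx.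
Proof.
move=> hU; elim: k => [|k IH]; first exact: unitarymx1.
by rewrite mxexprS; move: (U ^+ k) IH => A hA; apply: (mul_unitarymx hU hA).
Qed.

(** Unitary factors preserve the norm, so the errors of the telescoping sum add up without
    amplification. *)
Lemma fnorm_unitaryX n (U V : 'M[C]_n) k : U \is unitarymx -> V \is unitarymx ->
  fnorm (U ^+ k - V ^+ k) <= k%:R * fnorm (U - V).
Proof.
move=> hU hV; elim: k => [|k IH]; first by rewrite subrr fnorm0 mul0r.
rewrite !mxexprS; move: (U ^+ k) (V ^+ k) (unitarymxX k hV) IH => A B hB IH.
apply: le_trans (fnorm_dist _ (U *m B) _) _.
rewrite -mulmxBr -mulmxBl (fnorm_unitaryl (A - B) hU) (fnorm_unitaryr (U - V) hB).
by rewrite mulrSr mulrDl mul1r lerD2r.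
Qed.

End FrobeniusNorm.

(** * Matrix topology through the Frobenius norm *)

Section MatrixTopology.
Variable R : realType.
Local Notation C := R[i].
Local Notation Re := complex.Re.
Local Notation Im := complex.Im.

Lemma normc_norm (z : C) : `|z| = (normc z)%:C.
Proof. by case: z. Qed.

(** The successor in [(m * n).+1] keeps the inequality strict even when there are no entries; being
    larger than the square root of [m * n], it also spares a root. *)
Lemma fnorm_lt_entries m n (D : 'M[C]_(m, n)) (e : R) : 0 < e ->
  (forall i j, normc (D i j) < e / (m * n).+1%:R) -> fnorm D < e.
Proof.
move=> e0 h; rewrite -(ltr_pXn2r (n := 2)) ?nnegrE ?fnorm_ge0 ?ltW //.
set d := e / _ in h; have d0 : 0 < d by rewrite divr_gt0.
rewrite fnorm_sqr_sum.
apply: (@le_lt_trans _ _ (\sum_(i < m) \sum_(j < n) d ^+ 2)).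
  apply: ler_sum => i _; apply: ler_sum => j _.
  by rewrite ler_pXn2r ?nnegrE ?normc_ge0 ?ltW.
have -> : e = d * (m * n).+1%:R by rewrite /d divfK.
under eq_bigr do rewrite sumr_const card_ord.
rewrite sumr_const card_ord -mulrnA mulnC [ltRHS]exprMn -[ltLHS]mulr_natr.
rewrite ltr_pM2l ?exprn_gt0 //.
apply: (@lt_le_trans _ _ ((m * n).+1%:R)); first by rewrite ltr_nat.
by rewrite expr2 ler_peMr // ler1n.
Qed.

(** The topology on matrices is that of the largest modulus of an entry, and each of the two norms
    bounds the other up to a constant. Through this equivalence, closedness, compactness and
    continuity all become epsilon estimates in [fnorm]. *)
Lemma nbhs_fnormP m n (P : 'M[C^o]_(m, n)) (S : set 'M[C^o]_(m, n)) :
  nbhs P S <-> exists2 e : R, 0 < e & forall Q : 'M[C]_(m, n), fnorm (Q - P) < e -> S Q.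
Proof.
split.
  move=> /nbhs_ballP[e /= e0 PS].
  (* Radii of balls are elements of [R[i]]; a positive one is real. *)
  have eE : e = (Re e)%:C by rewrite RRe_real // gtr0_real.
  have re0 : 0 < Re e by rewrite -ltcR -eE.
  exists (Re e) => // Q PQ; apply: PS; split => // i j.
  rewrite -ball_normE /= eE normc_norm ltcR.
  have -> : P i j - Q i j = (P - Q : 'M[C]_(m, n)) i j by rewrite !mxE.
  by apply: le_lt_trans (normc_fnorm _ _ _) _; rewrite fnorm_distC.
move=> [e e0 PS]; apply/nbhs_ballP.
exists (e / (m * n).+1%:R)%:C; first by rewrite /= ltcR divr_gt0.
move=> Q [_ PQ]; apply: PS; apply: fnorm_lt_entries => // i j.
rewrite -ltcR -normc_norm.
have := PQ i j; rewrite -ball_normE /=.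
by rewrite -normrN opprB !mxE.
Qed.

Definition fclosed m n (K : set 'M[C]_(m, n)) :=
  forall P, (forall e : R, 0 < e -> exists2 Q, K Q & fnorm (Q - P) < e) -> K P.

Lemma closed_fnormP m n (K : set 'M[C^o]_(m, n)) :
  closed K <-> fclosed (K : set 'M[C]_(m, n)).
Proof.
split=> [cK P h|h P cP].
  apply: cK => B /nbhs_fnormP[e e0 PB]; have [Q KQ PQ] := h e e0.
  by exists Q; split => //; exact: PB.
apply: h => e e0.
have /cP[Q [KQ PQ]] : nbhs P [set Q : 'M[C^o]_(m, n) | fnorm ((Q : 'M[C]_(m, n)) - P) < e].
  by apply/nbhs_fnormP; exists e.
by exists Q.
Qed.

Lemma compact_complex_box (r : R) :
  compact [set z : C^o | `|Re z| <= r /\ `|Im z| <= r].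
Proof.
pose f (p : R * R) : C^o := Complex p.1 p.2.
have -> : [set z : C^o | `|Re z| <= r /\ `|Im z| <= r] =
   f @` (`[- r, r]%classic `*` `[- r, r]%classic).
  apply/seteqP; split=> [z [h1 h2]|_ [[a b] [/= h1 h2] <-]] /=; last first.
    by move: h1 h2; rewrite !in_itv /= !ler_norml.
  exists (Re z, Im z); last by case: z {h1 h2}.
  by split; rewrite /= in_itv /= -ler_norml.
apply: continuous_compact; last first.
  by apply: compact_setX; exact: segment_compact.
apply: continuous_subspaceT => p; apply/cvgrPdist_lt => e e0.
have eE : e = (Re e)%:C by rewrite RRe_real // gtr0_real.
have re0 : 0 < Re e by rewrite -ltcR -eE.
have h : \forall q \near p, `|p.1 - q.1| < Re e / 2 /\ `|p.2 - q.2| < Re e / 2.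
  exists (ball p.1 (Re e / 2), ball p.2 (Re e / 2)).
    by split; apply: nbhsx_ballx; rewrite divr_gt0.
  by move=> q []; rewrite -!ball_normE.
apply: filterS h => q [h1 h2]; rewrite eE normc_norm ltcR.
apply: le_lt_trans (normc_leD _) _; rewrite ReB ImB /=.
by rewrite [ltRHS](splitr (Re e)) ltrD.
Qed.

(** Heine-Borel: flattened to row vectors, [K] is a closed part of a product of squares of the
    complex plane, which is compact by [rV_compact]. *)
Lemma compact_fnorm m n (K : set 'M[C^o]_(m, n)) (r : R) :
  closed K -> (forall Q : 'M[C]_(m, n), K Q -> fnorm Q <= r) -> compact K.
Proof.
move=> cK bK.
have := @rV_compact C^o (m * n) (fun _ => [set z : C^o | `|Re z| <= r /\ `|Im z| <= r])
  (fun _ => @compact_complex_box r).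
set B := [set v | _] => cB.
apply: (@subclosed_compact _ _ ((fun v : 'rV[C^o]_(m * n) => vec_mx v : 'M[C^o]_(m, n)) @` B)) => //.
  apply: continuous_compact cB; apply: continuous_subspaceT => v.
  move=> S /nbhs_ballP[e e0 eS]; apply/nbhs_ballP; exists e => // w [_ vw].
  by apply: eS; split => // i j; rewrite !mxE; exact: vw.
move=> Q KQ; exists (mxvec (Q : 'M[C]_(m, n))); last exact: mxvecK.
move=> k /=; case/mxvec_indexP: k => i j; rewrite mxvecE.
have h := normc_fnorm Q i j.
by split; [apply: le_trans (ler_Re_normc _) _|apply: le_trans (ler_Im_normc _) _];
  apply: le_trans h (bK _ KQ).
Qed.

Definition fcontinuous_at m n (F : 'M[C]_(m, n) -> R) P :=
  forall e, 0 < e -> exists2 d, 0 < d & forall Q, fnorm (Q - P) < d -> `|F Q - F P| < e.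

Lemma fnorm_EVT m n (K : set 'M[C]_(m, n)) (r : R) (F : 'M[C]_(m, n) -> R) :
  K !=set0 -> fclosed K -> (forall Q, K Q -> fnorm Q <= r) ->
  (forall P, fcontinuous_at F P) ->
  exists2 P, K P & forall Q, K Q -> F Q <= F P.
Proof.
move=> K0 /closed_fnormP cK bK cF.
have [|P KP maxP] := @compact_EVT_max _ _ (F : 'M[C^o]_(m, n) -> R) _ K0 (compact_fnorm cK bK).
  apply: continuous_subspaceT => P S /nbhs_ballP[e e0 eS].
  have [d d0 h] := cF P e e0; apply/nbhs_fnormP; exists d => // Q PQ.
  by apply: eS; rewrite -ball_normE /= distrC; exact: h.
by exists P => [|Q KQ]; [exact: set_mem|exact/maxP/mem_set].
Qed.

Lemma fnorm_BolzanoWeierstrass m n (u : nat -> 'M[C]_(m, n)) (r : R) :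
  (forall k, fnorm (u k) <= r) ->
  exists Z, forall (e : R) N, 0 < e -> exists2 k, (N <= k)%N & fnorm (u k - Z) < e.
Proof.
move=> bu; pose K := [set Q : 'M[C]_(m, n) | fnorm Q <= r].
have cK : closed (K : set 'M[C^o]_(m, n)).
  apply/closed_fnormP => P h; rewrite /K /=; apply/ler_addgt0Pr => e e0.
  have [Q KQ PQ] := h e e0.
  have h1 : fnorm P - fnorm Q <= fnorm (Q - P) by rewrite fnorm_distC fnorm_lerB.
  by move: h1 PQ (KQ : fnorm Q <= r); move: (fnorm (Q - P)) (fnorm P) (fnorm Q) => ? ? ?; lra.
have [] := @compact_fnorm _ _ _ r cK (fun Q h => h)
  ((u : nat -> 'M[C^o]_(m, n)) @ \oo) _; first by exists 0%N => // k _; exact: bu.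
move=> Z [_ clZ]; exists Z => e N e0.
have [] := clZ (u @` [set k | (N <= k)%N])
  [set Q : 'M[C^o]_(m, n) | fnorm ((Q : 'M[C]_(m, n)) - Z) < e].
- by exists N => // k /= Nk; exists k.
- by apply/nbhs_fnormP; exists e.
by move=> _ [[k Nk <-] h]; exists k.
Qed.

End MatrixTopology.

(** * The matrix exponential *)

HB.lock Definition mexp (R : realType) n (A : 'M[R[i]]_n) : 'M[R[i]]_n := expm A.

Section MatrixExponential.
Variable R : realType.
Local Notation C := R[i].
Local Notation Re := complex.Re.
Local Notation Im := complex.Im.

Definition fcvg m n (u : nat -> 'M[C]_(m, n)) (L : 'M[C]_(m, n)) :=
  forall e : R, 0 < e -> exists N, forall k, (N <= k)%N -> fnorm (u k - L) < e.

Lemma fcvg_cvg m n (u : nat -> 'M[C]_(m, n)) L :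
  fcvg u L -> (u : nat -> 'M[C^o]_(m, n)) @ \oo --> (L : 'M[C^o]_(m, n)).
Proof.
move=> h S /nbhs_fnormP[e e0 eS]; have [N hN] := h e e0.
by exists N => // k /= Nk; apply: eS; exact: hN.
Qed.

Lemma fcvg_lim n (u : nat -> 'M[C]_n) L :
  fcvg u L -> lim ((u : nat -> 'M[C^o]_n) @ \oo) = (L : 'M[C^o]_n).
Proof. by move=> /fcvg_cvg; apply: cvg_lim; exact: norm_hausdorff. Qed.

Lemma fcvg_entries m n (u : nat -> 'M[C]_(m, n)) (L : 'M[C]_(m, n)) :
  (forall i j, (fun k => Re (u k i j)) @ \oo --> Re (L i j)) ->
  (forall i j, (fun k => Im (u k i j)) @ \oo --> Im (L i j)) -> fcvg u L.
Proof.
move=> hr hi e e0; pose d := e / (m * n).+1%:R.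
have d0 : 0 < d / 2 by rewrite !divr_gt0.
have : \forall k \near \oo, forall i j, normc ((u k - L) i j) < d.
  apply: filter_forall => i; apply: filter_forall => j.
  have /cvgrPdist_lt/(_ _ d0) h1 := hr i j.
  have /cvgrPdist_lt/(_ _ d0) h2 := hi i j.
  near=> k; apply: le_lt_trans (normc_leD _) _.
  rewrite (splitr d) !mxE ReB ImB ![`|_ (u k i j) - _|]distrC.
  by apply: ltrD; near: k.
move=> [N _ hN]; exists N => k Nk; apply: fnorm_lt_entries => // i j.
exact: hN.
Unshelve. all: by end_near. Qed.

Definition exp_psum n (N : nat) (A : 'M[C]_n) : 'M[C]_n :=
  \sum_(k < N) (k`!%:R^-1 : C) *: A ^+ k.

Lemma natVC k : (k%:R^-1 : C) = ((k%:R^-1 : R))%:C.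
Proof. by rewrite fmorphV /= rmorph_nat. Qed.

Lemma fnorm_mulX m n (B : 'M[C]_(m, n)) (A : 'M[C]_n) k :
  fnorm (B *m A ^+ k) <= fnorm B * fnorm A ^+ k.
Proof.
elim: k B => [|k IH] B; first by rewrite mulmx1 mulr1.
rewrite mxexprS mulmxA; apply: le_trans (IH _) _.
by rewrite exprS mulrA ler_wpM2r ?exprn_ge0 ?fnorm_ge0 // fnormM.
Qed.

Lemma fnorm_powB n (A B : 'M[C]_n) (r : R) k : fnorm A <= r -> fnorm B <= r ->
  fnorm (A ^+ k.+1 - B ^+ k.+1) <= k.+1%:R * r ^+ k * fnorm (A - B).
Proof.
move=> hA hB; have r0 : 0 <= r := le_trans (fnorm_ge0 _) hA.
elim: k => [|k IH]; first by rewrite !expr1 expr0 !mul1r.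
have hBX : fnorm ((A - B) *m B ^+ k.+1) <= fnorm (A - B) * r ^+ k.+1.
  apply: le_trans (fnorm_mulX _ _ _) _; rewrite ler_wpM2l ?fnorm_ge0 //.
  by apply: lerXn2r; rewrite ?nnegrE ?fnorm_ge0.
rewrite (mxexprS A) (mxexprS B); move: (A ^+ k.+1) (B ^+ k.+1) IH hBX => X Y IH hBX.
apply: le_trans (fnorm_dist _ (A *m Y) _) _.
rewrite -mulmxBr -mulmxBl.
have -> : k.+2%:R * r ^+ k.+1 * fnorm (A - B) =
   r * (k.+1%:R * r ^+ k * fnorm (A - B)) + fnorm (A - B) * r ^+ k.+1.
  by move: (fnorm _) => f; rewrite mulrSr exprS; ring.
by apply: lerD hBX; apply: le_trans (fnormM _ _) _; apply: ler_pM; rewrite ?fnorm_ge0.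
Qed.

Lemma exp_psum_cvg_ex n (A : 'M[C]_n) : exists L, fcvg (fun N => exp_psum N A) L.
Proof.
(* The norm of the identity is not 1 in general, hence this factor in the domination by the scalar
   exponential series. *)
pose K := fnorm (1%:M : 'M[C]_n).
have bnd k i j : normc (((k`!%:R^-1 : C) *: A ^+ k) i j) <= K * exp_coeff (fnorm A) k.
  apply: le_trans (normc_fnorm _ _ _) _.
  rewrite natVC fnormZ /exp_coeff /= ger0_norm ?invr_ge0 //.
  rewrite [leRHS]mulrA [leRHS]mulrC ler_wpM2l ?invr_ge0 // -[A ^+ k]mul1mx.
  exact: fnorm_mulX.
have sE (f : C -> R) (fD : {morph f : x y / x + y}) (f0 : f 0 = 0) i j :
   (fun N => f (exp_psum N A i j)) =
   series (fun k => f (((k`!%:R^-1 : C) *: A ^+ k) i j)).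
  apply/funext => N; rewrite /series /= big_mkord /exp_psum summxE.
  exact: (big_morph f fD f0).
have cvg_f (f : C -> R) (fD : {morph f : x y / x + y}) (f0 : f 0 = 0)
   (fle : forall z, `|f z| <= normc z) i j :
   cvgn (fun N => f (exp_psum N A i j)).
  rewrite sE //; apply: normed_cvg.
  apply: (@series_le_cvg _ _ (K *: exp_coeff (fnorm A))) => [k|k|k|].
  - exact: normr_ge0.
  - apply: mulr_ge0; first exact: fnorm_ge0.
    by apply: exp_coeff_ge0; exact: fnorm_ge0.
  - exact: le_trans (fle _) (bnd _ _ _).
  - by apply: is_cvg_seriesZ; exact: is_cvg_series_exp_coeff.
exists (\matrix_(i, j) Complex (limn (fun N => Re (exp_psum N A i j)))
                               (limn (fun N => Im (exp_psum N A i j)))).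
apply: fcvg_entries => i j; rewrite mxE /=.
  by apply: cvg_f; [exact: ReD| |exact: ler_Re_normc].
by apply: cvg_f; [exact: ImD| |exact: ler_Im_normc].
Qed.

Lemma expm_fcvg n (A : 'M[C]_n) : fcvg (fun N => exp_psum N A) (mexp A).
Proof.
have [L hL] := exp_psum_cvg_ex A.
suff -> : mexp A = L by [].
by rewrite mexp.unlock; exact: fcvg_lim hL.
Qed.

Lemma expm_unique n (A L : 'M[C]_n) : fcvg (fun N => exp_psum N A) L -> mexp A = L.
Proof. by rewrite mexp.unlock; exact: fcvg_lim. Qed.

Lemma exp_psum2 n (A : 'M[C]_n) N : exp_psum N.+2 A =
  1%:M + A + \sum_(i < N) (i.+2`!%:R^-1 : C) *: A ^+ i.+2.
Proof.
have H (c : nat -> C) (f : nat -> 'M[C]_n) : \sum_(k < N.+2) c k *: f k =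
    c 0%N *: f 0%N + c 1%N *: f 1%N + \sum_(i < N) c i.+2 *: f i.+2.
  by rewrite big_ord_recl big_ord_recl addrA.
rewrite /exp_psum (H (fun k => k`!%:R^-1) (fun k => A ^+ k)).
by rewrite !fact0 !invr1 !scale1r.
Qed.

(** The term of degree [k] has Lipschitz constant [k r^(k-1) / k! = r^(k-1) / (k-1)!] on the ball of
    radius [r]; over [k >= 2] these constants sum to [e^r - 1]. *)
Lemma exp_psumB n (A B : 'M[C]_n) (r : R) N : fnorm A <= r -> fnorm B <= r ->
  fnorm (exp_psum N.+2 A - exp_psum N.+2 B - (A - B)) <= fnorm (A - B) * (expR r - 1).
Proof.
move=> hA hB; have r0 : 0 <= r := le_trans (fnorm_ge0 _) hA.
rewrite !exp_psum2.
have addK (I a b c d : 'M[C]_n) : I + a + c - (I + b + d) - (a - b) = c - d.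
  by apply/matrixP => i j; rewrite !mxE; ring.
rewrite addK -sumrB; apply: le_trans (fnorm_sum _ _ _) _.
apply: (@le_trans _ _ (fnorm (A - B) * \sum_(i < N) exp_coeff r i.+1)).
  rewrite mulr_sumr; apply: ler_sum => i _.
  rewrite -scalerBr natVC fnormZ ger0_norm ?invr_ge0 //.
  rewrite mulrC ler_pdivrMr ?ltr0n ?fact_gt0 //.
  apply: le_trans (fnorm_powB _ hA hB) _.
  rewrite factS natrM /exp_coeff /=; move: (fnorm (A - B)) => f.
  have := fact_gt0 i.+1; rewrite lt0n -(pnatr_eq0 R); move: (i.+1`!%:R) => c c0.
  by rewrite le_eqVlt; apply/orP; left; apply/eqP; field.
rewrite ler_wpM2l ?fnorm_ge0 // lerBrDl.
have -> : 1 + \sum_(i < N) exp_coeff r i.+1 = series (exp_coeff r) N.+1.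
  by rewrite /series /= big_mkord big_ord_recl /exp_coeff /= expr0 fact0 divr1.
apply: nondecreasing_cvgn_le; last exact: is_cvg_series_exp_coeff.
by apply: nondecreasing_series => k _ _; apply: exp_coeff_ge0.
Qed.

(** Near 0 the exponential is a small perturbation of the identity map. Its continuity, its
    first-order expansions and its injectivity on small balls are all read off this bound. *)
Lemma expmB n (A B : 'M[C]_n) (r : R) : fnorm A <= r -> fnorm B <= r ->
  fnorm (mexp A - mexp B - (A - B)) <= fnorm (A - B) * (expR r - 1).
Proof.
move=> hA hB; apply/ler_addgt0Pr => e e0.
have e2 : 0 < e / 2 by rewrite divr_gt0.
have [NA hNA] := expm_fcvg A e2; have [NB hNB] := expm_fcvg B e2.
pose N := (maxn NA NB).+2.
have h1 : fnorm (exp_psum N A - mexp A) < e / 2.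
  by apply: hNA; rewrite (leq_trans (leq_maxl _ NB)) // /N -addn2 leq_addr.
have h2 : fnorm (exp_psum N B - mexp B) < e / 2.
  by apply: hNB; rewrite (leq_trans (leq_maxr NA _)) // /N -addn2 leq_addr.
have h3 := exp_psumB (maxn NA NB) hA hB; rewrite -/N in h3.
move: (exp_psum N A) (exp_psum N B) (mexp A) (mexp B) h1 h2 h3 => a b c d h1 h2 h3.
have -> : c - d - (A - B) = (a - b - (A - B)) + ((b - d) - (a - c)).
  by apply/matrixP => i j; rewrite !mxE; ring.
apply: le_trans (fnormD _ _) _.
apply: lerD; first exact: h3.
apply: le_trans (fnormB _ _) _; rewrite (splitr e).
by apply: lerD; apply: ltW; [exact: h2|exact: h1].
Qed.

Lemma expm0 n : mexp (0 : 'M[C]_n) = 1%:M.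
Proof.
apply: expm_unique => e e0; exists 1%N => -[//|k] _.
rewrite /exp_psum big_ord_recl big1 => [|i _]; last first.
  by rewrite mxexprS mul0mx scaler0.
by rewrite fact0 invr1 scale1r addr0 expr0 subrr fnorm0.
Qed.

Lemma expm_small n (A : 'M[C]_n) :
  fnorm (mexp A - 1%:M - A) <= fnorm A * (expR (fnorm A) - 1).
Proof. by have := @expmB n A 0 (fnorm A); rewrite expm0 fnorm0 subr0; apply; rewrite ?fnorm_ge0. Qed.

Lemma mxexpr_conj n (U A : 'M[C]_n) k : U \is unitarymx ->
  (U^t* *m A *m U) ^+ k = U^t* *m A ^+ k *m U.
Proof.
move=> hU; elim: k => [|k IH]; first by rewrite mulmx1 unitary_adjl.
rewrite !mxexprS IH; move: (A ^+ k) => B.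
rewrite !mulmxA.
by rewrite mulmxtVK.
Qed.

Lemma expm_conj n (U A : 'M[C]_n) : U \is unitarymx ->
  mexp (U^t* *m A *m U) = U^t* *m mexp A *m U.
Proof.
move=> hU; apply: expm_unique => e e0; have [N hN] := expm_fcvg A e0.
exists N => k /hN; suff -> : exp_psum k (U^t* *m A *m U) = U^t* *m exp_psum k A *m U.
  by rewrite fnorm_conjB.
rewrite /exp_psum mulmx_sumr mulmx_suml; apply: eq_bigr => i _.
by rewrite mxexpr_conj // -scalemxAr -scalemxAl.
Qed.

Lemma expm_comm n (A B : 'M[C]_n) : A *m B = B *m A -> mexp A *m B = B *m mexp A.
Proof.
move=> AB; apply/eqP; rewrite -subr_eq0; apply/eqP/fnorm_eq0/eqP.
rewrite eq_le fnorm_ge0 andbT; apply/ler_addgt0Pr => e e0; rewrite add0r.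
have d0 : 0 < e / (2 * (fnorm B + 1)).
  by rewrite divr_gt0 ?mulr_gt0 // ltr_wpDl ?fnorm_ge0.
have [N hN] := expm_fcvg A d0.
have {hN} := hN N (leqnn _); set S := exp_psum N A => hS.
have SB : S *m B = B *m S.
  rewrite /S /exp_psum mulmx_suml mulmx_sumr; apply: eq_bigr => i _.
  rewrite -scalemxAl -scalemxAr; congr (_ *: _); elim: (nat_of_ord i) => [|k IH].
    by rewrite mul1mx mulmx1.
  by rewrite mxexprS -mulmxA IH mulmxA AB mulmxA.
have -> : mexp A *m B - B *m mexp A = B *m (S - mexp A) - (S - mexp A) *m B.
  by rewrite mulmxBl mulmxBr SB opprB [RHS]addrC addrA subrK.
apply: le_trans (fnormB _ _) _; move: hS; move: (S - mexp A) => D hD.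
have hB : fnorm D * (fnorm B + 1) <= e / 2.
  rewrite -ler_pdivlMr ?ltr_wpDl ?fnorm_ge0 // ltW //.
  by apply: lt_le_trans hD _; rewrite invfM mulrA.
have hB' : fnorm D * fnorm B <= e / 2.
  by apply: le_trans hB; rewrite ler_wpM2l ?fnorm_ge0 // lerDl.
rewrite (splitr e) lerD //; apply: le_trans (fnormM _ _) _; last by [].
by rewrite mulrC.
Qed.

Definition cis (x : R) : C := Complex (cos x) (sin x).

(** The powers of [i x] alternate between real and imaginary, so the real and imaginary parts of the
    partial sums are the partial sums that define [cos] and [sin]. *)
Lemma expm_diag n (th : 'rV[R]_n) :
  mexp (diag_mx (\row_j Complex 0 (th 0 j))) = diag_mx (\row_j cis (th 0 j)).
Proof.
set D := diag_mx _; have powD k : D ^+ k = diag_mx (\row_j (Complex 0 (th 0 j)) ^+ k).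
  elim: k => [|k IH].
    by rewrite expr0; apply/matrixP => i j; rewrite !mxE expr0.
  rewrite mxexprS IH mulmx_diag; congr diag_mx.
  by apply/rowP => j; rewrite !mxE exprS.
have entE N i j : exp_psum N D i j =
    (\sum_(k < N) (k`!%:R^-1 : C) * (Complex 0 (th 0 i)) ^+ k) *+ (i == j).
  rewrite /exp_psum summxE -sumrMnl; apply: eq_bigr => k _.
  by rewrite powD !mxE; case: eqP => [->|_]; rewrite ?mulr0.
(* The parity factors and halved exponents are those of [cos_coeff] and [sin_coeff], so that the
   series agree term by term. *)
have imX (x : R) k : (Complex 0 x) ^+ k =
    Complex ((~~ odd k)%:R * (-1) ^+ k./2 * x ^+ k) ((odd k)%:R * (-1) ^+ k.-1./2 * x ^+ k).
  elim: k => [|k IH]; first by apply: complex_eq; rewrite /= ?expr0 ?mulr1 ?mul0r.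
  rewrite exprS IH /=; apply: complex_eq; rewrite ?ReM ?ImM /= !mul0r ?sub0r ?add0r ?addr0;
    case: (boolP (odd k)) => ok; rewrite /= ?mul0r ?mulr0 ?oppr0 ?mul1r ?exprS //.
  - have -> : uphalf k = k.-1./2.+1 by case: k ok {IH} => // k /=; rewrite uphalfE.
    by rewrite exprS; ring.
  - by ring.
have cS (x : R) : (fun N => Re (\sum_(k < N) (k`!%:R^-1 : C) * (Complex 0 x) ^+ k))
     = series (cos_coeff x).
  apply/funext => N; rewrite Re_sum /series /= big_mkord; apply: eq_bigr => k _.
  by rewrite natVC ReZ imX /= mulrC.
have sS (x : R) : (fun N => Im (\sum_(k < N) (k`!%:R^-1 : C) * (Complex 0 x) ^+ k))
     = series (sin_coeff x).
  apply/funext => N; rewrite Im_sum /series /= big_mkord; apply: eq_bigr => k _.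
  by rewrite natVC ImZ imX /= mulrC.
have cC (x : R) : series (cos_coeff x) @ \oo --> cos x.
  by rewrite cos.unlock; exact: is_cvg_series_cos_coeff.
have sC (x : R) : series (sin_coeff x) @ \oo --> sin x.
  by rewrite sin.unlock; exact: is_cvg_series_sin_coeff.
apply: expm_unique; apply: fcvg_entries => i j.
  under eq_fun do rewrite entE.
  rewrite !mxE; case: eqP => [_|_]; last exact: cvg_cst.
  by rewrite cS; exact: cC.
under eq_fun do rewrite entE.
rewrite !mxE; case: eqP => [_|_]; last exact: cvg_cst.
by rewrite sS; exact: sC.
Qed.

End MatrixExponential.

(** * Unitary diagonalisation and exponentials of skew-hermitian matrices *)

HB.lock Definition udiag (R : realType) n (U : 'M[R[i]]_n) (d : 'I_n -> R[i]) : 'M[R[i]]_n :=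
  U^t* *m diag_mx (\row_j d j) *m U.

Section SkewHermitian.
Variable R : realType.
Local Notation C := R[i].
Local Notation Re := complex.Re.
Local Notation Im := complex.Im.

(** From [e^(-r) >= 1 - r] follows [e^r - 1 <= r / (1 - r)], and [1 - r >= 1 / 2]. *)
Lemma expR_sub1_le (r : R) : 0 <= r <= 2^-1 -> expR r - 1 <= 2 * r.
Proof.
move=> /andP[r0 r1]; have h := expR_ge1Dx (- r).
have : expR r * expR (- r) = 1 by rewrite expRN divff // gt_eqF ?expR_gt0.
have := expR_gt0 r; move: h; move: (expR r) (expR (- r)) => a b; nra.
Qed.

Lemma expmB_small n (A B : 'M[C]_n) (r : R) : r <= 2^-1 ->
  fnorm A <= r -> fnorm B <= r ->
  fnorm (mexp A - mexp B - (A - B)) <= 2 * r * fnorm (A - B).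
Proof.
move=> r1 hA hB; have r0 : 0 <= r := le_trans (fnorm_ge0 _) hA.
apply: le_trans (expmB hA hB) _; rewrite mulrC ler_wpM2r ?fnorm_ge0 //.
by rewrite expR_sub1_le // r0.
Qed.

Lemma expm_sub1_le n (A : 'M[C]_n) : fnorm A <= 2^-1 ->
  fnorm (mexp A - 1%:M - A) <= 2 * fnorm A ^+ 2.
Proof.
move=> hA; apply: le_trans (expm_small _) _.
rewrite expr2 mulrCA ler_wpM2l ?fnorm_ge0 //.
by rewrite expR_sub1_le // fnorm_ge0.
Qed.

Lemma expm_sub1_le2 n (A : 'M[C]_n) : fnorm A <= 2^-1 ->
  fnorm (mexp A - 1%:M) <= 2 * fnorm A.
Proof.
move=> hA; have h := expm_sub1_le hA.
have : fnorm (mexp A - 1%:M) <= fnorm (mexp A - 1%:M - A) + fnorm A.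
  by apply: le_trans (fnormD _ _); rewrite subrK.
have := fnorm_ge0 A; move: hA h; move: (fnorm A) (fnorm _) (fnorm _) => a b c; nra.
Qed.

Definition skew n (A : 'M[C]_n) := A^t* = - A.

Lemma skewD n (A B : 'M[C]_n) : skew A -> skew B -> skew (A + B).
Proof. by rewrite /skew adjD => -> ->; rewrite opprD. Qed.

Lemma skewN n (A : 'M[C]_n) : skew A -> skew (- A).
Proof. by rewrite /skew adjN => ->. Qed.

Lemma skewZ n (a : R) (A : 'M[C]_n) : skew A -> skew (a%:C *: A).
Proof. by rewrite /skew adjZ => ->; rewrite scalerN. Qed.

Definition imag (x : R) : C := Complex 0 x.

Lemma eq_udiag n (U : 'M[C]_n) (d e : 'I_n -> C) : d =1 e -> udiag U d = udiag U e.
Proof. by move=> /funext ->. Qed.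

Lemma udiagE n (U : 'M[C]_n) (d : 'I_n -> C) i j :
  udiag U d i j = \sum_k ((U k i)^*)%R * d k * U k j.
Proof.
rewrite udiag.unlock -mulmxA mxE; apply: eq_bigr => k _.
by rewrite adjE mul_diag_mx !mxE mulrA.
Qed.

Lemma udiagM n (U : 'M[C]_n) (d e : 'I_n -> C) : U \is unitarymx ->
  udiag U d *m udiag U e = udiag U (fun j => d j * e j).
Proof.
move=> hU; rewrite udiag.unlock; have -> : diag_mx (\row_j (d j * e j)) =
    diag_mx (\row_j d j) *m diag_mx (\row_j e j).
  by rewrite mulmx_diag; congr diag_mx; apply/rowP => j; rewrite !mxE.
move: (diag_mx _) (diag_mx _) => D E.
by rewrite !mulmxA mulmxtVK.
Qed.

Lemma udiagK n (U : 'M[C]_n) (d : 'I_n -> C) : U \is unitarymx ->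
  U *m udiag U d *m U^t* = diag_mx (\row_j d j).
Proof.
move=> hU; rewrite udiag.unlock; move: (diag_mx _) => D.
by rewrite !mulmxA mulmxtVK // unitary_adjr // mul1mx.
Qed.

Lemma normal_spectral n (A : 'M[C]_n) : A *m A^t* = A^t* *m A ->
  exists (U : 'M[C]_n) (d : 'I_n -> C), U \is unitarymx /\ A = udiag U d.
Proof.
move=> hA; have /orthomx_spectralP hE : A \is normalmx by apply/normalmxP.
have hU := spectral_unitarymx A.
exists (spectralmx A), (spectral_diag A 0); split; first exact: hU.
rewrite udiag.unlock -(invmx_unitary hU).
by have -> : \row_j spectral_diag A 0 j = spectral_diag A by apply/rowP => j; rewrite mxE.
Qed.

Lemma expm_udiag n (U : 'M[C]_n) (th : 'I_n -> R) : U \is unitarymx ->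
  mexp (udiag U (fun j => imag (th j))) = udiag U (fun j => cis (th j)).
Proof.
move=> hU; rewrite udiag.unlock expm_conj //; have := expm_diag (\row_j th j).
have -> : \row_j Complex 0 ((\row_j th j) 0 j) = \row_j imag (th j).
  by apply/rowP => j; rewrite !mxE.
move=> ->; have -> : \row_j cis ((\row_j th j) 0 j) = \row_j cis (th j) => //.
by apply/rowP => j; rewrite !mxE.
Qed.

Lemma udiag_adj n (U : 'M[C]_n) (d : 'I_n -> C) :
  (udiag U d)^t* = udiag U (fun j => ((d j)^*)%R).
Proof.
apply/matrixP => i j; rewrite adjE (udiagE U d) (udiagE U (fun j => _)).
rewrite rmorph_sum; apply: eq_bigr => k _.
rewrite !rmorphM /= conjCK; move: (U k j) (d k) (U k i) => x y z.
by move: (_^*)%R (_^*)%R => a b; ring.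
Qed.

Lemma udiagZ n (U : 'M[C]_n) (d : 'I_n -> C) (a : C) :
  a *: udiag U d = udiag U (fun j => a * d j).
Proof.
apply/matrixP => i j; rewrite mxE !udiagE mulr_sumr; apply: eq_bigr => k _.
by rewrite mulrA mulrCA !mulrA.
Qed.

Lemma udiagN n (U : 'M[C]_n) (d : 'I_n -> C) :
  - udiag U d = udiag U (fun j => - d j).
Proof. by rewrite -scaleN1r udiagZ; apply: eq_udiag => j; rewrite mulN1r. Qed.

Lemma udiag0 n (U : 'M[C]_n) : udiag U (fun=> 0) = 0.
Proof.
by apply/matrixP => i j; rewrite udiagE mxE big1 // => k _; rewrite mulr0 mul0r.
Qed.

Lemma udiag_sum n (U : 'M[C]_n) I (r : seq I) (P : pred I) (d : I -> 'I_n -> C) :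
  \sum_(s <- r | P s) udiag U (d s) = udiag U (fun j => \sum_(s <- r | P s) d s j).
Proof.
apply/matrixP => i j; rewrite summxE udiagE.
under [RHS]eq_bigr do rewrite mulr_sumr mulr_suml.
by rewrite exchange_big /=; apply: eq_bigr => s _; rewrite udiagE.
Qed.

Lemma udiag_inj n (U : 'M[C]_n) (d e : 'I_n -> C) : U \is unitarymx ->
  udiag U d = udiag U e -> d =1 e.
Proof.
move=> hU h j; have := udiagK d hU; rewrite h udiagK // => /matrixP/(_ j j).
by rewrite !mxE eqxx !mulr1n.
Qed.

Lemma udiag_ReIm n (U : 'M[C]_n) (d : 'I_n -> C) : U \is unitarymx ->
  skew (udiag U d) -> forall j, Re (d j) = 0.
Proof.
move=> hU; rewrite /skew udiag_adj udiagN => /(udiag_inj hU) h j.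
by have /(congr1 (@complex.Re R)) := h j; rewrite ReJ ReN => h'; lra.
Qed.

Lemma skew_spectral n (A : 'M[C]_n) : skew A ->
  exists (U : 'M[C]_n) (th : 'I_n -> R), U \is unitarymx /\
    A = udiag U (fun j => imag (th j)).
Proof.
move=> sA; have [|U [d [hU AE]]] := @normal_spectral n A.
  by rewrite sA mulmxN mulNmx.
exists U, (fun j => Im (d j)); split; first exact: hU.
rewrite AE; apply: eq_udiag => j; apply: complex_eq => //=.
by apply: (udiag_ReIm hU); rewrite -AE.
Qed.

Lemma udiag_imagZ n (a : R) (U : 'M[C]_n) (th : 'I_n -> R) :
  a%:C *: udiag U (fun j => imag (th j)) = udiag U (fun j => imag (a * th j)).
Proof.
rewrite udiagZ; apply: eq_udiag => j.
by apply: complex_eq; rewrite ?ReZ ?ImZ /= ?mulr0.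
Qed.

Lemma cisD (a b : R) : cis (a + b) = cis a * cis b :> C.
Proof. by apply: complex_eq; rewrite ?ReM ?ImM /= ?cosD ?sinD //; ring. Qed.

(** Diagonalising turns the one-parameter law into the addition formulas of [cos] and [sin]. *)
Lemma expm_scaleD n (A : 'M[C]_n) (a b : R) : skew A ->
  mexp ((a + b)%:C *: A) = mexp (a%:C *: A) *m mexp (b%:C *: A).
Proof.
move=> /skew_spectral[U [th [hU ->]]].
rewrite (udiag_imagZ (a + b)) (udiag_imagZ a) (udiag_imagZ b).
rewrite !(expm_udiag _ hU) (udiagM _ _ hU).
by apply: eq_udiag => j; rewrite mulrDl cisD.
Qed.

Lemma expm_scale0 n (A : 'M[C]_n) : mexp ((0 : R)%:C *: A) = 1%:M.
Proof. by rewrite scale0r expm0. Qed.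

Lemma expm_scaleN n (A : 'M[C]_n) (a : R) : skew A ->
  mexp (a%:C *: A) *m mexp ((- a)%:C *: A) = 1%:M.
Proof. by move=> sA; rewrite -expm_scaleD // subrr expm_scale0. Qed.

Lemma expm_adj n (A : 'M[C]_n) : skew A -> (mexp A)^t* = mexp (- A).
Proof.
move=> /skew_spectral[U [th [hU ->]]].
have -> : - udiag U (fun j => imag (th j)) = udiag U (fun j => imag (- th j)).
  by rewrite udiagN; apply: eq_udiag => j; apply: complex_eq; rewrite ?ReN ?ImN /= ?oppr0.
rewrite !(expm_udiag _ hU) udiag_adj; apply: eq_udiag => j.
by apply: complex_eq; rewrite ?ReJ ?ImJ /= ?cosN ?sinN.
Qed.

Lemma expm_unitary n (A : 'M[C]_n) : skew A -> mexp A \is unitarymx.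
Proof.
move=> sA; apply/unitarymxP; rewrite expm_adj //.
have := @expm_scaleN n A 1 sA.
by rewrite rmorphN scaleNr !scale1r.
Qed.

Lemma expm_scaleX n (A : 'M[C]_n) (a : R) k : skew A ->
  mexp (a%:C *: A) ^+ k = mexp ((k%:R * a)%:C *: A).
Proof.
move=> sA; elim: k => [|k IH]; first by rewrite mul0r expm_scale0.
have -> : k.+1%:R * a = a + k%:R * a by rewrite mulrSr mulrDl mul1r addrC.
by rewrite mxexprS IH (expm_scaleD a (k%:R * a) sA).
Qed.

End SkewHermitian.

(** * Products of exponentials of skew-hermitian matrices *)

Section ExpAdd.
Variable R : realType.
Local Notation C := R[i].

Lemma mul_near1 n (P Q A B : 'M[C]_n) (p q a b : R) : Q \is unitarymx ->
  fnorm (P - 1%:M - A) <= p -> fnorm (Q - 1%:M - B) <= q -> fnorm A <= a ->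
  fnorm (Q - 1%:M) <= b -> fnorm (P *m Q - 1%:M - (A + B)) <= p + (a * b + q).
Proof.
move=> hQ hp hq ha hb.
have -> : P *m Q - 1%:M - (A + B) =
   (P - 1%:M - A) *m Q + (A *m (Q - 1%:M) + (Q - 1%:M - B)).
  rewrite !(mulmxDl, mulmxDr, mulNmx, mulmxN, mulmx1, mul1mx).
  move: (P *m Q) (A *m Q) => x y {hp hq ha hb hQ}.
  by apply/matrixP => i j; rewrite !mxE; ring.
apply: (le_trans (fnormD _ _)); apply: lerD.
  by rewrite (fnorm_unitaryr _ hQ).
apply: (le_trans (fnormD _ _)); apply: lerD; last exact: hq.
apply: (le_trans (fnormM _ _)); apply: ler_pM; [exact: fnorm_ge0|exact: fnorm_ge0|exact: ha|exact: hb].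
Qed.

(** The quadratic order of the error in [s] is what matters: it survives the accumulation of [1 / s]
    factors in [expm_add_comm], and it makes [A + B] a tangent direction in [lieD]. *)
Lemma expm_mulB n (A B : 'M[C]_n) (s : R) : skew A -> skew B -> 0 <= s ->
  s * (fnorm A + fnorm B) <= 2^-1 ->
  fnorm (mexp (s%:C *: A) *m mexp (s%:C *: B) - 1%:M - s%:C *: (A + B))
    <= 2 * s ^+ 2 * (fnorm A + fnorm B) ^+ 2.
Proof.
move=> sA sB s0 hs; have a0 := fnorm_ge0 A; have b0 := fnorm_ge0 B.
have hB := expm_unitary (skewZ s sB).
have eA : fnorm (s%:C *: A) = s * fnorm A by rewrite fnormZ (ger0_norm s0).
have eB : fnorm (s%:C *: B) = s * fnorm B by rewrite fnormZ (ger0_norm s0).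
rewrite scalerDr; move: (s%:C *: A) (s%:C *: B) hB eA eB => A' B' hB eA eB.
have ha : fnorm A' <= 2^-1 by rewrite eA; move: (fnorm A) (fnorm B) hs a0 b0 {eA eB} => a b; nra.
have hb : fnorm B' <= 2^-1 by rewrite eB; move: (fnorm A) (fnorm B) hs a0 b0 {eA eB ha} => a b; nra.
have h1 := expm_sub1_le ha; have h2 := expm_sub1_le hb; have h3 := expm_sub1_le2 hb.
apply: (le_trans (mul_near1 hB h1 h2 (lexx _) h3)).
rewrite eA eB; move: (fnorm A) (fnorm B) a0 b0 => a b a0 b0.
have : 0 <= s ^+ 2 * (a * b) by rewrite mulr_ge0 ?sqr_ge0 // mulr_ge0.
have -> : 2 * s ^+ 2 * (a + b) ^+ 2 = 2 * (s * a) ^+ 2 + 2 * (s * b) ^+ 2 + 4 * (s ^+ 2 * (a * b)) by ring.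
have -> : s * a * (2 * (s * b)) = 2 * (s ^+ 2 * (a * b)) by ring.
move: (s ^+ 2 * (a * b)) (_ ^+ 2) ((s * b) ^+ 2) => x y z; clear; lra.
Qed.

(** This is how limits as [e] tends to 0 are taken throughout; norms are shown to vanish by
    combining it with [fnorm_le0]. *)
Lemma small_le0 (x K : R) : (forall e, 0 < e -> e <= 1 -> x <= K * e) -> x <= 0.
Proof.
move=> h; rewrite leNgt; apply/negP => x0.
have K1 : 0 < `|K| + 1 by rewrite ltr_wpDl.
pose e := Num.min 1 (x / (2 * (`|K| + 1))).
have e0 : 0 < e by rewrite lt_min ltr01 divr_gt0 // mulr_gt0.
have e1 : e <= x / (2 * (`|K| + 1)) by rewrite ge_min lexx orbT.
have := h e e0; rewrite ge_min lexx => /(_ isT).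
rewrite ler_pdivlMr ?mulr_gt0 // in e1.
have := ler_norm K; move: e0 e1 => {h}; move: e (`|K|) K1 => e k k1 e0; nra.
Qed.

Lemma small_ex (K c e0 : R) : 0 <= K -> 0 < c -> 0 < e0 ->
  exists e, [/\ 0 < e, e <= c & K * e < e0].
Proof.
move=> K0 c0 e00; have K1 : 0 < K + 1 by rewrite ltr_wpDl.
exists (Num.min c (e0 / (2 * (K + 1)))).
have e1 : 0 < e0 / (2 * (K + 1)) by rewrite divr_gt0 // mulr_gt0.
split; [by rewrite lt_min c0|by rewrite ge_min lexx|].
apply: (@le_lt_trans _ _ (K * (e0 / (2 * (K + 1))))).
  by rewrite ler_wpM2l // ge_min lexx orbT.
by rewrite mulrA ltr_pdivrMr ?mulr_gt0 //; nra.
Qed.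

Lemma fnorm_le0 m n (A : 'M[C]_(m, n)) : fnorm A <= 0 -> A = 0.
Proof. by move=> h; apply: fnorm_eq0; apply/eqP; rewrite eq_le h fnorm_ge0. Qed.

(** With [s = 1 / m], both sides are [m]-th powers, of [e^(s (A + B))] and of [e^(s A) e^(s B)]; the
    second power splits because [A] and [B] commute. The two bases are unitary and differ by
    [O(s^2)], so the powers differ by [O(1 / m)]. *)
Lemma expm_add_comm n (A B : 'M[C]_n) : skew A -> skew B -> A *m B = B *m A ->
  mexp (A + B) = mexp A *m mexp B.
Proof.
move=> sA sB AB; apply/eqP; rewrite -subr_eq0; apply/eqP/fnorm_le0.
pose c := fnorm A + fnorm B.
have c0 : 0 <= c by rewrite addr_ge0 ?fnorm_ge0.
have key (m : nat) : 2 * c <= m.+1%:R ->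
    fnorm (mexp (A + B) - mexp A *m mexp B) <= 4 * c ^+ 2 / m.+1%:R.
  move=> hm; pose s : R := m.+1%:R^-1.
  have s0 : 0 < s by rewrite invr_gt0.
  have ms : m.+1%:R * s = 1 by rewrite divff.
  have sc : s * c <= 2^-1.
    by rewrite mulrC ler_pdivrMr // mulrC ler_pdivlMr // mulrC.
  have EX (X : 'M[C]_n) : skew X -> mexp X = mexp (s%:C *: X) ^+ m.+1.
    by move=> sX; rewrite (expm_scaleX _ _ sX) ms scale1r.
  have comm : mexp (s%:C *: A) *m mexp (s%:C *: B) = mexp (s%:C *: B) *m mexp (s%:C *: A).
    apply: expm_comm; apply/esym/expm_comm.
    by rewrite -!scalemxAl -!scalemxAr AB.
  have -> : mexp A *m mexp B = (mexp (s%:C *: A) *m mexp (s%:C *: B)) ^+ m.+1.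
    by rewrite (EX A sA) (EX B sB); apply/esym; exact: exprMn_comm.
  rewrite (EX (A + B) (skewD sA sB)).
  have uA := expm_unitary (skewZ s sA); have uB := expm_unitary (skewZ s sB).
  have uAB := expm_unitary (skewZ s (skewD sA sB)).
  apply: (le_trans (fnorm_unitaryX _ uAB (mul_unitarymx uA uB))).
  have h1 := expm_mulB sA sB (ltW s0) sc.
  have h2 : fnorm (s%:C *: (A + B)) <= s * c.
    by rewrite fnormZ (ger0_norm (ltW s0)) (ler_wpM2l (ltW s0) (fnormD A B)).
  have h3 := expm_sub1_le (le_trans h2 sc).
  rewrite -/c in h1.
  (* Both matrices equal [1 + s (A + B)] up to [2 s^2 c^2]. *)
  have h5 : fnorm (mexp (s%:C *: (A + B)) - mexp (s%:C *: A) *m mexp (s%:C *: B)) <=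
     4 * s ^+ 2 * c ^+ 2.
    move: h2 h3 h1; clear; move: (s%:C *: (A + B)) => Z.
    move: (mexp Z) (mexp _ *m _) => X Y h2 h3 h1.
    apply: le_trans (_ : fnorm (X - 1%:M - Z) + fnorm (Y - 1%:M - Z) <= _).
      apply: le_trans (fnormB _ _).
      have -> : X - 1%:M - Z - (Y - 1%:M - Z) = X - Y; last exact: lexx.
      by clear; apply/matrixP => i j; rewrite !mxE; ring.
    have h4 : fnorm Z ^+ 2 <= (s * c) ^+ 2.
      by apply: lerXn2r; rewrite ?nnegrE ?fnorm_ge0 ?(le_trans (fnorm_ge0 _) h2).
    rewrite exprMn in h4.
    move: h3 h1 h4; move: (fnorm (_ - Z)) (fnorm (Y - 1%:M - Z)) (fnorm Z ^+ 2) => x y z; clear.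
    rewrite -!mulrA; move: (s ^+ 2 * c ^+ 2) => t; lra.
  apply: (@le_trans _ _ (m.+1%:R * (4 * s ^+ 2 * c ^+ 2))).
    by rewrite (ler_wpM2l _ h5).
  have -> : m.+1%:R * (4 * s ^+ 2 * c ^+ 2) = (m.+1%:R * s) * (4 * c ^+ 2 * s).
    by clear; move: s => t; ring.
  by rewrite ms mul1r lexx.
apply: (@small_le0 _ (4 * c ^+ 2)) => e e0 e1.
have [m hm] : exists m : nat, 2 * c + e^-1 <= m.+1%:R.
  by exists (Num.truncn (2 * c + e^-1)); apply/ltW/truncnS_gt.
have ei : 0 < e^-1 by rewrite invr_gt0.
apply: le_trans (key m _) _; first by move: hm; lra.
rewrite ler_wpM2l ?mulr_ge0 ?sqr_ge0 // -(invrK e) lef_pV2 ?posrE //.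
by move: hm; lra.
Qed.

End ExpAdd.

(** * Closed unitary groups and their Lie algebras *)

Section LieAlgebra.
Variable R : realType.
Local Notation C := R[i].

Lemma unitary_fclosed n : fclosed [set A : 'M[C]_n | A \is unitarymx].
Proof.
move=> P h; apply/unitarymxP/eqP; rewrite -subr_eq0; apply/eqP/fnorm_le0.
apply: (@small_le0 _ _ (fnorm P + 1)) => e e0 _.
have [Q hQ PQ] := h e e0; have QQ := unitary_adjr hQ.
have -> : P *m P^t* - 1%:M = (P - Q) *m P^t* + Q *m (P - Q)^t*.
  by rewrite adjB mulmxBl mulmxBr QQ addrA subrK.
apply: (le_trans (fnormD _ _)); rewrite mulrDl mul1r; apply: lerD.
  apply: (le_trans (fnormM _ _)); rewrite fnorm_adj mulrC.
  by apply: ler_wpM2l; [exact: fnorm_ge0|rewrite fnorm_distC; exact: ltW].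
by rewrite (fnorm_unitaryl _ hQ) fnorm_adj fnorm_distC; exact: ltW.
Qed.

(** With [D = Q - 1], unitarity reads [D + D^* + D D^* = 0]. Since [D] is [s X] up to [e s], the sum
    of [s X] and its adjoint is bounded by [2 e s] plus [|D|^2], and [s <= e] turns the [s^2] of the
    last term into [e s]. *)
Lemma near1_skew n (Q X : 'M[C]_n) (s e : R) : Q \is unitarymx -> 0 < s -> s <= e ->
  e <= 1 -> fnorm (Q - 1%:M - s%:C *: X) <= e * s ->
  fnorm (X + X^t*) <= (2 + (fnorm X + 1) ^+ 2) * e.
Proof.
move=> hQ s0 se e1 h; have QQ := unitary_adjr hQ.
pose E := Q - 1%:M - s%:C *: X; pose D := Q - 1%:M.
have hD : fnorm D <= s * (fnorm X + 1).
  have -> : D = s%:C *: X + E by rewrite /E addrC subrK.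
  apply: (le_trans (fnormD _ _)); rewrite fnormZ (ger0_norm (ltW s0)) mulrDr mulr1.
  apply: lerD; first exact: lexx.
  by apply: (le_trans h); rewrite ger_pMl.
have key : s%:C *: (X + X^t*) = - (E + E^t* + D *m D^t*).
  have DD : D + D^t* + D *m D^t* = 0.
    rewrite /D adjB adj1 mulmxBl !mulmxBr QQ !mul1mx mulmx1; clear.
    by apply/matrixP => i j; rewrite !mxE; ring.
  have -> : E + E^t* = D + D^t* - s%:C *: (X + X^t*).
    rewrite {1 2}/E -/D adjB adjZ; clear.
    by apply/matrixP => i j; rewrite !mxE; ring.
  by rewrite addrAC DD add0r opprK.
have : s * fnorm (X + X^t*) <= s * ((2 + (fnorm X + 1) ^+ 2) * e).
  have -> : s * fnorm (X + X^t*) = fnorm (s%:C *: (X + X^t*)).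
    by rewrite fnormZ (ger0_norm (ltW s0)).
  rewrite key fnormN.
  have h1 := fnormD (E + E^t*) (D *m D^t*); have h2 := fnormD E (E^t*).
  have h3 := fnormM D (D^t*); rewrite !fnorm_adj in h2 h3.
  have h4 : fnorm D * fnorm D <= (s * (fnorm X + 1)) * (s * (fnorm X + 1)).
    by apply: ler_pM; rewrite ?fnorm_ge0.
  have h5 : s * s <= s * e by rewrite ler_pM2l.
  have h6 := fnorm_ge0 X.
  move: h h1 h2 h3 h4 h5 h6; rewrite -/E.
  move: (fnorm _) (fnorm (D *m _)) (fnorm (E + _)) (fnorm E) (fnorm D) (fnorm X).
  clear => a b c d f x h h1 h2 h3 h4 h5 h6.
  have : s * s * (x + 1) ^+ 2 <= s * e * (x + 1) ^+ 2 by rewrite ler_wpM2r ?sqr_ge0.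
  move: h4; have -> : s * (x + 1) * (s * (x + 1)) = s * s * (x + 1) ^+ 2 by ring.
  have -> : s * ((2 + (x + 1) ^+ 2) * e) = 2 * (e * s) + s * e * (x + 1) ^+ 2 by ring.
  move: (_ * _ ^+ 2) (_ * _ ^+ 2) (e * s) h h1 h2 h3 => u v w; lra.
by rewrite ler_pM2l.
Qed.

(** The exponent [m] is the integer part of [t / s]. Each factor [Q] differs from [e^(s X)] by
    [O(e s)], which over [m] factors adds up to [O(e t)], and the remaining time [t - m s <= s]
    costs another [O(e)]. *)
Lemma pow_near_expm n (Q X : 'M[C]_n) (s e t : R) : skew X -> Q \is unitarymx ->
  0 < s -> s <= e -> s * fnorm X <= 2^-1 -> fnorm (Q - 1%:M - s%:C *: X) <= e * s ->
  0 <= t ->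
  exists m, fnorm (Q ^+ m - mexp (t%:C *: X)) <= (t + 2 * t * fnorm X ^+ 2 + 2 * fnorm X) * e.
Proof.
move=> sX hQ s0 se sx h t0.
have ts0 : 0 <= t / s by rewrite divr_ge0 // ltW.
have /andP[m1 m2] := truncn_itv ts0.
move: (Num.truncn (t / s)) m1 m2 => m m1 m2; exists m.
rewrite ler_pdivlMr // in m1; rewrite ltr_pdivrMr // in m2.
have hS := expm_unitary (skewZ s sX).
have eX : fnorm (s%:C *: X) = s * fnorm X by rewrite fnormZ (ger0_norm (ltW s0)).
have h1 : fnorm (Q - mexp (s%:C *: X)) <= e * s + 2 * (s * fnorm X) ^+ 2.
  have h2 := @expm_sub1_le _ _ (s%:C *: X); rewrite eX in h2; move: (h2 sx) h; clear.
  move: (s%:C *: X) (mexp _) => A P hP hA.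
  have -> : Q - P = (Q - 1%:M - A) - (P - 1%:M - A).
    by clear; apply/matrixP => i j; rewrite !mxE; ring.
  by apply: (le_trans (fnormB _ _)); apply: lerD.
have h2 : fnorm (Q ^+ m - mexp (s%:C *: X) ^+ m) <= m%:R * (e * s + 2 * (s * fnorm X) ^+ 2).
  by apply: (le_trans (fnorm_unitaryX m hQ hS)); apply: ler_wpM2l.
have h3 : fnorm (mexp (s%:C *: X) ^+ m - mexp (t%:C *: X)) <= 2 * (s * fnorm X).
  rewrite (expm_scaleX _ _ sX).
  have -> : t%:C = ((m%:R * s) + (t - m%:R * s))%:C by rewrite addrC subrK.
  rewrite (expm_scaleD _ _ sX); have hM := expm_unitary (skewZ (m%:R * s) sX).
  have -> : mexp ((m%:R * s)%:C *: X) - mexp ((m%:R * s)%:C *: X) *m mexp ((t - m%:R * s)%:C *: X)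
    = mexp ((m%:R * s)%:C *: X) *m (1%:M - mexp ((t - m%:R * s)%:C *: X)).
    by rewrite mulmxBr mulmx1.
  rewrite (fnorm_unitaryl _ hM) fnorm_distC.
  have d0 : 0 <= t - m%:R * s by rewrite subr_ge0.
  have ds : t - m%:R * s <= s.
    by move: m2; rewrite mulrSr mulrDl mul1r => /ltW; rewrite lerBlDl.
  have dx : (t - m%:R * s) * fnorm X <= s * fnorm X by rewrite (ler_wpM2r _ ds) ?fnorm_ge0.
  have h4 := @expm_sub1_le2 _ _ ((t - m%:R * s)%:C *: X).
  rewrite fnormZ (ger0_norm d0) in h4.
  apply: (le_trans (h4 (le_trans dx sx))); exact: ler_wpM2l.
apply: (le_trans (fnorm_dist _ (mexp (s%:C *: X) ^+ m) _)).
have x0 := fnorm_ge0 X; clear h1 sx; move: (fnorm X) x0 h2 h3 => x x0 ha hb.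
have hms : m%:R * (e * s + 2 * (s * x) ^+ 2) <= (t + 2 * t * x ^+ 2) * e.
  have -> : m%:R * (e * s + 2 * (s * x) ^+ 2) = (m%:R * s) * (e + 2 * s * x ^+ 2) by ring.
  have -> : (t + 2 * t * x ^+ 2) * e = t * (e + 2 * e * x ^+ 2) by ring.
  have x2 := sqr_ge0 x; apply: ler_pM.
  - by rewrite mulr_ge0 // ltW.
  - by rewrite addr_ge0 ?mulr_ge0 // ltW // (lt_le_trans s0).
  - exact: m1.
  - by rewrite lerD2l ler_wpM2r // ler_wpM2l.
have : 2 * (s * x) <= 2 * x * e by rewrite -mulrA ler_wpM2l // mulrC ler_wpM2l.
move=> hx; rewrite mulrDl; apply: lerD; [exact: (le_trans ha hms)|exact: (le_trans hb hx)].
Qed.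

Definition closed_unitary_group n (G : set 'M[C]_n) :=
  [/\ G `<=` [set A | A \is unitarymx], GL_subgroup G & closed_in_GL G].

Section Group.
Variables (n : nat) (G : set 'M[C]_n).
Hypothesis hG : closed_unitary_group G.
Local Notation g := (lie_algebra G).

Lemma groupU A : G A -> A \is unitarymx. Proof. by case: hG => h _ _ /h. Qed.
Lemma group1 : G 1%:M. Proof. by case: hG => _ []. Qed.
Lemma groupM A B : G A -> G B -> G (A *m B).
Proof. by case: hG => _ [_ _ h _] _; exact: h. Qed.
Lemma groupJ A : G A -> G (A^t*).
Proof. by move=> GA; rewrite -(invmx_unitary (groupU GA)); case: hG => _ [_ _ _ h] _; exact: h. Qed.
Lemma groupX A k : G A -> G (A ^+ k).
Proof.
move=> GA; elim: k => [|k IH]; first exact: group1.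
by rewrite mxexprS; exact: groupM.
Qed.

(** Closedness in GL becomes closedness among all matrices, because a limit of unitary matrices is
    unitary and therefore invertible. *)
Lemma group_fclosed : fclosed G.
Proof.
move=> P h; case: hG => _ _ [F cF GE].
rewrite GE; split; last first.
  apply: unitarymx_unit; apply: unitary_fclosed => e e0.
  by have [Q /groupU GQ PQ] := h e e0; exists Q.
have /closed_fnormP := cF; apply => e e0.
by have [Q] := h e e0; rewrite {1}GE => -[FQ _] PQ; exists Q.
Qed.

(** The limits of [(Q - 1) / s] with [Q] in [G] and [s > 0] tending to 0. This set turns out to be
    the Lie algebra, and membership in it is a first-order condition on elements of [G], easier to
    verify for sums and limits than a condition on whole one-parameter groups. *)
Definition tangent_dir (X : 'M[C]_n) := forall e : R, 0 < e -> exists s Q,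
  [/\ G Q, 0 < s, s <= e & fnorm (Q - 1%:M - s%:C *: X) <= e * s].

Lemma lieI X : (forall t, G (mexp (t%:C *: X))) -> g X.
Proof. by rewrite mexp.unlock. Qed.

Lemma lie_mexpZ X t : g X -> G (mexp (t%:C *: X)).
Proof. by rewrite mexp.unlock => /(_ t). Qed.

Lemma tangent_dir_skew X : tangent_dir X -> skew X.
Proof.
move=> h; apply/eqP; rewrite -addr_eq0 addrC; apply/eqP/fnorm_le0.
apply: (@small_le0 _ _ (2 + (fnorm X + 1) ^+ 2)) => e e0 e1.
have [s [Q [/groupU GQ s0 se hQ]]] := h e e0.
exact: near1_skew hQ.
Qed.

(** The core of the closed subgroup theorem: the powers of [Q] with exponent about [t / s] stay in
    [G] and tend to [e^(t X)], which is in [G] by closedness. Negative times are obtained from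
    adjoints. *)
Lemma tangent_dir_lie X : tangent_dir X -> g X.
Proof.
move=> h; have sX := tangent_dir_skew h.
have pos t : 0 <= t -> G (mexp (t%:C *: X)).
  move=> t0; apply: group_fclosed => e0 e00.
  have x0 := fnorm_ge0 X.
  have K0 : 0 <= t + 2 * t * fnorm X ^+ 2 + 2 * fnorm X.
    by rewrite !addr_ge0 ?mulr_ge0 ?sqr_ge0.
  have c0 : 0 < 2^-1 / (fnorm X + 1) by rewrite divr_gt0 // ltr_wpDl.
  have [e [e1 e2 e3]] := small_ex K0 c0 e00.
  have [s [Q [GQ s0 se hQ]]] := h e e1.
  have sx : s * fnorm X <= 2^-1.
    have := le_trans se e2; rewrite ler_pdivlMr ?ltr_wpDl // => hs.
    by apply: (le_trans _ hs); rewrite ler_pM2l // lerDl.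
  have [m hm] := pow_near_expm sX (groupU GQ) s0 se sx hQ t0.
  by exists (Q ^+ m); [exact: groupX|exact: (le_lt_trans hm e3)].
apply: lieI => t; have [t0|t0] := leP 0 t; first exact: pos.
have -> : t%:C *: X = - ((- t)%:C *: X) by rewrite rmorphN scaleNr opprK.
rewrite -(expm_adj (skewZ (- t) sX)); apply/groupJ/pos.
by rewrite oppr_ge0 ltW.
Qed.

Lemma lie_expm X : g X -> G (mexp X).
Proof. by move=> /(lie_mexpZ 1); rewrite scale1r. Qed.

Lemma lieZ a X : g X -> g (a%:C *: X).
Proof. by move=> gX; apply: lieI => t; rewrite scalerA -rmorphM; exact: lie_mexpZ. Qed.

Lemma expm_scale_near n' (X : 'M[C]_n') (e : R) : 0 < e ->
  exists d, [/\ 0 < d & forall s, 0 <= s -> s <= d ->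
    s * fnorm X <= 2^-1 /\ fnorm (mexp (s%:C *: X) - 1%:M - s%:C *: X) <= e * s].
Proof.
move=> e0; have x0 := fnorm_ge0 X.
have K0 : 0 <= 2 * fnorm X ^+ 2 by rewrite mulr_ge0 ?sqr_ge0.
have c0 : 0 < 2^-1 / (fnorm X + 1) by rewrite divr_gt0 // ltr_wpDl.
have [d [d0 d1 d2]] := small_ex K0 c0 e0; exists d; split; first exact: d0.
move=> s s0 sd.
have sx : s * fnorm X <= 2^-1.
  have := le_trans sd d1; rewrite ler_pdivlMr ?ltr_wpDl // => hs.
  by apply: (le_trans _ hs); apply: ler_wpM2l => //; rewrite lerDl.
split; first exact: sx.
have h := @expm_sub1_le _ _ (s%:C *: X); rewrite fnormZ (ger0_norm s0) in h.
apply: (le_trans (h sx)).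
have -> : 2 * (s * fnorm X) ^+ 2 = (2 * fnorm X ^+ 2 * s) * s by ring.
apply: ler_wpM2r => //; apply: (le_trans _ (ltW d2)); exact: ler_wpM2l.
Qed.

Lemma lie_tangent_dir X : g X -> tangent_dir X.
Proof.
move=> gX e e0; have [d [d0 hd]] := expm_scale_near X e0.
have m0 : 0 < Num.min d e by rewrite lt_min d0.
have [|_ h] := hd _ (ltW m0); first by rewrite ge_min lexx.
exists (Num.min d e), (mexp ((Num.min d e)%:C *: X)).
by split; [exact: lie_mexpZ|exact: m0|rewrite ge_min lexx orbT|exact: h].
Qed.

Lemma lie_skew X : g X -> skew X.
Proof. by move=> /lie_tangent_dir/tangent_dir_skew. Qed.

(** If [Y] in [g] is within [e / 2] of [X], then [e^(s Y)] is [1 + s X] up to [e s], so [X] is a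
    tangent direction. *)
Lemma lie_closed : fclosed g.
Proof.
move=> X h; apply: tangent_dir_lie => e e0.
have e2 : 0 < e / 2 by rewrite divr_gt0.
have [Y gY XY] := h _ e2; have [d [d0 hd]] := expm_scale_near Y e2.
have m0 : 0 < Num.min d e by rewrite lt_min d0.
have [|_ hY] := hd _ (ltW m0); first by rewrite ge_min lexx.
exists (Num.min d e), (mexp ((Num.min d e)%:C *: Y)).
split; [exact: lie_mexpZ|exact: m0|by rewrite ge_min lexx orbT|].
move: (Num.min d e) m0 hY => s s0 hY.
have -> : mexp (s%:C *: Y) - 1%:M - s%:C *: X = (mexp (s%:C *: Y) - 1%:M - s%:C *: Y) + s%:C *: (Y - X).
  by rewrite scalerBr addrA subrK.
apply: (le_trans (fnormD _ _)); rewrite fnormZ (ger0_norm (ltW s0)).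
move: (ltW XY) hY; move: (fnorm _) (fnorm _) => b a ha hb.
have : s * a <= s * (e / 2) by rewrite ler_pM2l.
by move: hb; clear; lra.
Qed.

Lemma lieD X Y : g X -> g Y -> g (X + Y).
Proof.
move=> gX gY; apply: tangent_dir_lie => e e0.
have sX := lie_skew gX; have sY := lie_skew gY.
pose c := fnorm X + fnorm Y; have c0 : 0 <= c by rewrite addr_ge0 ?fnorm_ge0.
have K0 : 0 <= 2 * c ^+ 2 by rewrite mulr_ge0 ?sqr_ge0.
have d0 : 0 < Num.min (2^-1 / (c + 1)) e by rewrite lt_min e0 divr_gt0 // ltr_wpDl.
have [s [s0 + hs]] := small_ex K0 d0 e0; rewrite le_min => /andP[s1 s2].
exists s, (mexp (s%:C *: X) *m mexp (s%:C *: Y)).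
split; [by apply: groupM; exact: lie_mexpZ|exact: s0|exact: s2|].
have sc : s * c <= 2^-1.
  rewrite ler_pdivlMr ?ltr_wpDl // in s1.
  by apply: (le_trans _ s1); rewrite ler_pM2l // lerDl.
apply: (le_trans (expm_mulB sX sY (ltW s0) sc)); rewrite -/c.
have -> : 2 * s ^+ 2 * c ^+ 2 = (2 * c ^+ 2 * s) * s by ring.
by rewrite ler_pM2r // ltW.
Qed.

Lemma lieN X : g X -> g (- X).
Proof. by move=> gX; rewrite -scaleN1r -(rmorphN1 (real_complex R)); exact: lieZ. Qed.

Lemma lieB X Y : g X -> g Y -> g (X - Y).
Proof. by move=> gX gY; exact: (lieD gX (lieN gY)). Qed.

Lemma lie0 : g 0.
Proof. by apply: lieI => t; rewrite scaler0 expm0; exact: group1. Qed.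

Lemma lie_sum I (r : seq I) (P : pred I) (F : I -> 'M[C]_n) :
  (forall i, P i -> g (F i)) -> g (\sum_(i <- r | P i) F i).
Proof. by move=> h; apply: (big_ind g); [exact: lie0|exact: lieD|exact: h]. Qed.

Lemma lieJ P X : G P -> g X -> g (P *m X *m P^t*).
Proof.
move=> GP gX; apply: lieI => t; have uP := groupU GP.
have -> : t%:C *: (P *m X *m P^t*) = (P^t*)^t* *m (t%:C *: X) *m P^t*.
  by rewrite trmxCK -scalemxAr -scalemxAl.
rewrite (expm_conj _ (unitarymx_adj uP)) trmxCK.
by apply: groupM; [apply: groupM => //; exact: lie_mexpZ|exact: groupJ].
Qed.

(** By unitarity [E Y E^* - Y] is [E Y - Y E] times [E^*]. Expanding [E] in the commutator gives
    [s (X Y - Y X)] with an error from [r], and replacing the last factor by 1 costs [q]. *)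
Lemma conj_near (E X Y : 'M[C]_n) (s r q : R) : E \is unitarymx -> 0 <= s ->
  fnorm (E - 1%:M - s%:C *: X) <= r -> fnorm (E - 1%:M) <= q ->
  fnorm (E *m Y *m E^t* - Y - s%:C *: (X *m Y - Y *m X)) <=
    2 * r * fnorm Y + s * fnorm (X *m Y - Y *m X) * q.
Proof.
move=> uE s0 hr hq; have EE := unitary_adjr uE.
pose D := E - 1%:M - s%:C *: X; pose B := X *m Y - Y *m X.
have EYY : E *m Y - Y *m E = s%:C *: B + (D *m Y - Y *m D).
  have -> : E = 1%:M + s%:C *: X + D.
    by rewrite /D; clear; apply/matrixP => i j; rewrite !mxE; ring.
  rewrite !mulmxDl !mulmxDr !mul1mx !mulmx1 -scalemxAl -scalemxAr /B scalerBr.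
  move: (D *m Y) (Y *m D) (s%:C *: (X *m Y)) (s%:C *: (Y *m X)); clear => a b c d.
  by apply/matrixP => i j; rewrite !mxE; ring.
have -> : E *m Y *m E^t* - Y - s%:C *: B = (D *m Y - Y *m D) *m E^t* + s%:C *: B *m (E - 1%:M)^t*.
  have -> : D *m Y - Y *m D = E *m Y - Y *m E - s%:C *: B by rewrite EYY [RHS]addrC addKr.
  rewrite adjB adj1 mulmxBr mulmx1 !mulmxBl -(mulmxA Y E) EE mulmx1.
  move: (E *m Y *m E^t*) (s%:C *: B *m E^t*) (s%:C *: B); clear => a b c.
  by apply/matrixP => i j; rewrite !mxE; ring.
apply: (le_trans (fnormD _ _)); apply: lerD.
  rewrite (fnorm_unitaryr _ (unitarymx_adj uE)); apply: (le_trans (fnormB _ _)).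
  have h1 := fnormM D Y; have h2 := fnormM Y D.
  have h3 : fnorm D * fnorm Y <= r * fnorm Y by rewrite ler_wpM2r ?fnorm_ge0.
  move: h1 h2 h3; rewrite (mulrC (fnorm Y)); clear.
  move: (fnorm (D *m Y)) (fnorm (Y *m D)) (fnorm D * fnorm Y) (fnorm Y) => a b c d.
  by rewrite -mulrA; move: (r * d) => f; lra.
apply: (le_trans (fnormM _ _)); rewrite fnormZ (ger0_norm s0) fnorm_adj.
apply: ler_wpM2l hq; by rewrite mulr_ge0 ?fnorm_ge0.
Qed.

(** The bracket is the limit of [(E Y E^* - Y) / s] with [E = e^(s X)]; these quotients lie in [g],
    which is closed. *)
Lemma lie_bracket X Y : g X -> g Y -> g (X *m Y - Y *m X).
Proof.
move=> gX gY; apply: lie_closed => e e0.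
have sX := lie_skew gX; have x0 := fnorm_ge0 X.
pose B := X *m Y - Y *m X.
have K0 : 0 <= 4 * fnorm X ^+ 2 * fnorm Y + 2 * fnorm B * fnorm X.
  by rewrite addr_ge0 ?mulr_ge0 ?fnorm_ge0 ?sqr_ge0.
have c0 : 0 < 2^-1 / (fnorm X + 1) by rewrite divr_gt0 // ltr_wpDl.
have [s [s0 s1 s2]] := small_ex K0 c0 e0.
have sx : s * fnorm X <= 2^-1.
  rewrite ler_pdivlMr ?ltr_wpDl // in s1.
  by apply: (le_trans _ s1); rewrite ler_pM2l // lerDl.
have h1 := @expm_sub1_le _ _ (s%:C *: X); have h2 := @expm_sub1_le2 _ _ (s%:C *: X).
rewrite fnormZ (ger0_norm (ltW s0)) in h1 h2.
have h3 := @conj_near _ X Y s _ _ (expm_unitary (skewZ s sX)) (ltW s0) (h1 sx) (h2 sx).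
rewrite -/B in h3.
have GE : G (mexp (s%:C *: X)) by exact: lie_mexpZ.
move: (mexp _) GE h3 => E GE h3.
exists ((s^-1)%:C *: (E *m Y *m E^t* - Y)).
  by apply/lieZ/lieB; [exact: lieJ|exact: gY].
have -> : (s^-1)%:C *: (E *m Y *m E^t* - Y) - B = (s^-1)%:C *: (E *m Y *m E^t* - Y - s%:C *: B).
  by rewrite [RHS]scalerBr scalerA -rmorphM mulVf ?gt_eqF // scale1r.
have si : 0 <= s^-1 by rewrite invr_ge0 ltW.
rewrite fnormZ (ger0_norm si); apply: (le_lt_trans _ s2).
rewrite mulrC ler_pdivrMr //; apply: (le_trans h3).
rewrite le_eqVlt; apply/orP; left; apply/eqP; clear.
by move: (fnorm X) (fnorm Y) (fnorm B) => x y b; ring.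
Qed.

End Group.
End LieAlgebra.

(** * SVD-components of skew-hermitian matrices and reduction of eigenangles *)

Section SVDCalculus.
Variable R : realType.
Local Notation C := R[i].

Lemma imag_sum I (r : seq I) (P : pred I) (f : I -> R) :
  \sum_(s <- r | P s) imag (f s) = imag (\sum_(s <- r | P s) f s).
Proof.
apply: complex_eq; rewrite ?Re_sum ?Im_sum //=.
by rewrite big1.
Qed.

Lemma imagZ (a x : R) : a%:C * imag x = imag (a * x).
Proof. by apply: complex_eq; rewrite ?ReZ ?ImZ /= ?mulr0. Qed.

Definition svd_sign (s x : R) : R := if `|x| == s then Num.sg x else 0.

Definition svd_values n (th : 'I_n -> R) : seq R :=
  sort >=%O (undup [seq `|th j| | j <- enum 'I_n & th j != 0]).

Lemma svd_valuesP n (th : 'I_n -> R) s :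
  reflect (exists2 j, th j != 0 & s = `|th j|) (s \in svd_values th).
Proof.
rewrite mem_sort mem_undup; apply: (iffP mapP) => [[j]|[j hj ->]].
  by rewrite mem_filter => /andP[hj _] ->; exists j.
by exists j; rewrite // mem_filter hj mem_enum.
Qed.

Lemma svd_values_sum n (th : 'I_n -> R) (f : R -> R) k :
  \sum_(s <- svd_values th) f s * svd_sign s (th k) =
    if th k == 0 then 0 else f `|th k| * Num.sg (th k).
Proof.
case: ifPn => hk.
  rewrite big_seq big1 // => s /svd_valuesP[j hj ->].
  by rewrite /svd_sign (eqP hk) sgr0 if_same mulr0.
rewrite (bigD1_seq `|th k|) /=; last first.
- by rewrite sort_uniq undup_uniq.
- by apply/svd_valuesP; exists k.
rewrite big1 => [|s hs]; last by rewrite /svd_sign eq_sym (negPf hs) mulr0.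
by rewrite addr0 /svd_sign eqxx.
Qed.

(** In the eigenbasis the components are diagonal with entries [i e], where [e] is -1, 0 or 1.
    Distinct components have disjoint supports, and [A A^* A = A] amounts to [e^3 = e]. *)
Lemma svd_decomposition_udiag n (U : 'M[C]_n) (th : 'I_n -> R) :
  U \is unitarymx -> udiag U (fun j => imag (th j)) != 0 ->
  svd_decomposition (udiag U (fun j => imag (th j)))
    (fun i : 'I_(size (svd_values th)) => (svd_values th)`_i)
    (fun i => udiag U (fun j => imag (svd_sign (svd_values th)`_i (th j)))).
Proof.
move=> hU X0; set vals := svd_values th.
have valsP (i : 'I_(size vals)) : vals`_i \in vals by rewrite mem_nth.
have uvals : uniq vals by rewrite sort_uniq undup_uniq.
split; first split.
- rewrite lt0n size_eq0; apply: contra X0 => /eqP vals0.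
  apply/eqP; rewrite -(udiag0 U); apply: eq_udiag => j.
  suff -> : th j = 0 by [].
  apply/eqP/negPn/negP => hj.
  have : `|th j| \in vals by apply/svd_valuesP; exists j.
  by rewrite vals0.
- move=> i; apply/eqP; rewrite -(udiag0 U) => /(udiag_inj hU).
  have /svd_valuesP[j hj ->] := valsP i.
  move=> /(_ j)/(congr1 (@complex.Im R)) /= /eqP.
  by rewrite /svd_sign eqxx sgr_eq0 (negPf hj).
- move=> h i hi.
  have key j : svd_sign vals`_h (th j) * svd_sign vals`_i (th j) = 0.
    rewrite /svd_sign; case: eqP => [->|_]; last by rewrite mul0r.
    by rewrite (nth_uniq 0 (ltn_ord h) (ltn_ord i) uvals) (inj_eq (@ord_inj _)) (negPf hi) mulr0.
  split; rewrite udiag_adj (udiagM _ _ hU) -(udiag0 U); apply: eq_udiag => j;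
    apply: complex_eq; rewrite ?ReM ?ImM ?ReJ ?ImJ /= ?(mul0r, mulr0, addr0, sub0r) //.
  - by rewrite mulNr opprK key.
  - by rewrite mulrN opprK key.
- move=> i; rewrite udiag_adj !(udiagM _ _ hU); apply: eq_udiag => j.
  apply: complex_eq; rewrite ?ReM ?ImM ?ReM ?ImM ?ReJ ?ImJ /= ?(mul0r, mulr0, addr0, sub0r, add0r) ?oppr0 //.
  rewrite mulrN opprK /svd_sign; case: ifP => _; last by rewrite mulr0.
  by case: sgrP; rewrite ?mulr0 ?mulr1 // ?mulrNN ?mulr1 ?mul1r.
- move=> h i hi.
  have srt : sorted >=%O vals by apply: sort_sorted; exact: ge_total.
  have ge_tr : transitive (>=%O : rel R) by move=> x y z h1 h2; exact: le_trans h2 h1.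
  have := sorted_ltn_nth ge_tr 0 srt; move=> /(_ h i); rewrite !inE !ltn_ord => /(_ isT isT hi) hle.
  rewrite lt_neqAle; apply/andP; split; last exact: hle.
  by rewrite (nth_uniq 0 (ltn_ord i) (ltn_ord h) uvals) gtn_eqF.
- by move=> i; have /svd_valuesP[j hj ->] := valsP i; rewrite normr_gt0.
- under [RHS]eq_bigr do rewrite udiagZ.
  rewrite udiag_sum; apply: eq_udiag => j.
  under [RHS]eq_bigr do rewrite imagZ.
  rewrite imag_sum; congr imag.
  transitivity (\sum_(s <- vals) s * svd_sign s (th j)).
    rewrite (svd_values_sum th id); case: eqP => [->//|_].
    by rewrite mulrC -numEsg.
  by rewrite (big_nth 0) big_mkord.
Qed.

Section Closed.
Variables (n : nat) (G : set 'M[C]_n).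
Hypothesis hG : closed_unitary_group G.
Hypothesis hsvd : svd_closed_algebra (lie_algebra G).
Local Notation g := (lie_algebra G).

(* The SVD-components of [U^* diag(i th) U] are the [U^* diag(i e) U], [e j] being
   the sign of [th j] where [|th j|] takes a given positive value. *)
Lemma lie_svd_calculus (U : 'M[C]_n) (th : 'I_n -> R) (phi : R -> R) :
  U \is unitarymx -> (forall x, phi (- x) = - phi x) ->
  g (udiag U (fun j => imag (th j))) -> g (udiag U (fun j => imag (phi (th j)))).
Proof.
move=> hU hphi gX.
have phi0 : phi 0 = 0 by have := hphi 0; rewrite oppr0 => h; lra.
have -> : (fun j => imag (phi (th j))) =
    (fun j => \sum_(i < size (svd_values th))
      (phi (svd_values th)`_i)%:C * imag (svd_sign (svd_values th)`_i (th j))).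
  apply/funext => j; under [RHS]eq_bigr do rewrite imagZ.
  rewrite imag_sum; congr imag.
  transitivity (\sum_(s <- svd_values th) phi s * svd_sign s (th j)).
    rewrite svd_values_sum; case: eqP => [->//|/eqP hj].
    case: sgrP hj => [//|xp|xn] _; first by rewrite mulr1.
    by rewrite mulrN1 hphi opprK.
  by rewrite (big_nth 0) big_mkord.
rewrite -udiag_sum; apply: (lie_sum hG) => i _; rewrite -udiagZ; apply: lieZ.
have [X0|X0] := eqVneq (udiag U (fun j => imag (th j))) 0.
  suff th0 : forall j, th j = 0.
    rewrite (_ : (fun j => _) = (fun=> 0)) ?udiag0; first exact: lie0.
    by apply/funext => j; rewrite th0 /svd_sign sgr0 if_same.
  by move=> j; rewrite -(udiag0 U) in X0; have := udiag_inj hU X0 j => /(congr1 (@complex.Im R)).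
apply: (hsvd gX X0); exists (size (svd_values th)).
eexists; eexists; split; first exact: svd_decomposition_udiag.
by exists i.
Qed.

(** For [s >= 0] this is the representative of [s] modulo 2 pi in [-pi, pi). It is extended to
    negative angles as an odd function, since [lie_svd_calculus] handles only odd functions; as a
    result both -pi and pi occur as values of [red_angle]. *)
Definition red2pi (s : R) : R := s - (Num.truncn ((s + pi) / (2 * pi)))%:R * (2 * pi).
Definition red_angle (x : R) : R := Num.sg x * red2pi `|x|.

Lemma cis_2pi (x : R) k : cis (x - k%:R * (2 * pi)) = cis x :> C.
Proof.
elim: k x => [|k IH] x; first by rewrite mul0r subr0.
have -> : x - k.+1%:R * (2 * pi) = (x - 2 * pi) - k%:R * (2 * pi) by rewrite mulrSr; ring.
rewrite IH; have -> : cis x = cis (x - 2 * pi + pi + pi) :> C by congr cis; ring.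
by rewrite /cis !cosDpi !sinDpi !opprK.
Qed.

Lemma cis_red_angle (x : R) : cis (red_angle x) = cis x :> C.
Proof.
rewrite /red_angle /red2pi; case: sgrP => [->|x0|x0].
- by rewrite mul0r.
- by rewrite mul1r cis_2pi.
- rewrite mulN1r; have := cis_2pi (- x) (Num.truncn ((- x + pi) / (2 * pi))).
  rewrite /cis; move: (_ - _ * _) => r [hc hs].
  by rewrite cosN sinN hc hs cosN sinN opprK.
Qed.

Lemma red_angle_le (x : R) : `|red_angle x| <= pi.
Proof.
rewrite /red_angle normrM; have pi0 := pi_gt0 R.
have s0 : 0 <= `|x| by exact: normr_ge0.
have hr : `|red2pi `|x| | <= pi.
  rewrite /red2pi; move: `|x| s0 => s s0.
  have h0 : 0 <= (s + pi) / (2 * pi) by apply: divr_ge0; lra.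
  have /andP[] := truncn_itv h0; move: (Num.truncn _) => k.
  rewrite ler_pdivlMr ?mulr_gt0 // ltr_pdivrMr ?mulr_gt0 // => h1 h2.
  rewrite mulrSr in h2; rewrite ler_norml; apply/andP; split; lra.
rewrite normr_sg; case: (x != 0); first by rewrite mul1r.
by rewrite mul0r ltW.
Qed.

Lemma red_angleN (x : R) : red_angle (- x) = - red_angle x.
Proof. by rewrite /red_angle sgrN normrN mulNr. Qed.

Lemma lie_expm_reduce X : g X -> exists (U : 'M[C]_n) (th : 'I_n -> R),
  [/\ U \is unitarymx, forall j, `|th j| <= pi,
      g (udiag U (fun j => imag (th j))) &
      mexp (udiag U (fun j => imag (th j))) = mexp X].
Proof.
move=> gX; have [U [th [hU XE]]] := skew_spectral (lie_skew hG gX).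
exists U, (fun j => red_angle (th j)); split; first exact: hU.
- by move=> j; exact: red_angle_le.
- by apply: (lie_svd_calculus hU red_angleN); rewrite -XE.
- rewrite XE !(expm_udiag _ hU); apply: eq_udiag => j; exact: cis_red_angle.
Qed.

End Closed.
End SVDCalculus.

(** * Logarithms of the group elements close to the identity *)

Section Surjectivity.
Variable R : realType.
Local Notation C := R[i].

Lemma fnorm_udiag n (U : 'M[C]_n) (th : 'I_n -> R) : U \is unitarymx ->
  fnorm (udiag U (fun j => imag (th j))) ^+ 2 = \sum_j th j ^+ 2.
Proof.
move=> hU; rewrite -(fnorm_unitaryl _ hU) -(fnorm_unitaryr _ (unitarymx_adj hU)).
rewrite (udiagK _ hU) fnorm_sqr_sum; apply: eq_bigr => i _.
rewrite (bigD1 i) //= big1 => [|j ji].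
  by rewrite !mxE eqxx mulr1n normc_sqr /= expr0n add0r addr0.
by rewrite !mxE eq_sym (negPf ji) mulr0n normc0 expr0n.
Qed.

Lemma expm_continuous n (P : 'M[C]_n) (e : R) : 0 < e ->
  exists2 d, 0 < d & forall X, fnorm (X - P) < d -> fnorm (mexp X - mexp P) < e.
Proof.
move=> e0; pose r := fnorm P + 1.
have r0 : 0 <= r by rewrite addr_ge0 ?fnorm_ge0.
have K0 : 0 <= expR r by exact: expR_ge0.
have [d [d0 d1 d2]] := small_ex K0 ltr01 e0; exists d; first exact: d0.
move=> X XP.
have hP : fnorm P <= r by rewrite lerDl.
have hX : fnorm X <= r.
  have := fnorm_lerB X P; move: XP d1; rewrite /r; clear.
  by move: (fnorm (X - P)) (fnorm X) (fnorm P) => a b c; lra.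
apply: (@le_lt_trans _ _ (expR r * d)); last exact: d2.
have := fnormD (mexp X - mexp P - (X - P)) (X - P); rewrite subrK => h.
apply: (le_trans h); have := expmB hX hP => h'.
apply: (@le_trans _ _ (fnorm (X - P) * expR r)).
  by move: h'; rewrite mulrBr mulr1 lerBrDr.
by rewrite mulrC ler_wpM2l // ltW.
Qed.

(** The sign is there because [fnorm_EVT] provides maxima, while distances are to be minimised. *)
Lemma expm_dist_continuous n (Q : 'M[C]_n) P :
  fcontinuous_at (fun X => - fnorm (Q - mexp X)) P.
Proof.
move=> e e0; have [d d0 h] := expm_continuous P e0; exists d; first exact: d0.
move=> X /h; move: (mexp X) (mexp P) => A B hAB.
apply: le_lt_trans hAB.
have h1 := fnorm_dist Q A B; have h2 := fnorm_dist Q B A.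
rewrite (fnorm_distC B A) in h2.
move: h1 h2; move: (fnorm (Q - A)) (fnorm (Q - B)) (fnorm (A - B)); clear => a b c h1 h2.
by rewrite ler_norml; apply/andP; split; lra.
Qed.

(* First-order expansion of [s |-> ip Q (e^(sW) Y e^(-sW))] at [s = 0]. *)
Lemma conj_critical n (Q Y W : 'M[C]_n) : skew W ->
  (forall s : R, 0 < s -> ip Q (mexp (s%:C *: W) *m Y *m (mexp (s%:C *: W))^t*) <= ip Q Y) ->
  ip Q (W *m Y - Y *m W) <= 0.
Proof.
move=> sW h; pose B := W *m Y - Y *m W; rewrite -/B.
have w0 := fnorm_ge0 W; have q0 := fnorm_ge0 Q.
pose K := fnorm Q * (4 * fnorm W ^+ 2 * fnorm Y + 2 * fnorm B * fnorm W).
apply: (@small_le0 _ _ (K * (2^-1 / (fnorm W + 1)))) => e e0 e1.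
have c0 : 0 < 2^-1 / (fnorm W + 1) by rewrite divr_gt0 // ltr_wpDl.
pose s := 2^-1 / (fnorm W + 1) * e; have s0 : 0 < s by rewrite mulr_gt0.
have sw : s * fnorm W <= 2^-1.
  apply: (@le_trans _ _ (2^-1 / (fnorm W + 1) * (fnorm W + 1))); last first.
    by rewrite divfK // gt_eqF // ltr_wpDl.
  rewrite /s -mulrA ler_pM2l //; apply: (@le_trans _ _ (1 * fnorm W)).
    by rewrite ler_wpM2r.
  by rewrite mul1r lerDl.
have h1 := @expm_sub1_le _ _ (s%:C *: W); have h2 := @expm_sub1_le2 _ _ (s%:C *: W).
rewrite fnormZ (ger0_norm (ltW s0)) in h1 h2.
have h3 := @conj_near _ _ _ W Y s _ _ (expm_unitary (skewZ s sW)) (ltW s0) (h1 sw) (h2 sw).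
rewrite -/B in h3; have h4 := h s s0; move: (mexp _) h3 h4 => E h3 h4.
have h5 := ip_CauchySchwarz Q (E *m Y *m E^t* - Y - s%:C *: B).
rewrite !ipBr ipZr in h5.
have h6 : fnorm Q * fnorm (E *m Y *m E^t* - Y - s%:C *: B) <= s * (K * s).
  apply: (le_trans (ler_wpM2l q0 h3)); rewrite le_eqVlt; apply/orP; left; apply/eqP.
  rewrite /K; clear; move: (fnorm Q) (fnorm W) (fnorm Y) (fnorm B) s => q w y b s; ring.
have h7 : s * ip Q B <= s * (K * s).
  move: (le_trans h5 h6) h4; clear; rewrite ler_norml => /andP[h1 _].
  by move: h1; move: (ip Q B) (ip Q Y) (ip Q _) (K * s) => a b c d; lra.
by move: h7; rewrite ler_pM2l // /s mulrA.
Qed.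

Section Group.
Variables (n : nat) (G : set 'M[C]_n).
Hypothesis hG : closed_unitary_group G.
Local Notation g := (lie_algebra G).

(** The group is tangent to [1 + g] at 1. Otherwise some sequence in [G] tends to 1 with normalised
    differences [(Q - 1) / |Q - 1|] at distance more than [eps] from [g]; by compactness these
    cluster at some [Z], which is a tangent direction and hence in [g]. *)
Lemma group_direction (eps : R) : 0 < eps -> exists2 d, 0 < d &
  forall Q, G Q -> 0 < fnorm (Q - 1%:M) -> fnorm (Q - 1%:M) < d ->
  exists2 Z, g Z & fnorm (Q - 1%:M - Z) <= eps * fnorm (Q - 1%:M).
Proof.
move=> eps0; apply: contrapT => hno.
have bad (k : nat) : exists Q, [/\ G Q, 0 < fnorm (Q - 1%:M),
    fnorm (Q - 1%:M) < k.+1%:R^-1 &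
    forall Z, g Z -> ~ fnorm (Q - 1%:M - Z) <= eps * fnorm (Q - 1%:M)].
  apply: contrapT => hk; apply: hno; exists (k.+1%:R^-1); first by rewrite invr_gt0.
  move=> Q GQ Q0 Qk; apply: contrapT => hZ; apply: hk; exists Q.
  by split=> // Z gZ hle; apply: hZ; exists Z.
have [q hq] := choice bad.
pose s k : R := fnorm (q k - 1%:M).
pose D k := ((s k)^-1)%:C *: (q k - 1%:M).
have s0 k : 0 < s k by have [] := hq k.
have nD k : fnorm (D k) <= 1.
  rewrite fnormZ (gtr0_norm _) ?invr_gt0 // -/(s k) mulVf //.
  by rewrite gt_eqF.
have [Z hZ] := fnorm_BolzanoWeierstrass nD.
have near k (e : R) : fnorm (D k - Z) < e -> fnorm (q k - 1%:M - (s k)%:C *: Z) <= e * s k.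
  move=> hD; have -> : q k - 1%:M - (s k)%:C *: Z = (s k)%:C *: (D k - Z).
    by rewrite scalerBr /D scalerA -rmorphM divff ?gt_eqF // scale1r.
  by rewrite fnormZ (gtr0_norm (s0 k)) mulrC ler_pM2r // ltW.
have gZ : g Z.
  apply: (tangent_dir_lie hG) => e e0.
  have [N hN] : exists N : nat, e^-1 <= N.+1%:R.
    by exists (Num.truncn e^-1); apply/ltW/truncnS_gt.
  have [k Nk hk] := hZ e N e0; exists (s k), (q k).
  have [h1 _ h2 _] := hq k; split; [exact: h1|exact: s0| |exact: near].
  apply: ltW; apply: (lt_le_trans h2).
  rewrite -(invrK e) lef_pV2 ?posrE ?invr_gt0 //.
  by apply: (le_trans hN); rewrite ler_nat.
have [k _ hk] := hZ eps 0%N eps0; have [_ _ _ h] := hq k.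
by apply: (h ((s k)%:C *: Z)); [exact: lieZ|exact: near].
Qed.

(** Let [X] minimise the distance from [Q] to [e^X] over a small ball of [g]. If that distance were
    positive, the direction in [g] of the multiplicative error would give a correction [Z] for which
    [e^(X + Z)] is strictly closer to [Q], as in a Newton step. *)
Lemma group_local_log (r : R) : 0 < r -> exists2 d, 0 < d &
  forall Q, G Q -> fnorm (Q - 1%:M) < d ->
  exists B, [/\ g B, fnorm B <= r & mexp B = Q].
Proof.
(* With [rho <= 1/32] and a direction exact up to a relative error 1/4, the correction has norm at
   most 5/4 of the old error, and the new error is at most [1/4 + 2 (1/16) (5/4) = 13/32] of the old
   one. *)
move=> r0; pose rho := Num.min r 32^-1.
have rho0 : 0 < rho by rewrite lt_min r0 /=; lra.
have rho1 : rho <= 32^-1 by rewrite ge_min lexx orbT.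
have rhor : rho <= r by rewrite ge_min lexx.
have c32 : (32^-1 : R) <= 2^-1 by lra.
have e40 : (0 : R) < 4^-1 by lra.
have [d0 d00 hdir] := group_direction e40.
pose d := Num.min d0 (rho / 8).
have dd0 : d <= d0 by rewrite ge_min lexx.
have drho : d <= rho / 8 by rewrite ge_min lexx orbT.
have dgt0 : 0 < d by rewrite lt_min d00 /=; lra.
clearbody rho d; exists d => // Q GQ Qd.
pose K := [set X | g X /\ fnorm X <= rho].
have K0 : K !=set0 by exists 0; split; [exact: lie0|rewrite fnorm0 ltW].
have cK : fclosed K.
  move=> P h; split; first by apply: (lie_closed hG) => e /h[X [gX _] PX]; exists X.
  apply/ler_addgt0Pr => e e0; have [X [_ hX] PX] := h e e0.
  have := fnorm_lerB P X; rewrite fnorm_distC; move: hX PX; clear.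
  by move: (fnorm _) (fnorm X) (fnorm P) => a b c; lra.
have [X [gX Xrho] minX] := fnorm_EVT K0 cK (fun Q (h : K Q) => proj2 h) (expm_dist_continuous Q).
have e_le : fnorm (Q - mexp X) <= fnorm (Q - 1%:M).
  have := minX 0; rewrite expm0 lerN2; apply.
  by split; [exact: lie0|rewrite fnorm0 ltW].
exists X; split; [exact: gX|exact: (le_trans Xrho rhor)|].
have [e0|e0] := leP (fnorm (Q - mexp X)) 0.
  by move/fnorm_le0/eqP: e0; rewrite subr_eq0 => /eqP.
exfalso; have sX := lie_skew hG gX; have uX := expm_unitary sX.
(* The multiplicative error: it is in [G], and its distance to 1 is the distance from [Q] to
   [e^X]. *)
pose Q' := (mexp X)^t* *m Q.
have GQ' : G Q' by apply: (groupM hG) => //; apply: (groupJ hG); exact: lie_expm.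
have XQ' : mexp X *m Q' = Q by rewrite mulmxA unitary_adjr // mul1mx.
have Q'E : fnorm (Q' - 1%:M) = fnorm (Q - mexp X).
  rewrite -(fnorm_unitaryl _ uX) mulmxBr mulmx1; congr (fnorm (_ - _)).
  exact: XQ'.
have Q'd : fnorm (Q' - 1%:M) < d0.
  by rewrite Q'E; apply: (le_lt_trans e_le); exact: (lt_le_trans Qd dd0).
have [|Z gZ hZ] := hdir Q' GQ' _ Q'd; first by rewrite Q'E.
have x0 := fnorm_ge0 X.
have X12 : fnorm X <= 2^-1.
  exact: (le_trans Xrho (le_trans rho1 c32)).
have h1 := expm_sub1_le X12; have h2 := expm_sub1_le2 X12.
have h3 : fnorm X <= fnorm (mexp X - 1%:M - X) + fnorm (mexp X - 1%:M).
  have := fnormB (mexp X - 1%:M) (mexp X - 1%:M - X).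
  by rewrite subKr addrC.
have h4 : fnorm (mexp X - 1%:M) <= fnorm (Q - mexp X) + fnorm (Q - 1%:M).
  by rewrite (fnorm_distC Q (mexp X)); exact: fnorm_dist.
have h5 : fnorm Z <= fnorm (Q' - 1%:M) + fnorm (Q' - 1%:M - Z).
  by have := fnormB (Q' - 1%:M) (Q' - 1%:M - Z); rewrite subKr.
(* The corrected point remains admissible: [e^X] is within [2 d <= rho / 4] of 1, which keeps [X]
   well inside the ball, and [Z] is at most 5/4 of [rho / 8]. *)
have hXZ : fnorm (X + Z) <= rho.
  apply: (le_trans (fnormD _ _)); move: h1 h3 h4 h5 hZ e_le Qd drho Xrho rho1; rewrite Q'E expr2.
  move: (fnorm X) x0 (fnorm Z) (fnorm (mexp X - 1%:M - X)) (fnorm (mexp X - 1%:M)) (fnorm (Q - mexp X)) (fnorm (Q - 1%:M)) (fnorm (Q' - 1%:M - Z)).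
  clear => x x0 z a b e q w h1 h3 h4 h5 hZ e_le Qd drho Xrho rho1.
  have : x * x <= 32^-1 * x by rewrite ler_wpM2r // (le_trans Xrho).
  by lra.
have h6 := @expmB_small _ _ (X + Z) X rho _ hXZ Xrho.
have h7 : fnorm (Q - mexp (X + Z)) <= fnorm (Q' - 1%:M - Z) + fnorm (mexp X - 1%:M) * fnorm Z + 2 * rho * fnorm Z.
  have -> : Q - mexp (X + Z) = (mexp X *m (Q' - 1%:M - Z) + (mexp X - 1%:M) *m Z) -
     (mexp (X + Z) - mexp X - (X + Z - X)).
    rewrite !mulmxBr XQ' mulmx1 mulmxBl mul1mx.
    move: (mexp X) (mexp (X + Z)) => P S; move: (P *m Z); clear => PZ.
    by apply/matrixP => i j; rewrite !mxE; ring.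
  apply: (le_trans (fnormB _ _)); apply: lerD.
    apply: (le_trans (fnormD _ _)); rewrite (fnorm_unitaryl _ uX) lerD2l.
    exact: fnormM.
  apply: (le_trans (h6 (le_trans rho1 c32))).
  by have -> : X + Z - X = Z; [rewrite addrAC subrr add0r|exact: lexx].
have := minX (X + Z) (conj (lieD hG gX gZ) hXZ); rewrite lerN2 leNgt => /negP; apply.
apply: (le_lt_trans h7).
move: h5 hZ h2 Xrho rho1 e0; rewrite Q'E; have := fnorm_ge0 Z; move: x0.
move: (fnorm X) (fnorm Z) (fnorm (mexp X - 1%:M)) (fnorm (Q - mexp X)) (fnorm (Q' - 1%:M - Z)).
clear => x z a e w x0 z0 h5 hZ h2 Xrho rho1 e0.
have : a * z <= 16^-1 * z by rewrite ler_wpM2r //; lra.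
have : rho * z <= 32^-1 * z by rewrite ler_wpM2r //; lra.
by rewrite -mulrA; lra.
Qed.

End Group.
End Surjectivity.

(** * Surjectivity of the exponential *)

Section ExpSurjective.
Variable R : realType.
Local Notation C := R[i].
Variables (n : nat) (G : set 'M[C]_n).
Hypothesis hG : closed_unitary_group G.
Hypothesis hsvd : svd_closed_algebra (lie_algebra G).
Local Notation g := (lie_algebra G).

Definition exp_image : set 'M[C]_n := [set P | exists2 X, g X & mexp X = P].

(** By [lie_expm_reduce] every point of [exp g] has a logarithm in [g] with eigenangles in
    [-pi, pi], hence of norm at most [sqrt (n pi^2)]; the minimum over a compact ball is therefore a
    minimum over all of [g]. *)
Lemma exp_image_closest (Q : 'M[C]_n) : exists2 X, g X &
  forall Y, g Y -> fnorm (Q - mexp X) <= fnorm (Q - mexp Y).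
Proof.
pose b : R := Num.sqrt (n%:R * pi ^+ 2).
pose K := [set X | g X /\ fnorm X <= b].
have K0 : K !=set0 by exists 0; split; [exact: lie0|rewrite fnorm0 sqrtr_ge0].
have cK : fclosed K.
  move=> P h; split; first by apply: (lie_closed hG) => e /h[X [gX _] PX]; exists X.
  apply/ler_addgt0Pr => e e0; have [X [_ hX] PX] := h e e0.
  have := fnorm_lerB P X; rewrite fnorm_distC; move: hX PX; clear.
  by move: (fnorm _) (fnorm X) (fnorm P) => a' b' c; lra.
have [X [gX Xb] minX] := fnorm_EVT K0 cK (fun Q (h : K Q) => proj2 h) (expm_dist_continuous Q).
exists X; first exact: gX.
move=> Y /(lie_expm_reduce hG hsvd)[U [th [hU hth gY <-]]].
suff hb : fnorm (udiag U (fun j => imag (th j))) <= b by rewrite -lerN2; exact: minX (conj gY hb).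
rewrite -(ler_pXn2r (n := 2)) ?nnegrE ?fnorm_ge0 ?sqrtr_ge0 //.
rewrite (fnorm_udiag _ hU) (sqr_sqrtr (mulr_ge0 (ler0n _ _) (sqr_ge0 _))).
apply: (@le_trans _ _ (\sum_(j < n) pi ^+ 2)).
  apply: ler_sum => j _; rewrite -(real_normK (num_real (th j))).
  have pi0 : 0 <= pi :> R by exact: pi_ge0.
  by apply: lerXn2r; rewrite ?nnegrE ?normr_ge0 ?pi0 ?hth.
by rewrite sumr_const card_ord mulr_natl.
Qed.

Lemma exp_image_sub : exp_image `<=` G.
Proof. by move=> _ [X gX <-]; exact: lie_expm. Qed.

Lemma exp_image_fclosed : fclosed exp_image.
Proof.
move=> P h; have [X gX minX] := exp_image_closest P; exists X; first exact: gX.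
apply/esym/eqP; rewrite -subr_eq0; apply/eqP/fnorm_le0/ler_addgt0Pr => e e0.
have [_ [Y gY <-] hY] := h e e0; rewrite add0r.
by apply: (le_trans (minX Y gY)); rewrite fnorm_distC ltW.
Qed.

(* Conjugating the point [M] of [exp g] closest to [Q = M e^B] gives [Ad_M B = B]. *)
Lemma closest_commutes (X B : 'M[C]_n) : g X -> g B -> fnorm B <= 8^-1 ->
  (forall Y, g Y -> fnorm (mexp X *m mexp B - mexp X) <= fnorm (mexp X *m mexp B - mexp Y)) ->
  mexp X *m B = B *m mexp X.
Proof.
have h82 : (8^-1 : R) <= 2^-1 by lra.
have h28 : (2 * 8^-1 : R) < 1 by lra.
move=> gX gB B8 minX; have sX := lie_skew hG gX; have sB := lie_skew hG gB.
have uM := expm_unitary sX; have GM := lie_expm gX.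
have eXM W : G W -> mexp (W *m X *m W^t*) = W *m mexp X *m W^t*.
  move=> GW; have := expm_conj X (unitarymx_adj (groupU hG GW)).
  by rewrite trmxCK.
move: (mexp X) uM GM minX eXM => M uM GM minX eXM; pose Q := M *m mexp B.
(* The conjugates of [M] by elements of [G] are again in [exp g] and have the norm of [M], so
   minimal distance to [Q] means maximal inner product with [Q]. *)
have crit W : g W -> ip Q (W *m M - M *m W) <= 0.
  move=> gW; apply: conj_critical; first exact: lie_skew gW.
  move=> s s0; set E := mexp (s%:C *: W).
  have GE : G E by exact: lie_mexpZ.
  have uE := groupU hG GE.
  have := minX _ (lieJ hG GE gX); rewrite (eXM _ GE) -/Q.
  rewrite -(ler_pXn2r (n := 2)) ?nnegrE ?fnorm_ge0 // !fnorm_sqr.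
  have NE : ip (E *m M *m E^t*) (E *m M *m E^t*) = ip M M.
    by rewrite (ip_unitaryr _ _ (unitarymx_adj uE)) (ip_unitaryl _ _ uE).
  rewrite !(ipBl, ipBr) NE (ipC M Q) (ipC (E *m M *m E^t*) Q).
  move: (ip Q Q) (ip Q M) (ip M M) (ip Q _); clear => a b c d; lra.
have gB' : g (M *m B *m M^t*) by exact: lieJ.
have expB' : mexp (M *m B *m M^t*) = M *m mexp B *m M^t*.
  by have := expm_conj B (unitarymx_adj uM); rewrite trmxCK.
have nB' : fnorm (M *m B *m M^t*) = fnorm B.
  by rewrite (fnorm_unitaryr _ (unitarymx_adj uM)) (fnorm_unitaryl _ uM).
have B'E : M *m B *m M^t* *m M = M *m B.
  by rewrite -(mulmxA (M *m B)) (unitary_adjl uM) mulmx1.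
move: (M *m B *m M^t*) gB' expB' nB' B'E => B' gB' expB' nB' B'E.
(* The variations along [W] and [- W] together give an equality. Moving [M] across the inner product
   turns [Q] into [Q M^* = e^B'] on one side and into [M^* Q = e^B] on the other. *)
have orth W : g W -> ip W (mexp B') = ip W (mexp B).
  move=> gW; have h1 := crit W gW; have h2 := crit (- W) (lieN gW).
  have e1 : ip Q (W *m M) = ip W (mexp B') by rewrite (ipC Q) (ipMr W M Q) expB'.
  have e2 : ip Q (M *m W) = ip W (mexp B).
    rewrite (ipC Q) (ipMl M W Q) /Q mulmxA (unitary_adjl uM) mul1mx; exact: erefl.
  rewrite mulNmx mulmxN opprK in h2.
  rewrite ipDr ipNr in h2; rewrite ipBr in h1; rewrite e1 e2 in h1 h2.
  rewrite subr_le0 in h1; rewrite addrC subr_le0 in h2.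
  apply: le_anti; apply/andP; split; [exact: h1|exact: h2].
have gW : g (B' - B) := lieB hG gB' gB.
have B'8 : fnorm B' <= 8^-1 by rewrite nB'.
(* For [W = B' - B] the previous equality says that [W] is orthogonal to [e^B' - e^B]. The latter is
   [W] up to an error of at most [2 / 8] times the norm of [W], which is impossible for nonzero
   [W]. *)
have W0 : B' - B = 0.
  have h := expmB_small h82 B'8 B8.
  move: (B' - B) gW h => W gW h.
  have h0 : ip W (mexp B' - mexp B - W) = - fnorm W ^+ 2.
    rewrite (ipBr _ W W) (ipBr _ _ W) (orth W gW) (subrr (ip W (mexp B))) sub0r fnorm_sqr; exact: erefl.
  have h1 := ip_CauchySchwarz W (mexp B' - mexp B - W); rewrite h0 normrN in h1.
  rewrite ger0_norm ?sqr_ge0 // in h1.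
  have h2 := ler_wpM2l (fnorm_ge0 W) h.
  apply: fnorm_le0; rewrite leNgt; apply/negP => W0.
  have := le_trans h1 h2; rewrite expr2 mulrCA (ler_pMl _ (mulr_gt0 W0 W0)) leNgt.
  by rewrite h28.
have B'B : B' = B by apply/eqP; rewrite -subr_eq0 W0.
by rewrite -{2}B'B -B'E B'B.
Qed.

Lemma centralizer_closed (M : 'M[C]_n) : fclosed [set h | G h /\ h *m M = M *m h].
Proof.
move=> P h; split; first by apply: (group_fclosed hG) => e /h[Q [GQ _] PQ]; exists Q.
apply/eqP; rewrite -subr_eq0; apply/eqP/fnorm_le0.
apply: (@small_le0 _ _ (2 * fnorm M)) => e e0 _.
have [Q [_ QM] PQ] := h e e0.
have -> : P *m M - M *m P = M *m (Q - P) - (Q - P) *m M.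
  rewrite mulmxBl mulmxBr QM; move: (P *m M) (M *m P) (M *m Q); clear => a b c.
  by apply/matrixP => i j; rewrite !mxE; ring.
apply: (le_trans (fnormB _ _)); have h1 := fnormM M (Q - P); have h2 := fnormM (Q - P) M.
have h3 : fnorm M * fnorm (Q - P) <= fnorm M * e by rewrite ler_wpM2l ?fnorm_ge0 // ltW.
rewrite (mulrC (fnorm (Q - P))) in h2; move: h1 h2 h3.
rewrite -mulrA; move: (fnorm (M *m _)) (fnorm (_ *m M)) (fnorm M * _) (fnorm M * _).
clear => a b c d h1 h2 h3; lra.
Qed.

Lemma conj_ip_continuous (X B P : 'M[C]_n) :
  fcontinuous_at (fun h => ip B (h *m X *m h^t*)) P.
Proof.
move=> e e0.
have b0 := fnorm_ge0 B; have x0 := fnorm_ge0 X; have p0 := fnorm_ge0 P.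
have K0 : 0 <= fnorm B * (fnorm X * (2 * fnorm P + 1)).
  by rewrite !mulr_ge0 ?addr_ge0 ?mulr_ge0.
have [d [d0 d1 d2]] := small_ex K0 ltr01 e0; exists d; first exact: d0.
move=> Q QP; rewrite -ipBr; apply: (le_lt_trans (ip_CauchySchwarz _ _)).
apply: (le_lt_trans _ d2); rewrite -mulrA; apply: (ler_wpM2l b0).
have -> : Q *m X *m Q^t* - P *m X *m P^t* = (Q - P) *m X *m Q^t* + P *m X *m (Q - P)^t*.
  by rewrite adjB mulmxBr !mulmxBl addrA subrK.
have hQ : fnorm Q <= fnorm P + 1.
  have := fnorm_lerB Q P; move: QP d1; move: (fnorm (Q - P)) (fnorm Q) (fnorm P).
  by clear => a b c h1 h2 h3; lra.
have q0 := fnorm_ge0 (Q - P).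
apply: (le_trans (fnormD _ _)).
have h1 : fnorm ((Q - P) *m X *m Q^t*) <= d * fnorm X * (fnorm P + 1).
  apply: (le_trans (fnormM _ _)); rewrite fnorm_adj; apply: ler_pM => //; rewrite ?fnorm_ge0 //.
  by apply: (le_trans (fnormM _ _)); apply: ler_wpM2r => //; exact: ltW.
have h2 : fnorm (P *m X *m (Q - P)^t*) <= fnorm P * fnorm X * d.
  apply: (le_trans (fnormM _ _)); rewrite fnorm_adj.
  by apply: ler_pM; [exact: fnorm_ge0|exact: fnorm_ge0|exact: fnormM|exact: ltW].
apply: (le_trans (lerD h1 h2)); rewrite le_eqVlt; apply/orP; left; apply/eqP; ring.
Qed.

(* Maximising [ip B (Ad_h X)] over the centraliser of [M = e^X] yields a logarithm of
   [M] commuting with [B]. *)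
Lemma commuting_log (X B : 'M[C]_n) : g X -> g B -> mexp X *m B = B *m mexp X ->
  exists X', [/\ g X', mexp X' = mexp X & X' *m B = B *m X'].
Proof.
move=> gX gB MB; set M := mexp X in MB *.
have MX : M *m X = X *m M by exact: expm_comm.
have bH : forall h, [set h | G h /\ h *m M = M *m h] h -> fnorm h <= fnorm (1%:M : 'M[C]_n).
  by move=> h [Gh _]; rewrite -[h]mulmx1 (fnorm_unitaryl _ (groupU hG Gh)).
have H0 : [set h | G h /\ h *m M = M *m h] !=set0.
  by exists 1%:M; split; [exact: group1|rewrite mul1mx mulmx1].
have [h [Gh hM] maxh] := fnorm_EVT H0 (@centralizer_closed M) bH (conj_ip_continuous X B).
have uh := groupU hG Gh.
pose X' := h *m X *m h^t*; have gX' : g X' by exact: lieJ.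
have eX' : mexp X' = M.
  have := expm_conj X (unitarymx_adj uh); rewrite trmxCK => ->.
  by rewrite -/M hM -mulmxA unitary_adjr // mulmx1.
have X'M : X' *m M = M *m X' by rewrite -eX'; apply/esym/expm_comm.
(* When [W] commutes with [M], so does [e^(s W)], and conjugating by it stays within the orbit over
   which [X'] is a maximum. *)
have crit W : g W -> W *m M = M *m W -> ip B (W *m X' - X' *m W) <= 0.
  move=> gW WM; apply: conj_critical; first exact: lie_skew gW.
  move=> s s0; set E := mexp (s%:C *: W).
  have GE : G E by exact: lie_mexpZ.
  have EM : E *m M = M *m E.
    by apply: expm_comm; rewrite -scalemxAl -scalemxAr WM.
  have -> : E *m X' *m E^t* = (E *m h) *m X *m (E *m h)^t*.
    by rewrite adjM /X' !mulmxA.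
  apply: maxh; split; first exact: (groupM hG).
  by rewrite -mulmxA hM !mulmxA EM.
(* The bracket is itself an admissible direction, since [X'] and [B] both commute with [M]. As [X']
   is skew, the first variation along [D] is the squared norm of [D], which must therefore
   vanish. *)
pose D := X' *m B - B *m X'; have gD : g D by exact: (lie_bracket hG).
have DM : D *m M = M *m D.
  have e1 : X' *m B *m M = M *m (X' *m B) by rewrite -mulmxA -MB mulmxA X'M mulmxA.
  have e2 : B *m X' *m M = M *m (B *m X') by rewrite -mulmxA X'M mulmxA -MB mulmxA.
  by rewrite /D mulmxBl mulmxBr e1 e2.
exists X'; split; [exact: gX'|exact: eX'|].
apply/eqP; rewrite -subr_eq0 -/D; apply/eqP/ip_eq0.
have h1 := crit D gD DM.
have h2 := crit (- D) (lieN gD) _; rewrite mulNmx mulmxN DM in h2.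
have {}h2 := h2 erefl.
rewrite mulNmx mulmxN opprK in h2.
have sX' : X'^t* = - X' := lie_skew hG gX'.
have e1 : ip B (D *m X') = - ip D (B *m X').
  by rewrite ipC ipMr sX' mulmxN ipNr.
have e2 : ip B (X' *m D) = - ip D (X' *m B).
  by rewrite ipC ipMl sX' mulNmx ipNr.
rewrite ipDr ipNr in h2; rewrite ipBr in h1; rewrite e1 e2 ?opprK in h1 h2.
have -> : ip D D = ip D (X' *m B) - ip D (B *m X') by rewrite -(ipBr _ _ D).
by move: h1 h2; move: (ip D (X' *m B)) (ip D (B *m X')) => a b h1 h2; lra.
Qed.

(** One [d] serves for every [M]: the argument takes place at the point [e^X] of [exp g] closest to
    [Q], which is at least as close as [M], so [(e^X)^* Q] is within [d] of 1 and has a logarithm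
    [B] in [g]. *)
Lemma exp_image_open : exists2 d : R, 0 < d &
  forall M Q, exp_image M -> G Q -> fnorm (Q - M) < d -> exp_image Q.
Proof.
have e80 : (0 : R) < 8^-1 by lra.
have [d d0 hloc] := group_local_log hG e80; exists d; first exact: d0.
move=> M Q [Y gY <-] GQ hQ.
have [X gX minX] := exp_image_closest Q.
have uM := expm_unitary (lie_skew hG gX).
have GM := lie_expm gX.
have [||B [gB B8 eB]] := hloc ((mexp X)^t* *m Q).
- by apply: (groupM hG); [exact: (groupJ hG)|exact: GQ].
- rewrite -(fnorm_unitaryl _ uM) mulmxBr mulmx1 mulmxA unitary_adjr // mul1mx.
  exact: (le_lt_trans (minX Y gY)).
have QE : mexp X *m mexp B = Q by rewrite eB mulmxA unitary_adjr // mul1mx.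
have MB : mexp X *m B = B *m mexp X.
  by apply: closest_commutes => // Z gZ; rewrite QE; exact: minX.
have [X' [gX' eX' XB]] := commuting_log gX gB MB.
exists (X' + B); first exact: (lieD hG).
by rewrite expm_add_comm ?eX' //; apply: (lie_skew hG).
Qed.

Lemma exp_surjective : connected (G : set 'M[C^o]_n) -> G `<=` exp_image.
Proof.
move=> conn; have -> : exp_image = G; last by [].
have [d d0 hop] := exp_image_open.
apply: conn.
- by exists 1%:M, 0; [exact: lie0|exact: expm0].
(* Relative openness is witnessed by the [d]-neighbourhood of the image, whose trace on [G] is the
   image itself. *)
- exists [set Q : 'M[C^o]_n | exists2 M, exp_image M & fnorm ((Q : 'M[C]_n) - M) < d].
    rewrite openE => Q [M EM QM]; apply/nbhs_fnormP.
    exists (d - fnorm ((Q : 'M[C]_n) - M)); first by rewrite subr_gt0.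
    move=> Q' QQ'; exists M => //; apply: (le_lt_trans (fnorm_dist _ Q _)).
    by rewrite -ltrBrDr.
  apply/seteqP; split=> [Q EQ|Q [GQ [M EM QM]]]; last exact: hop EM GQ QM.
  by split; [exact: exp_image_sub|exists Q => //; rewrite subrr fnorm0].
- exists exp_image; first by apply/closed_fnormP; exact: exp_image_fclosed.
  by apply/esym/setIidPr; exact: exp_image_sub.
Qed.

End ExpSurjective.

(** * Eigenvalues, complex logarithms and the norm of principal logarithms *)

Section Eigenvalues.
Variable R : realType.
Local Notation C := R[i].
Local Notation Re := complex.Re.
Local Notation Im := complex.Im.

Lemma char_poly_conj (F : fieldType) n (V W A : 'M[F]_n) : V *m W = 1%:M ->
  char_poly (V *m A *m W) = char_poly A.
Proof.
move=> VW; rewrite /char_poly /char_poly_mx.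
have -> : 'X%:M - map_mx polyC (V *m A *m W) =
    map_mx polyC V *m ('X%:M - map_mx polyC A) *m map_mx polyC W.
  rewrite mulmxBr mulmxBl -!map_mxM; congr (_ - _).
  by rewrite mul_mx_scalar -scalemxAl -map_mxM VW map_mx1 scalemx1.
by rewrite !det_mulmx mulrAC -det_mulmx -map_mxM VW map_mx1 det1 mul1r.
Qed.

Lemma char_poly_udiag n (U : 'M[C]_n) (d : 'I_n -> C) : U \is unitarymx ->
  char_poly (udiag U d) = \prod_j ('X - (d j)%:P).
Proof.
move=> hU; rewrite udiag.unlock char_poly_conj ?unitary_adjl //.
rewrite char_poly_trig; last exact: diag_mx_is_trig.
by apply: eq_bigr => j _; rewrite !mxE eqxx mulr1n.
Qed.

(** Two factorisations of the characteristic polynomial have the same roots up to a permutation,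
    multiplicities included. This carries sums over the given list [mu] to sums over any diagonal
    form. *)
Lemma char_poly_udiag_sum n (U : 'M[C]_n) (d mu : 'I_n -> C) (f : C -> R) :
  U \is unitarymx -> char_poly (udiag U d) = \prod_j ('X - (mu j)%:P) ->
  \sum_j f (d j) = \sum_j f (mu j).
Proof.
move=> hU; rewrite char_poly_udiag // => h.
have : perm_eq [seq d j | j <- index_enum 'I_n] [seq mu j | j <- index_enum 'I_n].
  by apply: prod_XsubC_eq; rewrite !big_map.
by move=> hp; rewrite -(big_map d predT f) -(big_map mu predT f); exact: perm_big.
Qed.

Lemma eigenvalue_udiag n (U : 'M[C]_n) (d : 'I_n -> C) l : U \is unitarymx ->
  eigenvalue (udiag U d) l -> exists j, l = d j.
Proof.
move=> hU; rewrite eigenvalue_root_char char_poly_udiag //.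
rewrite -(big_map d predT (fun z => 'X - z%:P)) root_prod_XsubC => /mapP[j _ ->].
by exists j.
Qed.

Lemma udiag_eigenvalue n (U : 'M[C]_n) (d : 'I_n -> C) j : U \is unitarymx ->
  eigenvalue (udiag U d) (d j).
Proof.
move=> hU; rewrite eigenvalue_root_char char_poly_udiag //.
rewrite -(big_map d predT (fun z => 'X - z%:P)) root_prod_XsubC.
by apply: map_f; rewrite mem_index_enum.
Qed.

Lemma acos_cos (x : R) : `|x| <= pi -> acos (cos x) = `|x|.
Proof.
move=> hx; have -> : cos x = cos `|x| by have [/ger0_norm ->//|/ltr0_norm ->] := leP 0 x; rewrite cosN.
by rewrite cosK // in_itv /= normr_ge0.
Qed.

Lemma cos_itv (x : R) : -1 <= cos x <= 1.
Proof. by rewrite cos_geN1 cos_le1. Qed.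

(** The left side is the distance from [x] to the multiples of 2 pi. *)
Lemma acos_cos_le (x : R) : acos (cos x) <= `|x|.
Proof.
have [h|h] := leP `|x| pi; first by rewrite acos_cos.
exact: (le_trans (acos_lepi (cos_itv x)) (ltW h)).
Qed.

Lemma cis_acos (x : R) : exists2 a, - pi < a <= pi & cis a = cis x :> C.
Proof.
have a0 := acos_ge0 (cos_itv x); have api := acos_lepi (cos_itv x).
have ca : cos (acos (cos x)) = cos x by rewrite acosK // in_itv /= cos_itv.
have sa : sin (acos (cos x)) = `|sin x|.
  by rewrite sin_acos ?cos_itv // -sin2cos2 sqrtr_sqr.
have pi0 := pi_gt0 R.
have [s0|s0] := leP 0 (sin x).
  exists (acos (cos x)); first by rewrite api andbT; lra.
  by rewrite /cis ca sa ger0_norm.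
exists (- acos (cos x)); last by rewrite /cis cosN sinN ca sa ltr0_norm // opprK.
apply/andP; split; last lra.
(* The value -pi, which the logarithm omits, would make [sin x] vanish, whereas here it is
   negative. *)
rewrite ltrN2 lt_neqAle api andbT; apply/eqP => h.
by move: ca sa; rewrite h cospi sinpi => _ /esym/eqP; rewrite normr_eq0 lt_eqF.
Qed.

(** A logarithm of a number of modulus 1 has zero real part, and its imaginary part, being in (-pi,
    pi], is recovered from its cosine up to sign. From here on [acos] of the cosine of an eigenangle
    stands for the modulus of the logarithm. *)
Lemma clog_cis (x : R) : Re `|clog (cis x)| ^+ 2 = acos (Re (cis x)) ^+ 2.
Proof.
rewrite /clog; set S := [set w | _].
have [a ha ax] := cis_acos x.
(* The set that [clog] chooses from is inhabited, so its default value is not taken. *)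
have /(xgetPex 0) : exists w, S w.
  exists (imag a); split; last exact: ha.
  by rewrite /cexp /= expR0 !mul1r.
move: (xget 0 S) => w [hw /andP[w1 w2]].
have hr : expR (Re w) * cos (Im w) = cos x by have := congr1 (@complex.Re R) hw.
have hi : expR (Re w) * sin (Im w) = sin x by have := congr1 (@complex.Im R) hw.
have e1 : expR (Re w) ^+ 2 = 1.
  by rewrite -[LHS]mulr1 -(cos2Dsin2 (Im w)) mulrDr -!exprMn hr hi !cos2Dsin2.
have e2 : expR (Re w) = 1.
  by apply/eqP; rewrite -(@pexpr_eq1 _ _ 2) ?expR_ge0 // e1.
have w0 : Re w = 0 by apply: expR_inj; rewrite expR0.
rewrite e2 !mul1r in hr hi.
rewrite normc_norm /= -hr acos_cos; last by rewrite ler_norml ltW.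
by rewrite normc_sqr w0 expr0n add0r real_normK ?num_real.
Qed.

Section Plog.
Variables (n : nat) (G : set 'M[C]_n) (M : 'M[C]_n) (mu : 'I_n -> C).
Hypothesis hG : closed_unitary_group G.
Hypothesis hsvd : svd_closed_algebra (lie_algebra G).
Hypothesis GM : G M.
Hypothesis hmu : char_poly M = \prod_(j < n) ('X - (mu j)%:P).
Local Notation g := (lie_algebra G).

Definition log_norm : R := Num.sqrt (\sum_(j < n) Re `|clog (mu j)| ^+ 2).

Lemma log_norm_udiag (U : 'M[C]_n) (th : 'I_n -> R) : U \is unitarymx ->
  M = udiag U (fun j => cis (th j)) ->
  log_norm ^+ 2 = \sum_j acos (cos (th j)) ^+ 2.
Proof.
move=> hU ME; rewrite /log_norm sqr_sqrtr; last by apply: sumr_ge0 => j _; rewrite sqr_ge0.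
have hc := hmu; rewrite ME in hc.
rewrite -(char_poly_udiag_sum (fun z => Re `|clog z| ^+ 2) hU hc).
by apply: eq_bigr => j _; rewrite clog_cis.
Qed.

Lemma plog_fnorm X : plog g M X -> fnorm X = log_norm.
Proof.
move=> [gX eX hX]; have [U [th [hU XE]]] := skew_spectral (lie_skew hG gX).
have ME : M = udiag U (fun j => cis (th j)).
  by rewrite -eX XE -(expm_udiag _ hU) mexp.unlock.
apply/eqP; rewrite -(@eqrXn2 _ 2) ?fnorm_ge0 ?sqrtr_ge0 //.
rewrite (log_norm_udiag hU ME) XE (fnorm_udiag _ hU); apply/eqP/eq_bigr => j _.
rewrite acos_cos ?real_normK ?num_real // ler_norml.
by have := hX _ (_ : eigenvalue X (imag (th j))); apply; rewrite XE (@udiag_eigenvalue _ _ (fun j => imag (th j))).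
Qed.

(** Each eigenangle satisfies [|th| >= acos (cos th)], while the sums of squares satisfy the reverse
    inequality. So equality holds for every index, and [acos] is at most pi. *)
Lemma fnorm_le_plog X : g X -> expm X = M -> fnorm X <= log_norm -> plog g M X.
Proof.
move=> gX eX hX; split=> // l.
have [U [th [hU XE]]] := skew_spectral (lie_skew hG gX).
have ME : M = udiag U (fun j => cis (th j)).
  by rewrite -eX XE -(expm_udiag _ hU) mexp.unlock.
rewrite XE => /(eigenvalue_udiag hU)[j ->] /=; rewrite -ler_norml.
have : fnorm X ^+ 2 <= log_norm ^+ 2 by apply: lerXn2r; rewrite ?nnegrE ?fnorm_ge0 ?sqrtr_ge0.
rewrite (log_norm_udiag hU ME) XE (fnorm_udiag _ hU).
have term (k : 'I_n) : 0 <= th k ^+ 2 - acos (cos (th k)) ^+ 2.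
  rewrite subr_ge0 -(real_normK (num_real (th k))); apply: lerXn2r.
  - by rewrite nnegrE acos_ge0 ?cos_itv.
  - by rewrite nnegrE.
  - exact: acos_cos_le.
rewrite -subr_le0 -sumrB => hs.
have /(psumr_eq0P (fun k _ => term k)) : \sum_k (th k ^+ 2 - acos (cos (th k)) ^+ 2) = 0.
  by apply: le_anti; rewrite hs sumr_ge0.
move=> /(_ j isT) /eqP; rewrite subr_eq0 -(real_normK (num_real (th j))).
rewrite eqrXn2 ?acos_ge0 ?cos_itv // => /eqP ->.
exact: acos_lepi (cos_itv _).
Qed.

Lemma plog_nonempty : connected (G : set 'M[C^o]_n) -> exists X, plog g M X.
Proof.
move=> conn; have [X gX eX] := exp_surjective hG hsvd conn GM.
have [U [th [hU hth gY eY]]] := lie_expm_reduce hG hsvd gX.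
exists (udiag U (fun j => imag (th j))); split; first exact: gY.
  by rewrite mexp.unlock in eY eX; rewrite eY.
by move=> l /(eigenvalue_udiag hU)[j ->] /=; rewrite -ler_norml.
Qed.

End Plog.
End Eigenvalues.

(** * Lower bound for the length of curves *)

Section MatrixDerivative.
Variable R : realType.
Local Notation C := R[i].
Local Notation Re := complex.Re.
Local Notation Im := complex.Im.

Definition cderiv (f : R -> C) (t : R) (z : C) :=
  is_derive t 1 (fun s => Re (f s)) (Re z) /\ is_derive t 1 (fun s => Im (f s)) (Im z).

Lemma cderiv_cst (z : C) t : cderiv (fun=> z) t 0.
Proof. by split; exact: is_derive_cst. Qed.

Lemma cderivD f g t y z : cderiv f t y -> cderiv g t z -> cderiv (fun s => f s + g s) t (y + z).
Proof.
move=> [f1 f2] [g1 g2]; split.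
  rewrite ReD (_ : (fun s => _) = (fun s => Re (f s)) + (fun s => Re (g s))).
    exact: is_deriveD.
  by apply/funext => s; rewrite ReD.
rewrite ImD (_ : (fun s => _) = (fun s => Im (f s)) + (fun s => Im (g s))).
  exact: is_deriveD.
by apply/funext => s; rewrite ImD.
Qed.

Lemma cderivM f g t y z : cderiv f t y -> cderiv g t z ->
  cderiv (fun s => f s * g s) t (y * g t + f t * z).
Proof.
move=> [f1 f2] [g1 g2]; split.
  rewrite (_ : (fun s => _) = (fun s => Re (f s)) * (fun s => Re (g s))
     - (fun s => Im (f s)) * (fun s => Im (g s))); last by apply/funext => s; rewrite ReM.
  apply: (is_derive_eq (is_deriveB (is_deriveM f1 g1) (is_deriveM f2 g2))); rewrite ReD !ReM /GRing.scale /=.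
  by rewrite /cst; clear; move: (Re y) (Im y) (Re z) (Im z) (Re (f t)) (Im (f t)) (Re (g t)) (Im (g t)) => *; ring.
rewrite (_ : (fun s => _) = (fun s => Re (f s)) * (fun s => Im (g s))
   + (fun s => Im (f s)) * (fun s => Re (g s))); last by apply/funext => s; rewrite ImM.
apply: (is_derive_eq (is_deriveD (is_deriveM f1 g2) (is_deriveM f2 g1))); rewrite ImD !ImM /GRing.scale /=.
by rewrite /cst; clear; move: (Re y) (Im y) (Re z) (Im z) (Re (f t)) (Im (f t)) (Re (g t)) (Im (g t)) => *; ring.
Qed.

Lemma cderiv_conj f t z : cderiv f t z -> cderiv (fun s => (f s)^*%R) t (z^*)%R.
Proof.
move=> [f1 f2]; split.
  by rewrite ReJ (_ : (fun s => _) = (fun s => Re (f s))) //; apply/funext => s; rewrite ReJ.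
rewrite ImJ (_ : (fun s => _) = - (fun s => Im (f s))); first exact: is_deriveN.
by apply/funext => s; rewrite ImJ.
Qed.

Lemma cderiv_sum n (f : 'I_n -> R -> C) t (z : 'I_n -> C) :
  (forall i, cderiv (f i) t (z i)) ->
  cderiv (fun s => \sum_i f i s) t (\sum_i z i).
Proof.
move=> h; elim: (index_enum _) => [|i r IH].
  by rewrite big_nil (_ : (fun s => _) = fun=> 0);
    [exact: cderiv_cst|apply/funext => s; rewrite big_nil].
rewrite big_cons (_ : (fun s => _) = fun s => f i s + \sum_(j <- r) f j s).
  exact: cderivD.
by apply/funext => s; rewrite big_cons.
Qed.

Definition mderiv m n (c : R -> 'M[C]_(m, n)) (t : R) (D : 'M[C]_(m, n)) :=
  forall i j, cderiv (fun s => c s i j) t (D i j).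

Lemma mderiv_cst m n (A : 'M[C]_(m, n)) t : mderiv (fun=> A) t 0.
Proof. by move=> i j; rewrite mxE; exact: cderiv_cst. Qed.

Lemma mderiv_adj m n (c : R -> 'M[C]_(m, n)) t D : mderiv c t D ->
  mderiv (fun s => (c s)^t*) t (D^t*).
Proof.
move=> h i j; rewrite adjE (_ : (fun s => _) = fun s => ((c s j i)^*)%R).
  exact: cderiv_conj.
by apply/funext => s; rewrite adjE.
Qed.

Lemma mderivM m n p (c : R -> 'M[C]_(m, n)) (d : R -> 'M[C]_(n, p)) t D E :
  mderiv c t D -> mderiv d t E ->
  mderiv (fun s => c s *m d s) t (D *m d t + c t *m E).
Proof.
move=> hc hd i j; rewrite (_ : (fun s => _) = fun s => \sum_k c s i k * d s k j).
  rewrite !mxE -big_split /=; apply: cderiv_sum => k; exact: cderivM.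
by apply/funext => s; rewrite mxE.
Qed.

Lemma mderiv_mull m n p (A : 'M[C]_(m, n)) (d : R -> 'M[C]_(n, p)) t E :
  mderiv d t E -> mderiv (fun s => A *m d s) t (A *m E).
Proof. by move=> h; have := mderivM (mderiv_cst A t) h; rewrite mul0mx add0r. Qed.

Lemma mderiv_mulr m n p (B : 'M[C]_(n, p)) (c : R -> 'M[C]_(m, n)) t D :
  mderiv c t D -> mderiv (fun s => c s *m B) t (D *m B).
Proof. by move=> h; have := mderivM h (mderiv_cst B t); rewrite mulmx0 addr0. Qed.

Lemma mderiv_deriv_curve n (c : R -> 'M[C]_n) t D : mderiv c t D -> deriv_curve c t = D.
Proof.
move=> h; apply/matrixP => i j; rewrite mxE; have [h1 h2] := h i j.
by apply: complex_eq; rewrite /= derive1E derive_val.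
Qed.

Lemma C1_mderiv n (c : R -> 'M[C]_n) t : C1_curve c -> mderiv c t (deriv_curve c t).
Proof.
move=> h i j; rewrite mxE; have [[h1 _] [h2 _]] := h i j.
by split=> /=; rewrite derive1E; exact/derivableP.
Qed.

Lemma mderiv_uniq m n (c : R -> 'M[C]_(m, n)) t D E : mderiv c t D -> mderiv c t E -> D = E.
Proof.
move=> h1 h2; apply/matrixP => i j; have [a1 a2] := h1 i j; have [b1 b2] := h2 i j.
by apply: complex_eq; [rewrite -(@derive_val _ _ _ _ _ _ _ a1) -(@derive_val _ _ _ _ _ _ _ b1)|
 rewrite -(@derive_val _ _ _ _ _ _ _ a2) -(@derive_val _ _ _ _ _ _ _ b2)].
Qed.

Lemma mderiv_near m n (c d : R -> 'M[C]_(m, n)) t D :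
  (\forall s \near t, c s = d s) -> mderiv c t D -> mderiv d t D.
Proof.
move=> cd h i j; have [h1 h2] := h i j; split.
  apply: near_eq_is_derive h1.
  by apply: filterS cd => s ->.
apply: near_eq_is_derive h2.
by apply: filterS cd => s ->.
Qed.

Lemma mderiv_C1 n (c D : R -> 'M[C]_n) : (forall t, mderiv c t (D t)) ->
  (forall t, exists E, mderiv D t E) -> C1_curve c.
Proof.
move=> hc hD i j; split; split.
- by move=> t; have [h _] := hc t i j; exact: ex_derive.
- have -> : derive1 (fun s => Re (c s i j)) = (fun s => Re (D s i j)).
    by apply/funext => t; have [h _] := hc t i j; rewrite derive1E derive_val.
  move=> t; have [E hE] := hD t; have [h _] := hE i j.
  by apply/differentiable_continuous/derivable1_diffP; exact: ex_derive.
- by move=> t; have [_ h] := hc t i j; exact: ex_derive.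
- have -> : derive1 (fun s => Im (c s i j)) = (fun s => Im (D s i j)).
    by apply/funext => t; have [_ h] := hc t i j; rewrite derive1E derive_val.
  move=> t; have [E hE] := hD t; have [_ h] := hE i j.
  by apply/differentiable_continuous/derivable1_diffP; exact: ex_derive.
Qed.

Lemma is_derive_epsP (f : R -> R) (t l : R) :
  is_derive t 1 f l <-> forall e, 0 < e ->
    exists2 d, 0 < d & forall h, `|h| < d -> `|f (t + h) - f t - h * l| <= e * `|h|.
Proof.
split=> [hf e e0|hf].
  have := @ex_derive _ _ _ _ _ _ _ hf; rewrite /derivable => hc.
  have {hc} : h^-1 *: ((f \o shift t) (h *: 1) - f t) @[h --> 0^'] --> l.
    by rewrite -(@derive_val _ _ _ _ _ _ _ hf).
  move=> /cvgrPdist_le /(_ e e0); rewrite near_withinE => /nbhs_ballP[d /= d0 hd].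
  exists d => // h hh; have [->|h0] := eqVneq h 0.
    by rewrite addr0 subrr mul0r subr0 normr0 mulr0.
  have := hd h; rewrite /ball /= sub0r normrN => /(_ hh h0).
  rewrite [h *: 1]mulr1 [t + h]addrC => hle.
  have -> : f (h + t) - f t - h * l = - (h * (l - h^-1 * (f (h + t) - f t))).
    by rewrite mulrBr mulrA divff // mul1r opprB.
  by rewrite normrN normrM mulrC ler_wpM2r.
have hc : h^-1 *: ((f \o shift t) (h *: 1) - f t) @[h --> 0^'] --> l.
  apply/cvgrPdist_le => e e0; have [d d0 hd] := hf e e0.
  rewrite near_withinE; apply/nbhs_ballP; exists d => //= h.
  rewrite /ball /= sub0r normrN => hh h0; have := hd h hh.
  rewrite [h *: 1]mulr1 [t + h]addrC => hle.
  rewrite -(ler_pM2r (_ : 0 < `|h|)) ?normr_gt0 // -normrM.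
  rewrite -normrN -mulNr opprB mulrBl; have -> : h^-1 *: (f (h + t) - f t) * h = f (h + t) - f t.
    by rewrite /GRing.scale /= mulrAC mulVf // mul1r.
  by rewrite (mulrC l).
by apply: DeriveDef; [exact: cvgP hc|exact: cvg_lim hc].
Qed.

Lemma mderiv_eps m n (c : R -> 'M[C]_(m, n)) t D : mderiv c t D ->
  forall e, 0 < e -> exists2 d, 0 < d & forall h, `|h| < d ->
    fnorm (c (t + h) - c t - h%:C *: D) <= e * `|h|.
Proof.
move=> hc e e0; pose N : R := (m * n).+1%:R; have N0 : 0 < N by rewrite ltr0n.
(* One factor 2 for the real and imaginary parts, another to get the strict inequality of
   [fnorm_lt_entries]. *)
pose e' := e / (4 * N); have e'0 : 0 < e' by rewrite divr_gt0 // mulr_gt0.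
have hn : \forall h \near (0 : R), forall i j,
   normc ((c (t + h) - c t - h%:C *: D) i j) <= 2 * e' * `|h|.
  apply: (@filter_forall _ _ _ (nbhs (0 : R)) _) => i.
  apply: (@filter_forall _ _ _ (nbhs (0 : R)) _) => j; have [h1 h2] := hc i j.
  have [d1 d10 hd1] := (is_derive_epsP _ _ _).1 h1 e' e'0.
  have [d2 d20 hd2] := (is_derive_epsP _ _ _).1 h2 e' e'0.
  apply/nbhs_ballP; exists (Num.min d1 d2); first by rewrite /= lt_min d10.
  move=> h; rewrite /ball /= sub0r normrN lt_min => /andP[hh1 hh2].
  apply: (le_trans (normc_leD _)); rewrite !mxE !ReB !ImB ReZ ImZ.
  by have := hd1 h hh1; have := hd2 h hh2; lra.
move/nbhs_ballP : hn => [d /= d0 hd]; exists d => // h hh.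
have [->|h0] := eqVneq h 0.
  by rewrite addr0 subrr scale0r subr0 fnorm0 normr0 mulr0.
apply: ltW; apply: fnorm_lt_entries; first by rewrite mulr_gt0 ?normr_gt0.
move=> i j; apply: (le_lt_trans (hd h _ i j)); first by rewrite /ball /= sub0r normrN.
have -> : e * `|h| / (m * n).+1%:R = 4 * e' * `|h|.
  by rewrite -/N /e'; field; rewrite gt_eqF.
by rewrite ltr_pM2r ?normr_gt0 // ltr_pM2r //; lra.
Qed.

Lemma eps_mderiv m n (c : R -> 'M[C]_(m, n)) t D :
  (forall e, 0 < e -> exists2 d, 0 < d & forall h, `|h| < d ->
    fnorm (c (t + h) - c t - h%:C *: D) <= e * `|h|) -> mderiv c t D.
Proof.
move=> hc i j; split; apply/is_derive_epsP => e e0; have [d d0 hd] := hc e e0;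
  exists d => // h hh; apply: (le_trans _ (hd h hh)); apply: (le_trans _ (normc_fnorm _ i j)).
- by apply: (le_trans _ (ler_Re_normc _)); rewrite !mxE !ReB ReZ.
- by apply: (le_trans _ (ler_Im_normc _)); rewrite !mxE !ImB ImZ.
Qed.

Lemma mderiv_mexp n (X : 'M[C]_n) t : skew X ->
  mderiv (fun s => mexp (s%:C *: X)) t (X *m mexp (t%:C *: X)).
Proof.
move=> sX; apply: eps_mderiv => e e0.
have K0 : 0 <= 2 * fnorm X ^+ 2 by rewrite mulr_ge0 ?sqr_ge0.
have c0 : 0 < 2^-1 / (fnorm X + 1) by rewrite divr_gt0 // ltr_wpDl ?fnorm_ge0.
have [d [d0 d1 d2]] := small_ex K0 c0 e0; exists d; first exact: d0.
move=> h hd; have uE := expm_unitary (skewZ t sX).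
rewrite (addrC t) (expm_scaleD _ _ sX).
have -> : mexp (h%:C *: X) *m mexp (t%:C *: X) - mexp (t%:C *: X) - h%:C *: (X *m mexp (t%:C *: X))
   = (mexp (h%:C *: X) - 1%:M - h%:C *: X) *m mexp (t%:C *: X).
  by rewrite !mulmxBl mul1mx -scalemxAl.
rewrite (fnorm_unitaryr _ uE).
have hX : fnorm (h%:C *: X) <= 2^-1.
  have := le_trans (ltW hd) d1; rewrite fnormZ ler_pdivlMr ?ltr_wpDl ?fnorm_ge0 // => hs.
  by apply: (le_trans _ hs); apply: ler_wpM2l => //; rewrite lerDl.
apply: (le_trans (expm_sub1_le hX)); rewrite fnormZ exprMn.
have -> : 2 * (`|h| ^+ 2 * fnorm X ^+ 2) = (2 * fnorm X ^+ 2 * `|h|) * `|h| by ring.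
apply: ler_wpM2r => //; apply: (le_trans _ (ltW d2)); apply: ler_wpM2l => //; exact: ltW.
Qed.

End MatrixDerivative.

(** * Increments bounded by the integral of a bound on the derivative *)

Section FTC.
Variable R : realType.
Local Notation mu := (@lebesgue_measure R).

(** With [I] the primitive of [F], the difference [I - Phi] has derivative [F - dPhi >= 0], and the
    mean value theorem applies; [dPhi] itself is never integrated. *)
Lemma ftc_le (a b : R) (F Phi dPhi : R -> R) : a < b -> continuous F ->
  {within `[a, b], continuous Phi} ->
  (forall x, x \in `]a, b[%R -> is_derive x 1 Phi (dPhi x)) ->
  (forall x, x \in `]a, b[%R -> dPhi x <= F x) ->
  Phi b - Phi a <= \int[mu]_(x in `[a, b]) F x.
Proof.
move=> ab cF cPhi dP hle.
have iF (u : R) : mu.-integrable `[a, u] (EFin \o F).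
  apply: continuous_compact_integrable; first exact: segment_compact.
  exact: continuous_subspaceT.
pose I x := \int[mu]_(t in `[a, x]) F t.
have dI x : a < x -> is_derive x 1 I (F x).
  (* The integral is taken up to [x + 1] so that [x] is an interior point of the interval. *)
  move=> ax; have x1 : x < x + 1 by rewrite ltrDl.
  have [d1 d2] := continuous_FTC1_closed x1 (iF (x + 1)) ax (cF x).
  by apply: DeriveDef; [exact: d1|rewrite -derive1E].
have cI : {within `[a, b], continuous I}.
  exact: (parameterized_integral_continuous (ltW ab) (iF b)).
have Ia : I a = 0 by rewrite /I set_itv1 Rintegral_set1.
have hd x : x \in `]a, b[%R -> is_derive x 1 (I - Phi) (F x - dPhi x).
  move=> xab; apply: is_deriveB; last exact: dP.
  by apply: dI; move: xab; rewrite in_itv => /andP[].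
have hc : {within `[a, b], continuous (I - Phi)}.
  by move=> x; apply: continuousB; [exact: cI|exact: cPhi].
have [x xab hx] := MVT ab hd hc.
have : 0 <= (F x - dPhi x) * (b - a).
  by rewrite mulr_ge0 ?subr_ge0 ?hle // ltW.
by rewrite -hx !fctE Ia -/(I b); lra.
Qed.

End FTC.

(** * Angles through which eigenvectors turn along a C^1 piece *)

HB.lock Definition speed (R : realType) n (c : R -> 'M[R[i]]_n) (t : R) : R :=
  Num.sqrt (frob (deriv_curve c t) (deriv_curve c t)).

Section LengthLowerBound.
Variable R : realType.
Local Notation C := R[i].
Local Notation Re := complex.Re.
Local Notation mu := (@lebesgue_measure R).

(** With [lam = cos e], shrinking the argument of [acos] loses at most the angle [e]: when
    [acos x > e], expanding [cos (acos x - e)] gives [cos e * x] plus a product of two nonnegative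
    sines, and [cos] decreases on [0, pi]. *)
Lemma acos_cosM (e x : R) : 0 < e <= 1 -> -1 <= x <= 1 -> acos x - e <= acos (cos e * x).
Proof.
move=> /andP[e0 e1] hx; have pi2 := pi_ge2 R.
have a0 := acos_ge0 hx; have api := acos_lepi hx.
have cx : cos (acos x) = x by rewrite acosK // in_itv.
have ce := cos_itv e; have ce0 : 0 <= cos e by apply: cos_ge0_pihalf; lra.
have hy : -1 <= cos e * x <= 1.
  by move: ce hx => /andP[? ?] /andP[? ?]; apply/andP; split; nra.
have b0 := acos_ge0 hy; have bpi := acos_lepi hy.
have [ae|ae] := leP (acos x) e; first by apply: (le_trans _ b0); rewrite subr_le0.
rewrite leNgt; apply/negP => h.
have : cos (acos x - e) < cos (acos (cos e * x)).
  by rewrite ltr_cos // in_itv /=; apply/andP; split; lra.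
rewrite acosK ?in_itv // cosB cx mulrC ltNge => /negP; apply.
rewrite lerDl mulr_ge0 //.
  by rewrite sin_acos // sqrtr_ge0.
by apply: sin_ge0_pi; apply/andP; split; lra.
Qed.

Lemma fnorm_row_sum m n (A : 'M[C]_(m, n)) : \sum_j fnorm (row j A) ^+ 2 = fnorm A ^+ 2.
Proof.
rewrite fnorm_sqr_sum; apply: eq_bigr => j _; rewrite fnorm_sqr_sum big_ord1.
by apply: eq_bigr => k _; rewrite mxE.
Qed.

(* A curve [k] on the unit sphere satisfies [k' _|_ k], so [<e, k'> = <e - <e, k> k, k'>]
   with [|e - <e, k> k|^2 = 1 - <e, k>^2]. *)
Lemma unitary_diag_deriv n (K K' : 'M[C]_n) j : K \is unitarymx ->
  K' *m K^t* + K *m K'^t* = 0 ->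
  `|Re (K' j j)| <= fnorm (row j K') * Num.sqrt (1 - Re (K j j) ^+ 2).
Proof.
move=> uK h; pose e : 'rV[C]_n := delta_mx 0 j.
have row_e (A : 'M[C]_n) : ip (row j A) e = Re (A j j).
  rewrite ipE big_ord1 (bigD1 j) //= big1 => [|k kj].
    by rewrite !mxE !eqxx /= mulr1 mulr0 !addr0.
  by rewrite !mxE (negPf kj) andbF /= !mulr0 addr0.
have rows (A B : 'M[C]_n) : ip (row j A) (row j B) = Re ((A *m B^t*) j j).
  rewrite ipE big_ord1 mxE Re_sum; apply: eq_bigr => k _.
  by rewrite adjE ReM ReJ ImJ mulrN opprK !mxE.
have k0 : ip (row j K') (row j K) = 0.
  have KE : K *m K'^t* = (K' *m K^t*)^t* by rewrite adjM trmxCK.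
  rewrite rows; move: h; rewrite KE => /matrixP/(_ j j).
  by rewrite [LHS]mxE [RHS]mxE adjE => /(congr1 (@complex.Re R)); rewrite ReD ReJ /=; lra.
have kk : ip (row j K) (row j K) = 1.
  by rewrite rows unitary_adjr // mxE eqxx.
have ee : ip e e = 1.
  rewrite ipE big_ord1 (bigD1 j) //= big1 => [|k kj].
    by rewrite !mxE !eqxx /= mulr1 mulr0 !addr0.
  by rewrite !mxE (negPf kj) andbF /= !mulr0 addr0.
set g := Re (K j j).
have -> : Re (K' j j) = ip (row j K') (e - g%:C *: row j K).
  by rewrite ipBr ipZr k0 mulr0 subr0 row_e.
apply: (le_trans (ip_CauchySchwarz _ _)); apply: ler_wpM2l; first exact: fnorm_ge0.
rewrite -[leLHS]ger0_norm ?fnorm_ge0 // -sqrtr_sqr fnorm_sqr le_eqVlt; apply/orP; left.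
apply/eqP; congr Num.sqrt.
by rewrite !(ipBl, ipBr, ipZl, ipZr) kk ee (ipC e) row_e -/g expr2; ring.
Qed.

Lemma fnorm_diag_bound n (K : 'M[C]_n) j : K \is unitarymx -> -1 <= Re (K j j) <= 1.
Proof.
move=> uK; rewrite -ler_norml; apply: (le_trans (ler_Re_normc _)).
have kk : fnorm (row j K) ^+ 2 = 1.
  rewrite fnorm_sqr_sum big_ord1.
  have := congr1 (fun A : 'M[C]_n => Re (A j j)) (unitary_adjr uK).
  rewrite !mxE eqxx Re_sum /= => <-; apply: eq_bigr => k _.
  by rewrite adjE ReM ReJ ImJ mulrN opprK normc_sqr !mxE !expr2.
have := normc_fnorm (row j K) 0 j; rewrite mxE.
suff -> : fnorm (row j K) = 1 by [].
by apply/eqP; rewrite -(@pexpr_eq1 _ _ 2) ?fnorm_ge0 // kk.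
Qed.

Lemma speedE n (c : R -> 'M[C]_n) t : speed c t = fnorm (deriv_curve c t).
Proof. by rewrite speed.unlock fnorm.unlock ip.unlock. Qed.

Lemma curve_lengthE n (c : R -> 'M[C]_n) :
  curve_length c = \int[mu]_(t in `[0, 1]) speed c t.
Proof. by rewrite speed.unlock. Qed.

Lemma speed_continuous n (c : R -> 'M[C]_n) : C1_curve c -> continuous (speed c).
Proof.
move=> hc t; apply/cvgrPdist_lt => e e0; pose d := e / (n * n).+1%:R.
have d0 : 0 < d / 2 by rewrite !divr_gt0.
have hn : \forall s \near t, forall i j,
    normc ((deriv_curve c t - deriv_curve c s) i j) < d.
  apply: (@filter_forall _ _ _ (nbhs t) _) => i.
  apply: (@filter_forall _ _ _ (nbhs t) _) => j.
  have [[_ h1] [_ h2]] := hc i j.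
  have /cvgrPdist_lt/(_ _ d0) h1' := h1 t.
  have /cvgrPdist_lt/(_ _ d0) h2' := h2 t.
  near=> s; apply: le_lt_trans (normc_leD _) _.
  rewrite (splitr d) !mxE ReB ImB /=.
  by apply: ltrD; near: s.
apply: filterS hn => s hs; rewrite !speedE.
have h := @fnorm_lt_entries _ _ _ (deriv_curve c t - deriv_curve c s) e e0 hs.
apply: le_lt_trans h; rewrite ler_norml; apply/andP; split.
  rewrite lerNl opprB fnorm_distC; exact: fnorm_lerB.
exact: fnorm_lerB.
Unshelve. all: by end_near. Qed.

Lemma itv_oo_cc (x y t : R) : t \in `]x, y[%R -> t \in `[x, y]%R.
Proof. by rewrite !in_itv /= => /andP[/ltW -> /ltW ->]. Qed.

Lemma is_derive_sumf n (f : 'I_n -> R -> R) (t : R) (z : 'I_n -> R) :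
  (forall i, is_derive t 1 (f i) (z i)) ->
  is_derive t 1 (fun s => \sum_i f i s) (\sum_i z i).
Proof.
move=> h; rewrite (_ : (fun s => _) = \sum_i f i); first exact: is_derive_sum.
by apply/funext => s; rewrite fct_sumE.
Qed.

Section Piece.
Variables (n : nat) (b : R -> 'M[C]_n) (V W : 'M[C]_n) (w : 'I_n -> R) (lam s0 s1 : R).
Hypothesis s01 : s0 < s1.
Hypothesis hb : C1_curve b.
Hypotheses (uV : V \is unitarymx) (uW : W \is unitarymx).
Hypothesis ub : forall t, t \in `[s0, s1]%R -> b t \is unitarymx.
Hypothesis w0 : forall j, 0 <= w j.
Hypothesis hlam : 0 < lam < 1.

(** In the application [V = U P0^*] and [W = U^*], where the columns [v_j] of [U^*] are eigenvectors
    of [P0^* P1]. The real part of the [j]-th diagonal entry is then the cosine of the angle between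
    [v_j] and [P0^* c(t) v_j]. *)
Definition angle_sum (c : R -> 'M[C]_n) t :=
  \sum_j w j * acos (lam * Re ((V *m c t *m W) j j)).

Let K t := V *m b t *m W.
Let K' t := V *m deriv_curve b t *m W.

Lemma piece_mderiv t : mderiv K t (K' t).
Proof. by apply/mderiv_mulr/mderiv_mull/C1_mderiv. Qed.

Lemma piece_unitary t : t \in `[s0, s1]%R -> K t \is unitarymx.
Proof. by move=> /ub hu; exact: (mul_unitarymx (mul_unitarymx uV hu) uW). Qed.

Lemma piece_itv t j : t \in `[s0, s1]%R -> -1 < lam * Re (K t j j) < 1.
Proof.
move=> /piece_unitary uK; have := fnorm_diag_bound j uK.
by move: hlam => /andP[l0 l1] /andP[h1 h2]; apply/andP; split; nra.
Qed.

Let dPhi t := \sum_j w j *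
  (- (Num.sqrt (1 - (lam * Re (K t j j)) ^+ 2))^-1 * (lam * Re (K' t j j))).

Lemma piece_is_derive t : t \in `[s0, s1]%R -> is_derive t 1 (angle_sum b) (dPhi t).
Proof.
move=> ht; apply: is_derive_sumf => j; have [hK _] := piece_mderiv t j j.
have h1 : is_derive t 1 (fun s => lam * Re (K s j j)) (lam * Re (K' t j j)).
  exact: is_deriveZ.
have h2 := is_derive1_acos (piece_itv j ht).
have h3 := @is_derive1_comp R (@acos R) (fun s => lam * Re (K s j j)) t _ _ h2 h1.
exact: (@is_deriveZ _ _ _ _ (w j) _ _ _ h3).
Qed.

Lemma piece_orth t : t \in `]s0, s1[%R -> K' t *m (K t)^t* + K t *m (K' t)^t* = 0.
Proof.
move=> ht; have h1 := mderivM (piece_mderiv t) (mderiv_adj (piece_mderiv t)).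
have h2 := mderiv_cst (1%:M : 'M[C]_n) t.
apply: (mderiv_uniq h1); apply: mderiv_near h2.
have : \forall s \near t, s \in `]s0, s1[%R by exact: near_in_itvoo.
apply: filterS => s hs.
exact: (esym (unitary_adjr (piece_unitary (itv_oo_cc hs)))).
Qed.

(** For [g = Re (K t j j)], the derivative of [acos (lam g)] is at most
    [lam |g'| / sqrt (1 - lam^2 g^2)]. The factor [lam] only enlarges the root, so
    [unitary_diag_deriv] bounds this by the norm of the [j]-th row of [K']; Cauchy-Schwarz over [j]
    then produces the norm of the weights and the speed. *)
Lemma piece_dPhi_le t : t \in `]s0, s1[%R ->
  dPhi t <= Num.sqrt (\sum_j w j ^+ 2) * speed b t.
Proof.
move=> ht; have ht' : t \in `[s0, s1]%R by exact: itv_oo_cc ht.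
have uK := piece_unitary ht'; have oK := piece_orth ht.
have -> : speed b t = fnorm (K' t).
  by rewrite speedE (fnorm_unitaryr _ uW) (fnorm_unitaryl _ uV).
apply: (@le_trans _ _ (\sum_j w j * fnorm (row j (K' t)))).
  apply: ler_sum => j _; apply: ler_wpM2l; first exact: w0.
  have /andP[g1 g2] := piece_itv j ht'; have hg := unitary_diag_deriv j uK oK.
  have /andP[h1 h2] := fnorm_diag_bound j uK.
  move: (Re (K t j j)) (Re (K' t j j)) (fnorm_ge0 (row j (K' t))) g1 g2 h1 h2 hg => g g' r0 g1 g2 h1 h2 hg.
  move: (fnorm _) r0 hg => r r0 hg; move: hlam => /andP[l0 l1].
  have s_gt0 : 0 < Num.sqrt (1 - (lam * g) ^+ 2) by rewrite sqrtr_gt0; nra.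
  have le_s : Num.sqrt (1 - g ^+ 2) <= Num.sqrt (1 - (lam * g) ^+ 2).
    apply: ler_wsqrtr; rewrite lerD2l lerN2 exprMn.
    by rewrite ler_piMl ?sqr_ge0 // expr_le1 // ltW.
  rewrite mulNr -mulrN mulrC ler_pdivrMr //.
  apply: (le_trans _ (ler_wpM2l r0 le_s)); apply: (le_trans _ hg).
  rewrite -mulrN; apply: (@le_trans _ _ (lam * `|g'|)).
    by rewrite ler_pM2l // -normrN ler_norm.
  by apply: ler_piMl => //; exact: ltW.
rewrite -[leLHS]ger0_norm; last by apply: sumr_ge0 => j _; rewrite mulr_ge0 ?fnorm_ge0.
rewrite -(ler_pXn2r (n := 2)) ?nnegrE ?mulr_ge0 ?fnorm_ge0 ?sqrtr_ge0 //.
rewrite real_normK ?num_real // exprMn sqr_sqrtr; last by apply: sumr_ge0 => j _; exact: sqr_ge0.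
by rewrite -fnorm_row_sum; exact: sqr_sum_le.
Qed.

Lemma speed_integrable (c : R -> 'M[C]_n) (x y : R) : C1_curve c ->
  mu.-integrable `[x, y] (EFin \o speed c).
Proof.
move=> hc; apply: continuous_compact_integrable; first exact: segment_compact.
by apply: continuous_subspaceT; exact: speed_continuous.
Qed.

Lemma piece_bound : angle_sum b s1 - angle_sum b s0 <=
  Num.sqrt (\sum_j w j ^+ 2) * \int[mu]_(t in `[s0, s1]) speed b t.
Proof.
rewrite -RintegralZl //; last exact: speed_integrable.
apply: (@ftc_le _ _ _ _ _ dPhi) => //.
- move=> t; apply: cvgMr; exact: speed_continuous.
- apply: derivable_within_continuous => t /piece_is_derive h; exact: ex_derive.
- by move=> t ht; apply: piece_is_derive; exact: itv_oo_cc ht.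
- exact: piece_dPhi_le.
Qed.

End Piece.
End LengthLowerBound.

(** * Piecewise C^1 curves and the lower bound for their length *)

Section CurveLength.
Variable R : realType.
Local Notation C := R[i].
Local Notation mu := (@lebesgue_measure R).

Section Pieces.
Variables (n : nat) (c : R -> 'M[C]_n) (V W : 'M[C]_n) (w : 'I_n -> R) (lam : R).
Hypotheses (uV : V \is unitarymx) (uW : W \is unitarymx).
Hypothesis uc : forall t, t \in `[0, 1]%R -> c t \is unitarymx.
Hypothesis w0 : forall j, 0 <= w j.
Hypothesis hlam : 0 < lam < 1.
Local Notation angle := (angle_sum V W w lam c).
Local Notation N := (Num.sqrt (\sum_j w j ^+ 2)).

(** The invariant of the induction over the pieces. Measurability and boundedness of the speed on
    [0, x] are carried along because integrability is what allows the integrals to be added. *)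
Definition length_bounded (x : R) :=
  [/\ measurable_fun `[0, x]%classic (speed c),
      exists B, forall t, t \in `[0, x]%R -> `|speed c t| <= B &
      angle x - angle 0 <= N * \int[mu]_(t in `[0, x]) speed c t].

Lemma bounded_speed_integrable (x : R) : measurable_fun `[0, x]%classic (speed c) ->
  (exists B, forall t, t \in `[0, x]%R -> `|speed c t| <= B) ->
  mu.-integrable `[0, x] (EFin \o speed c).
Proof.
move=> mF [B hB]; apply: measurable_bounded_integrable => //.
  exact: compact_finite_measure (@segment_compact _ _ _).
exists B; split; first exact: num_real.
by move=> M BM t /= ht; apply: (le_trans (hB t ht)); exact: ltW.
Qed.

Lemma length_bounded0 : length_bounded 0.
Proof.
split; rewrite ?set_itv1 ?Rintegral_set1 ?mulr0 ?subrr //; first exact: measurable_fun_set1.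
exists (`|speed c 0|) => t; rewrite in_itv /= => /andP[h1 h2].
by have -> : t = 0 by apply: le_anti; rewrite h1 h2.
Qed.

Lemma speed_eq_oo (b : R -> 'M[C]_n) (x y t : R) : C1_curve b ->
  {in `[x, y], c =1 b} -> t \in `]x, y[%R -> speed c t = speed b t.
Proof.
move=> hb cb ht; rewrite !speedE; congr fnorm; apply: mderiv_deriv_curve.
apply: mderiv_near (C1_mderiv t hb).
have := near_in_itvoo ht; apply: filterS => s hs.
by rewrite cb //; exact: itv_oo_cc.
Qed.

Lemma length_bounded_step (x y : R) (b : R -> 'M[C]_n) : 0 <= x -> x < y -> y <= 1 ->
  C1_curve b -> {in `[x, y], c =1 b} -> length_bounded x -> length_bounded y.
Proof.
move=> x0 xy y1 hb cb [mx [B hB] hx].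
have cFb := speed_continuous hb.
have eqF t : t \in `]x, y[%R -> speed c t = speed b t by exact: speed_eq_oo.
(* The speeds of [c] and [b] agree only on the open piece; at the break point [y] the derivative of
   [c] may be arbitrary, so that point is treated apart. *)
have split_itv : `[0, y]%classic = `[0, x]%classic `|` (`]x, y[%classic `|` [set y]).
  rewrite setUitv1 ?bnd_simp //; apply: itv_bndbnd_setU; rewrite bnd_simp //.
  exact: ltW.
have mFb : measurable_fun setT (speed b) by exact: continuous_measurable_fun.
have mxy : measurable_fun `]x, y[%classic (speed c).
  apply: (eq_measurable_fun (speed b)).
    by move=> t; rewrite inE /= => ht; rewrite eqF.
  exact: measurable_funS mFb.
have my : measurable_fun `[0, y]%classic (speed c).
  rewrite split_itv; apply/measurable_funU => //.
    by apply: measurableU => //; exact: measurable_set1.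
  split; first exact: mx.
  apply/measurable_funU => //.
  split; first exact: mxy.
  exact: measurable_fun_set1.
have by_ : exists B, forall t, t \in `[0, y]%R -> `|speed c t| <= B.
  have [z zxy hz] := EVT_max (ltW xy) (continuous_subspaceT cFb).
  (* [B] bounds the speed up to [x], the maximum of [speed b] bounds it inside the piece, and the
     last value takes care of [y]. *)
  exists (Num.max B (Num.max `|speed b z| `|speed c y|)) => t.
  rewrite in_itv /= => /andP[t0 ty]; rewrite !le_max.
  have [tx|tx] := leP t x; first by rewrite hB // in_itv /= t0.
  have [ty'|ty'] := ltP t y; last first.
    by have -> : t = y; [apply: le_anti; rewrite ty ty'|rewrite lexx !orbT].
  have ht : t \in `]x, y[%R by rewrite in_itv /= tx.
  rewrite eqF // (_ : _ <= `|speed b z|) ?orbT //.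
  rewrite ger0_norm ?speedE ?fnorm_ge0 //; rewrite -!speedE.
  by apply: (le_trans (hz t (itv_oo_cc ht))); exact: ler_norm.
split; [exact: my|exact: by_|].
have iy := bounded_speed_integrable my by_.
have ixy : mu.-integrable `]x, y[ (EFin \o speed c).
  apply: integrableS iy => //; apply: subset_itv; rewrite bnd_simp //.
have := Rintegral_itvB iy (_ : (BLeft 0 <= BRight x)%O) (_ : (BRight x <= BRight y)%O).
rewrite !bnd_simp => /(_ x0 (ltW xy)) hI.
rewrite -(Rintegral_itv_bndo_bndc ixy) in hI.
have hIb : \int[mu]_(t in `]x, y[) speed c t = \int[mu]_(t in `[x, y]) speed b t.
  have ib : mu.-integrable `]x, y[ (EFin \o speed b).
    apply: integrableS (speed_integrable x y hb) => //.
    by apply: subset_itv; rewrite bnd_simp.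
  have -> : \int[mu]_(t in `]x, y[) speed c t = \int[mu]_(t in `]x, y[) speed b t.
    by congr fine; apply: eq_integral => t; rewrite inE /= => ht; rewrite eqF.
  rewrite Rintegral_itv_bndo_bndc // Rintegral_itv_obnd_cbnd //.
  apply: integrableS (speed_integrable x y hb) => //.
  by apply: subset_itv; rewrite bnd_simp.
rewrite hIb in hI.
have ub t : t \in `[x, y]%R -> b t \is unitarymx.
  move=> ht; rewrite -(cb t ht); apply: uc; move: ht; rewrite !in_itv /= => /andP[h1 h2].
  by rewrite (le_trans x0 h1) (le_trans h2 y1).
have hp := piece_bound xy hb uV uW ub w0 hlam.
have ex : angle_sum V W w lam b x = angle x by rewrite /angle_sum cb // in_itv /= lexx ltW.
have ey : angle_sum V W w lam b y = angle y by rewrite /angle_sum cb // in_itv /= lexx ltW.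
rewrite ex ey -hI mulrBr in hp.
by have := lerD hp hx; rewrite addrA !subrK.
Qed.

Lemma angle_le_length : piecewise_C1 c -> angle 1 - angle 0 <= N * curve_length c.
Proof.
move=> [k [t [t0 tk ht]]].
have mono (i j : nat) : (i <= j <= k)%N -> t i <= t j.
  elim: j => [|j IH]; first by rewrite leqn0 => /andP[/eqP ->].
  rewrite leq_eqVlt => /andP[/orP[/eqP ->//|ij] jk].
  apply: (le_trans (IH _)); first by rewrite -ltnS ij ltnW.
  by have [/ltW] := ht j jk.
have : forall i, (i <= k)%N -> length_bounded (t i).
  elim=> [|i IH] ik; first by rewrite t0; exact: length_bounded0.
  have [tt [b hb cb]] := ht i ik.
  apply: (length_bounded_step _ tt _ hb cb (IH (ltnW ik))).
    by rewrite -t0; apply: mono; rewrite leq0n ltnW.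
  by rewrite -tk; apply: mono; rewrite ik leqnn.
by move=> /(_ k (leqnn k)); rewrite tk curve_lengthE => -[].
Qed.

End Pieces.

Lemma curve_length_ge0 n (c : R -> 'M[C]_n) : 0 <= curve_length c.
Proof. by rewrite curve_lengthE; apply: Rintegral_ge0 => t _; rewrite speedE fnorm_ge0. Qed.

(** The weights are the angles [a_j = acos (cos (th j))] themselves, so the bound on the increment
    of the angle sum becomes, as [lam] tends to 1, [sum a_j^2 <= |a| L] for a curve of length [L].
    Dividing by [|a|] when it is not zero gives [|a| <= L]. *)
Lemma log_norm_le_length n (P0 P1 U : 'M[C]_n) (th : 'I_n -> R) (ev : 'I_n -> C) c :
  char_poly (P0^t* *m P1) = \prod_(j < n) ('X - (ev j)%:P) ->
  U \is unitarymx -> P0 \is unitarymx -> P0^t* *m P1 = udiag U (fun j => cis (th j)) ->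
  piecewise_C1 c -> (forall t, t \in `[0, 1]%R -> c t \is unitarymx) ->
  c 0 = P0 -> c 1 = P1 -> log_norm ev <= curve_length c.
Proof.
move=> hev uU uP0 ME pc uc c0 c1.
pose a j := acos (cos (th j)).
have a0 j : 0 <= a j by rewrite acos_ge0 ?cos_itv.
have N0 : 0 <= log_norm ev by exact: sqrtr_ge0.
have NE : log_norm ev = Num.sqrt (\sum_j a j ^+ 2).
  by rewrite -(log_norm_udiag hev uU ME) sqrtr_sqr ger0_norm.
have uV : U *m P0^t* \is unitarymx by exact: (mul_unitarymx uU (unitarymx_adj uP0)).
have uW := unitarymx_adj uU.
have L0 := curve_length_ge0 c.
have key : log_norm ev ^+ 2 - log_norm ev * curve_length c <= 0.
  apply: (@small_le0 _ _ (\sum_j a j)) => e2 e20 e21.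
  (* With [lam = cos e] each angle is off by at most [e] at both ends: at time 0 it is
     [acos lam = e] instead of 0, and at time 1 it is at least [a_j - e]. *)
  have [e ee] : exists e, e2 = 2 * e by exists (e2 / 2); rewrite mulrC divfK.
  have e0 : 0 < e by lra.
  have e1 : e < 1 by lra.
  have pi2 := pi_ge2 R.
  have e01 : 0 < e <= 1 by rewrite e0 ltW.
  have lam01 : 0 < cos e < 1.
    rewrite cos_gt0_pihalf /=; last by apply/andP; split; lra.
    by rewrite -[ltRHS]cos0 ltr_cos // in_itv /=; apply/andP; split; lra.
  have := angle_le_length uV uW uc a0 lam01 pc; rewrite -NE.
  have -> : angle_sum (U *m P0^t*) (U^t*) a (cos e) c 0 = e * \sum_j a j.
    rewrite mulr_sumr; apply: eq_bigr => j _.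
    rewrite c0 -(mulmxA U) unitary_adjl // mulmx1 unitary_adjr // mxE eqxx /= mulr1.
    by rewrite cosK; [rewrite mulrC|rewrite in_itv /=; apply/andP; split; lra].
  have : \sum_j a j ^+ 2 - e * \sum_j a j <= angle_sum (U *m P0^t*) (U^t*) a (cos e) c 1.
    rewrite mulr_sumr -sumrB; apply: ler_sum => j _.
    rewrite c1 -(mulmxA U) ME udiagK // !mxE eqxx mulr1n /=.
    have -> : a j ^+ 2 - e * a j = a j * (a j - e) by ring.
    apply: ler_wpM2l; first exact: a0.
    exact: acos_cosM e01 (cos_itv _).
  rewrite (log_norm_udiag hev uU ME) -[X in _ -> _ -> X - _ <= _]/(\sum_j a j ^+ 2) ee.
  move: (angle_sum _ _ _ _ _ 1) (log_norm ev * _) (\sum_j a j) (\sum_j a j ^+ 2) => A B S Q.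
  by lra.
have [->|Nn] := eqVneq (log_norm ev) 0; first by [].
have Np : 0 < log_norm ev by rewrite lt_def Nn.
by move: key; rewrite expr2 -mulrBr pmulr_rle0 // subr_le0.
Qed.

End CurveLength.

(** * Geodesics *)

Section Geodesics.
Variable R : realType.
Local Notation C := R[i].
Local Notation Re := complex.Re.
Local Notation Im := complex.Im.
Local Notation mu := (@lebesgue_measure R).

Lemma frobE n (A B : 'M[C]_n) : frob A B = ip A B.
Proof. by rewrite ip.unlock. Qed.

Lemma ip_herm_skew n (H S : 'M[C]_n) : H^t* = H -> skew S -> ip H S = 0.
Proof.
by move=> hH hS; have := ip_adj H S; rewrite hH hS ipNr; lra.
Qed.

Definition exp_curve n (P X : 'M[C]_n) : R -> 'M[C]_n := fun t => P *m mexp (t%:C *: X).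

Lemma exp_curve_mderiv n (P X : 'M[C]_n) t : skew X ->
  mderiv (exp_curve P X) t (exp_curve (P *m X) X t).
Proof.
by move=> sX; rewrite /exp_curve -mulmxA; exact: mderiv_mull (mderiv_mexp t sX).
Qed.

Lemma exp_curve_deriv n (P X : 'M[C]_n) : skew X ->
  deriv_curve (exp_curve P X) = exp_curve (P *m X) X.
Proof. by move=> sX; apply/funext => t; exact/mderiv_deriv_curve/exp_curve_mderiv. Qed.

Lemma exp_curve_C1 n (P X : 'M[C]_n) : skew X -> C1_curve (exp_curve P X).
Proof.
move=> sX; apply: (@mderiv_C1 _ _ _ (exp_curve (P *m X) X)) => t.
  exact: exp_curve_mderiv.
by eexists; exact: exp_curve_mderiv.
Qed.

Lemma exp_curve_C2 n (P X : 'M[C]_n) : skew X -> C2_curve (exp_curve P X).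
Proof. by move=> sX; split; rewrite ?exp_curve_deriv //; exact: exp_curve_C1. Qed.

Lemma exp_curve_piecewise_C1 n (P X : 'M[C]_n) : skew X -> piecewise_C1 (exp_curve P X).
Proof.
move=> sX; exists 1%N, (fun i => i%:R); split=> // -[|//] _; split; first exact: ltr01.
by exists (exp_curve P X); [exact: exp_curve_C1|].
Qed.

Lemma const_speed_length n (c : R -> 'M[C]_n) (v : R) :
  (forall t, t \in `[0, 1]%R -> speed c t = v) -> curve_length c = v.
Proof.
move=> hc; rewrite curve_lengthE.
have -> : \int[mu]_(t in `[0, 1]) speed c t = \int[mu]_(t in `[0, 1]) (cst v) t.
  by congr fine; apply: eq_integral => t; rewrite inE /= => ht; rewrite hc.
by rewrite Rintegral_cst //= lebesgue_measure_itv /= lte_fin ltr01 oppr0 adde0 /= mulr1.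
Qed.

Lemma exp_curve_length n (P X : 'M[C]_n) : skew X -> P \is unitarymx ->
  curve_length (exp_curve P X) = fnorm X.
Proof.
move=> sX uP; apply: const_speed_length => t _; rewrite speedE exp_curve_deriv //.
by rewrite /exp_curve (fnorm_unitaryr _ (expm_unitary (skewZ t sX))) (fnorm_unitaryl _ uP).
Qed.

Lemma const_of_deriv0 (f : R -> R) :
  (forall x : R, x \in `]0, 1[%R -> is_derive x 1 f 0) -> {within `[0, 1], continuous f} ->
  forall t, t \in `[0, 1]%R -> f t = f 0.
Proof.
move=> df cf t; rewrite in_itv /= => /andP[t0 t1].
have sub : `[0, t]%classic `<=` `[0, 1]%classic by apply: subset_itvl; rewrite bnd_simp.
have df' (x : R) : x \in `]0, t[%R -> is_derive x 1 f ((fun=> 0) x).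
  rewrite in_itv /= => /andP[x0 xt]; apply: df.
  by rewrite in_itv /= x0 (lt_le_trans xt t1).
have [x _ hx] := MVT_segment t0 df' (continuous_subspaceW sub cf).
by apply/eqP; rewrite -subr_eq0 hx mul0r.
Qed.

Lemma mderiv0_const m n (c : R -> 'M[C]_(m, n)) :
  (forall t, t \in `]0, 1[%R -> mderiv c t 0) -> (forall t, exists D, mderiv c t D) ->
  forall t, t \in `[0, 1]%R -> c t = c 0.
Proof.
move=> h0 hD t ht; apply/matrixP => i j; apply: complex_eq.
  apply: (@const_of_deriv0 (fun s => Re (c s i j))) ht.
    by move=> x /h0/(_ i j)[h _]; rewrite mxE in h.
  apply: derivable_within_continuous => x _; have [D /(_ i j)[h _]] := hD x.
  exact: ex_derive.
apply: (@const_of_deriv0 (fun s => Im (c s i j))) ht.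
  by move=> x /h0/(_ i j)[_ h]; rewrite mxE in h.
apply: derivable_within_continuous => x _; have [D /(_ i j)[_ h]] := hD x.
exact: ex_derive.
Qed.

Section Group.
Variables (n : nat) (G : set 'M[C]_n).
Hypothesis hG : closed_unitary_group G.
Local Notation g := (lie_algebra G).

Lemma exp_curve_in P X t : G P -> g X -> G (exp_curve P X t).
Proof. by move=> GP gX; apply: (groupM hG); [exact: GP|exact: lie_mexpZ]. Qed.

Lemma tangent_space_skew P Z : G P -> tangent_space G P Z -> skew (P^t* *m Z).
Proof.
move=> GP [d [C1d d0 Gd] dZ].
have hd := C1_mderiv 0 C1d; rewrite dZ in hd.
have h1 := mderivM (mderiv_adj hd) hd.
have h2 := mderiv_cst (1%:M : 'M[C]_n) (0 : R).
have : Z^t* *m d 0 + (d 0)^t* *m Z = 0.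
  apply: (mderiv_uniq h1); apply: mderiv_near h2.
  by apply: filterS Gd => s /(groupU hG) us; rewrite unitary_adjl.
rewrite d0 /skew adjM trmxCK => /eqP; rewrite addr_eq0 => /eqP ->.
by [].
Qed.

Lemma tangent_space_lie P W : G P -> g W -> tangent_space G P (P *m W).
Proof.
move=> GP gW; have sW := lie_skew hG gW; exists (exp_curve P W); last first.
  by rewrite exp_curve_deriv // /exp_curve scale0r expm0 mulmx1.
split; first exact: exp_curve_C1.
  by rewrite /exp_curve scale0r expm0 mulmx1.
by exists 1 => //= s _; exact: exp_curve_in.
Qed.

(** The second derivative is [c X^2] with [X^2] hermitian, while tangent vectors at [c] are [c]
    times a skew matrix; hermitian and skew matrices are orthogonal for the real inner product. *)
Lemma exp_curve_geodesic P X : G P -> g X -> geodesic G (exp_curve P X).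
Proof.
move=> GP gX; have sX := lie_skew hG gX; split; first exact: exp_curve_C2.
  by move=> t _; exact: exp_curve_in.
move=> t _ Z tZ; rewrite frobE !exp_curve_deriv //.
have sZ := tangent_space_skew (exp_curve_in t GP gX) tZ.
have -> : exp_curve (P *m X *m X) X t = exp_curve P X t *m (X *m X).
  rewrite /exp_curve -!mulmxA; congr (_ *m _).
  have XE : mexp (t%:C *: X) *m X = X *m mexp (t%:C *: X).
    by apply: expm_comm; rewrite -scalemxAl -scalemxAr.
  by rewrite -XE !mulmxA XE.
rewrite ipMl; apply: ip_herm_skew => //.
by rewrite adjM sX mulmxN mulNmx opprK.
Qed.

(** One side suffices because [tangent_dir] only asks for [s > 0]; at the ends of [0, 1] the curve
    is known to lie in [G] on one side only. *)
Lemma one_sided_lie (q : R -> 'M[C]_n) D (d0 : R) : 0 < d0 ->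
  (forall s, 0 < s -> s < d0 -> G (q s)) ->
  (forall e, 0 < e -> exists2 d, 0 < d & forall s, 0 < s -> s < d ->
    fnorm (q s - 1%:M - s%:C *: D) <= e * s) -> g D.
Proof.
move=> d00 Gq hq; apply: (tangent_dir_lie hG) => e e0; have [d dd0 hd] := hq e e0.
pose s := Num.min (Num.min d0 d) e / 2.
have m0 : 0 < Num.min (Num.min d0 d) e by rewrite !lt_min d00 dd0.
have s0 : 0 < s by rewrite divr_gt0.
have sm : s < Num.min (Num.min d0 d) e by rewrite /s; lra.
move: sm; rewrite !lt_min => /andP[/andP[sd0 sd] se].
by exists s, (q s); split; [exact: Gq|exact: s0|exact: ltW|exact: hd].
Qed.

Lemma curve_deriv_lie (c : R -> 'M[C]_n) t : C1_curve c -> curve_in G c ->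
  t \in `[0, 1]%R -> g ((c t)^t* *m deriv_curve c t).
Proof.
move=> hc Gc ht; have Gt := Gc t ht; have ut := groupU hG Gt.
pose q h := (c t)^t* *m c (t + h).
have hq e : 0 < e -> exists2 d, 0 < d & forall h, `|h| < d ->
    fnorm (q h - 1%:M - h%:C *: ((c t)^t* *m deriv_curve c t)) <= e * `|h|.
  move=> e0; have [d d0 hd] := mderiv_eps (mderiv_mull ((c t)^t*) (C1_mderiv t hc)) e0.
  by exists d => // h /hd; rewrite unitary_adjl.
have Gq h : t + h \in `[0, 1]%R -> G (q h).
  by move=> hh; apply: (groupM hG); [exact: (groupJ hG)|exact: Gc].
move: ht; rewrite in_itv /= => /andP[t0 t1].
have [t1'|t1'] := ltP t 1.
  apply: (@one_sided_lie q _ (1 - t)); first by rewrite subr_gt0.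
    by move=> s s0 s1; apply: Gq; rewrite in_itv /=; apply/andP; split; lra.
  move=> e /hq[d d0 hd]; exists d => // s s0 sd.
  by have := hd s; rewrite gtr0_norm //; apply.
(* Here [t = 1] and only earlier times are available, so the reversed curve is used and yields the
   opposite of the derivative. *)
rewrite -[_ *m _]opprK; apply: lieN.
apply: (@one_sided_lie (fun s => q (- s)) _ 1); first exact: ltr01.
  by move=> s s0 s1; apply: Gq; rewrite in_itv /=; apply/andP; split; lra.
move=> e /hq[d d0 hd]; exists d => // s s0 sd.
by have := hd (- s); rewrite normrN gtr0_norm // rmorphN scaleNr scalerN; apply.
Qed.

Lemma geodesic_exp_curve (c : R -> 'M[C]_n) : geodesic G c ->
  exists2 X, g X & forall t, t \in `[0, 1]%R ->
    c t = exp_curve (c 0) X t /\ deriv_curve c t = c t *m X.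
Proof.
move=> [[C1c C1c'] Gc ortho].
have hc t := C1_mderiv t C1c; have hc' t := C1_mderiv t C1c'.
have G01 t : t \in `[0, 1]%R -> G (c t) by exact: Gc.
pose A t := (c t)^t* *m deriv_curve c t.
pose A' t := (deriv_curve c t)^t* *m deriv_curve c t +
  (c t)^t* *m deriv_curve (deriv_curve c) t.
have hA t : mderiv A t (A' t) := mderivM (mderiv_adj (hc t)) (hc' t).
have gA t : t \in `[0, 1]%R -> g (A t) by exact: curve_deriv_lie.
(* [A'] is a limit of difference quotients of [A], which lie in the closed linear space [g]. *)
have gA' t : t \in `]0, 1[%R -> g (A' t).
  move=> ht; apply: (lie_closed hG) => e e0.
  have e2 : 0 < e / 2 by rewrite divr_gt0.
  have [d d0 hd] := mderiv_eps (hA t) e2.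
  move: (ht); rewrite in_itv /= => /andP[t0 t1].
  pose h := Num.min d (1 - t) / 2.
  have m0 : 0 < Num.min d (1 - t) by rewrite lt_min d0 subr_gt0.
  have h0 : 0 < h by rewrite divr_gt0.
  have : h < Num.min d (1 - t) by rewrite /h; lra.
  rewrite lt_min => /andP[hd' h1].
  have hh : `|h| < d by rewrite gtr0_norm.
  exists ((h^-1)%:C *: (A (t + h) - A t)).
    apply: lieZ; apply: (lieB hG); apply: gA; last exact: itv_oo_cc.
    by rewrite in_itv /=; apply/andP; split; lra.
  have -> : (h^-1)%:C *: (A (t + h) - A t) - A' t = (h^-1)%:C *: (A (t + h) - A t - h%:C *: A' t).
    by rewrite [RHS]scalerBr scalerA -rmorphM mulVf ?gt_eqF // scale1r.
  rewrite fnormZ gtr0_norm ?invr_gt0 // mulrC ltr_pdivrMr //.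
  apply: (le_lt_trans (hd h hh)); rewrite gtr0_norm // ltr_pM2r //; lra.
(* The geodesic equation tested on the tangent vector [c A'] removes the pairing of [A'] with
   [c^* c'']. The other term of [A'] is hermitian, hence orthogonal to the skew matrix [A']; so [A']
   is orthogonal to itself. *)
have A'0 t : t \in `]0, 1[%R -> A' t = 0.
  move=> ht; have ht' := itv_oo_cc ht; have Gt := G01 t ht'.
  apply: ip_eq0.
  have h1 := ortho t ht' _ (tangent_space_lie Gt (gA' t ht)).
  rewrite frobE ipC ipMl in h1.
  have h2 : ip (A' t) ((deriv_curve c t)^t* *m deriv_curve c t) = 0.
    rewrite ipC; apply: ip_herm_skew; first by rewrite adjM trmxCK.
    exact: (lie_skew hG (gA' t ht)).
  by rewrite [X in ip _ X]/A' ipDr h1 h2 addr0.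
have Acst t : t \in `[0, 1]%R -> A t = A 0.
  apply: mderiv0_const; last by move=> s; exists (A' s).
  by move=> s hs; rewrite -(A'0 s hs).
have in0 : (0 : R) \in `[0, 1]%R by rewrite in_itv /= lexx ler01.
have gX := gA 0 in0; have sX := lie_skew hG gX.
have c'E t : t \in `[0, 1]%R -> deriv_curve c t = c t *m A 0.
  move=> ht; rewrite -(Acst t ht) /A mulmxA unitary_adjr ?mul1mx //.
  exact: (groupU hG (G01 t ht)).
exists (A 0) => // t ht; split; last exact: c'E.
(* Uniqueness for the linear equation [c' = c A(0)]: multiplied by the inverse of the expected
   solution, the curve becomes constant. *)
pose B s := c s *m mexp (s%:C *: (- A 0)).
have hB s : mderiv B s (deriv_curve c s *m mexp (s%:C *: - A 0) +
    c s *m (- A 0 *m mexp (s%:C *: - A 0))).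
  exact: mderivM (hc s) (mderiv_mexp s (skewN sX)).
have Bt : B t = B 0.
  apply: (mderiv0_const _ _ ht) => s; last by eexists; exact: hB.
  move=> hs; have := hB s; rewrite (c'E s (itv_oo_cc hs)).
  by rewrite mulNmx mulmxN (mulmxA (c s) (A 0)) subrr.
rewrite /exp_curve; have <- : B 0 = c 0 by rewrite /B scale0r expm0 mulmx1.
rewrite -Bt /B -mulmxA.
have -> : t%:C *: - A 0 = (- t)%:C *: A 0 by rewrite scalerN rmorphN scaleNr.
by rewrite -(expm_scaleD (- t) t sX) addNr scale0r expm0 mulmx1.
Qed.

(** [X] is recovered from the right derivative at 0. The endpoint [t = 1] alone would not determine
    it, as a matrix with eigenvalue -1 can have several principal logarithms. *)
Lemma exp_curve_inj P X Y : G P -> g X -> g Y ->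
  (forall t, t \in `[0, 1]%R -> exp_curve P X t = exp_curve P Y t) -> X = Y.
Proof.
move=> GP gX gY h; apply/eqP; rewrite -subr_eq0; apply/eqP/fnorm_le0.
apply: (@small_le0 _ _ 2) => e e0 e1.
have [d1 [d10 hd1]] := expm_scale_near X e0.
have [d2 [d20 hd2]] := expm_scale_near Y e0.
pose s := Num.min 1 (Num.min d1 d2).
have s0 : 0 < s by rewrite !lt_min ltr01 d10.
have s1 : s <= 1 by rewrite ge_min lexx.
have sd1 : s <= d1 by rewrite !ge_min lexx orbT.
have sd2 : s <= d2 by rewrite !ge_min lexx !orbT.
have [_ hX] := hd1 s (ltW s0) sd1; have [_ hY] := hd2 s (ltW s0) sd2.
have EE : mexp (s%:C *: X) = mexp (s%:C *: Y).
  have hs : s \in `[0, 1]%R by rewrite in_itv /= s1 ltW.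
  have := congr1 (mulmx (P^t*)) (h s hs); rewrite /exp_curve !mulmxA.
  by rewrite (unitary_adjl (groupU hG GP)) !mul1mx.
rewrite EE in hX.
have : s * fnorm (X - Y) <= s * (2 * e).
  have -> : s * fnorm (X - Y) = fnorm (s%:C *: (X - Y)) by rewrite fnormZ gtr0_norm.
  have -> : s%:C *: (X - Y) = (mexp (s%:C *: Y) - 1%:M - s%:C *: Y) - (mexp (s%:C *: Y) - 1%:M - s%:C *: X).
    have aux (E I x y : 'M[R[i]]_n) : x - y = (E - I - y) - (E - I - x).
      by rewrite opprB [RHS]addrC (addrA _ (E - I)) subrK.
    by rewrite scalerBr; exact: aux.
  apply: (le_trans (fnormB _ _)); apply: (le_trans (lerD hY hX)).
  by rewrite le_eqVlt; apply/orP; left; apply/eqP; ring.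
by rewrite ler_pM2l.
Qed.

End Group.
End Geodesics.

(** * The distance formula and the bijection with minimizing geodesics *)

Lemma inf_eq_min (R : realType) (S : set R) (x : R) : S x -> lbound S x -> inf S = x.
Proof.
move=> Sx lx; apply: le_anti; rewrite lb_le_inf //; last by exists x.
by rewrite andbT; apply: ge_inf => //; exists x.
Qed.

Theorem theorem6p5 (R : realType) (n : nat) (G : set 'M[R[i]]_n)
    (P0 P1 : 'M[R[i]]_n) (mu : 'I_n -> R[i])
    (GU : G `<=` [set A | A \is unitarymx])
    (Gsvd : svd_closed_subgroup G)
    (Gconn : connected (G : set 'M[R[i]^o]_n))
    (GP0 : G P0) (GP1 : G P1)
    (mu_eigen : char_poly (P0^t* *m P1) = \prod_(j < n) ('X - (mu j)%:P)) :
  riem_dist G P0 P1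
    = Num.sqrt (\sum_(j < n) complex.Re `|clog (mu j)| ^+ 2) /\
  set_bij (plog (lie_algebra G) (P0^t* *m P1))
    [set segment c | c in minimizing_geodesic G P0 P1]
    (fun X => segment (fun t : R => P0 *m expm (t%:C *: X))).
Proof.
have [Ggrp Gcl hsvd] := Gsvd.
have hG : closed_unitary_group G by split.
have uP0 := groupU hG GP0.
have GM : G (P0^t* *m P1) by apply: (groupM hG); [exact: (groupJ hG)|].
have [X0 plX0] := plog_nonempty hG hsvd GM Gconn.
have curveE X : (fun t : R => P0 *m expm (t%:C *: X)) = exp_curve P0 X.
  by rewrite /exp_curve mexp.unlock.
have at0 X : exp_curve P0 X 0 = P0 by rewrite /exp_curve scale0r expm0 mulmx1.
have at1 X : expm X = P0^t* *m P1 -> exp_curve P0 X 1 = P1.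
  by move=> eX; rewrite /exp_curve scale1r mexp.unlock eX mulmxA unitary_adjr // mul1mx.
have exp_length X : plog (lie_algebra G) (P0^t* *m P1) X ->
    curve_length (exp_curve P0 X) = log_norm mu.
  move=> plX; rewrite (exp_curve_length (lie_skew hG _) uP0); last by case: plX.
  exact: plog_fnorm plX.
(* The infimum is a minimum, attained by the exponential curve of the principal logarithm [X0]. *)
have dE : riem_dist G P0 P1 = log_norm mu.
  apply: inf_eq_min.
    exists (exp_curve P0 X0); last exact: exp_length.
    have [gX0 eX0 _] := plX0; split; [exact/exp_curve_piecewise_C1/(lie_skew hG)| |exact: at0|exact: at1].
    by move=> t _; exact: (exp_curve_in hG).
  move=> _ [c [pc Gc c0 c1] <-].
  have [gX0 eX0 _] := plX0.
  (* Diagonalising the logarithm [X0] diagonalises [P0^* P1] at the same time, with eigenvalues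
     already in the form [cis (th j)]. *)
  have [U [th [uU XE]]] := skew_spectral (lie_skew hG gX0).
  apply: (log_norm_le_length mu_eigen uU uP0 _ pc _ c0 c1) => [|t ht].
    by rewrite -eX0 XE -(expm_udiag _ uU) mexp.unlock.
  exact: (groupU hG (Gc t ht)).
split; first exact: dE.
split.
- move=> X plX; rewrite curveE; have [gX eX _] := plX.
  exists (exp_curve P0 X) => //; split; [exact: (exp_curve_geodesic hG)|exact: at0|exact: at1|].
  by rewrite dE exp_length.
- move=> X Y /set_mem plX /set_mem plY.
have [gX _ _] := plX.
have [gY _ _] := plY.
move=> eXY.
have : segment (exp_curve P0 X) = segment (exp_curve P0 Y).
  by rewrite -(curveE X) -(curveE Y); exact: eXY.
move=> /(@eq_sigLP _ _ _ (exp_curve P0 X) (exp_curve P0 Y)) h.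
  apply: (exp_curve_inj hG GP0 gX gY) => t ht.
  by apply: h; rewrite inE.
- move=> _ [c [geo c0 c1 len] <-].
  have [X gX hX] := geodesic_exp_curve hG geo.
  have in1 : (1 : R) \in `[0, 1]%R by rewrite in_itv /= lexx ler01.
  have eX : expm X = P0^t* *m P1.
    have [h _] := hX 1 in1; rewrite c0 c1 in h.
    by rewrite h /exp_curve scale1r mulmxA unitary_adjl // mul1mx mexp.unlock.
  (* The speed of a geodesic is constant, so minimality of the length becomes a bound on the norm of
     [X], from which [fnorm_le_plog] confines the eigenangles to [-pi, pi]. *)
  have lX : curve_length c = fnorm X.
    apply: const_speed_length => t ht; have [_ h] := hX t ht.
    rewrite speedE h (fnorm_unitaryl X) //; apply: (groupU hG).
    by case: geo => _ + _; apply.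
  exists X; last first.
    rewrite curveE; apply/eq_sigLP => t; rewrite inE => ht.
    by have [h _] := hX t ht; rewrite h c0.
  apply: (fnorm_le_plog hG mu_eigen gX eX).
  by rewrite -lX len dE.
Qed.
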